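(* Let $p>1$ and $F(u)=\frac{1}{2p}|u^2-1|^p$. Let $N\in\mathbb{N}$, let $v:[a,b]\to\{-1,1\}$ be a piecewise constant function with exactly $N$ jumps, located at $a<h_1<h_2<\dots<h_N<b$, let $r>0$ satisfy $h_i+r<h_{i+1}-r$ for $i=1,\dots,N-1$, $a\le h_1-r$ and $h_N+r\le b$, and let $A\in(0,r\sqrt2\,\lambda_p)$. For $\varepsilon>0$ let $u^\varepsilon$ be the solution to $$u_t=\varepsilon^p(|u_x|^{p-2}u_x)_x-F'(u),\qquad x\in(a,b),\ t>0,$$ with homogeneous Neumann boundary conditions $u_x(a,t)=u_x(b,t)=0$ for $t>0$ and initial datum $u^\varepsilon(\cdot,0)=u_0^\varepsilon\in H^1(a,b)$. Assume that $$\lim_{\varepsilon\to0}\|u_0^\varepsilon-v\|_{L^1}=0$$ and that there exists a constant $C>0$ (independent of $\varepsilon$) such that $$E_\varepsilon[u_0^\varepsilon]\le Nc_p+C\exp(-Ap/2\varepsilon)\qquad\text{for all sufficiently small }\varepsilon>0.$$ Then, for any $m>0$, $$\sup_{0\le t\le m\exp(Ap/2\varepsilon)}\|u^\varepsilon(\cdot,t)-v\|_{L^1}\longrightarrow 0\qquad\text{as }\varepsilon\to0.$$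
   Context: $[a,b]$ is a fixed bounded interval and $L^1=L^1(a,b)$. The renormalized energy is $$E_\varepsilon[u]=\int_a^b\left[\frac{\varepsilon^{p-1}|u_x|^p}{p}+\frac{F(u)}{\varepsilon}\right]dx$$ (equal to $+\infty$ if the integral diverges). The constants are $$c_p=\left(\frac{p}{p-1}\right)^{\frac{p-1}{p}}\int_{-1}^{1}F(s)^{\frac{p-1}{p}}\,ds,\qquad \lambda_p=2^{1-\frac1p}(p-1)^{-\frac1p}.$$ *)

(* Defs.v *)
From HB Require Import structures.
From mathcomp Require Import all_boot all_order all_algebra.
From mathcomp Require Import all_classical all_reals all_analysis.
Import Order.TTheory GRing.Theory Num.Theory.
Import numFieldNormedType.Exports.

Set Implicit Arguments.
Unset Strict Implicit.
Unset Printing Implicit Defensive.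

Local Open Scope classical_set_scope.
Local Open Scope ring_scope.

Definition Lp_norm {R : realType} (a b q : R) (f : R -> R) : \bar R :=
  'N[@lebesgue_measure R]_(q%:E)[EFin \o (f \_ `[a, b])]%E.

Definition in_Lp {R : realType} (a b q : R) (f : R -> R) : Prop :=
  measurable_fun `[a, b] f /\ (Lp_norm a b q f < +oo)%E.

(* C^1 functions with compact support in the open interval ]a, b[. *)
Definition test_function {R : realType} (a b : R) (phi : R -> R) : Prop :=
  [/\ forall x, derivable phi x 1,
      continuous (derive1 phi)
    & exists c d, [/\ a < c, d < b & forall x, ~~ (c <= x <= d) -> phi x = 0]].

(* g is the weak derivative of u on (a, b); elements of Lebesgue and Sobolev
   spaces are represented by functions R -> R, of which only the restriction to
   [a, b], up to null sets, matters. *)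
Definition weak_derivative {R : realType} (a b : R) (u g : R -> R) : Prop :=
  [/\ (@lebesgue_measure R).-integrable `[a, b] (EFin \o u),
      (@lebesgue_measure R).-integrable `[a, b] (EFin \o g)
    & forall phi, test_function a b phi ->
        \int[@lebesgue_measure R]_(x in `[a, b]) (u x * derive1 phi x) =
        - \int[@lebesgue_measure R]_(x in `[a, b]) (g x * phi x)].

Definition in_H1 {R : realType} (a b : R) (u : R -> R) : Prop :=
  in_Lp a b 2 u /\ exists g, in_Lp a b 2 g /\ weak_derivative a b u g.

Definition potential {R : realType} (p u : R) : R :=
  (2 * p)^-1 * `|u ^+ 2 - 1| `^ p.

(* The weak derivative is unique up to null sets, so the value of the integral
   does not depend on the chosen g; functions that are not weakly differentiable
   have infinite energy. *)
Definition energy {R : realType} (a b p eps : R) (u : R -> R) : \bar R :=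
  if pselect (exists g, weak_derivative a b u g) is left wd then
    let ux := projT1 (cid wd) in
    (\int[@lebesgue_measure R]_(x in `[a, b])
       (eps `^ (p - 1) * `|ux x| `^ p / p + potential p (u x) / eps)%:E)%E
  else +oo%E.

Definition c_const {R : realType} (p : R) : R :=
  (p / (p - 1)) `^ ((p - 1) / p) *
  \int[@lebesgue_measure R]_(s in `[-1, 1]) (potential p s `^ ((p - 1) / p)).

Definition lambda_const {R : realType} (p : R) : R :=
  2 `^ (1 - p^-1) * (p - 1) `^ (- p^-1).

(* |s|^(p-2) s; since 0 `^ y = 0 for y <> 0, the value at s = 0 is 0 for every
   p > 1, also when p < 2. *)
Definition plap {R : realType} (p s : R) : R := `|s| `^ (p - 2) * s.

(* The equation at a fixed time t: w is the continuous representative of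
   u_x(., t), so that the Neumann conditions make sense pointwise, q is
   (|u_x|^(p-2) u_x)_x, and u_t is the limit in L^2(a, b) of the difference
   quotients in time. *)
Definition pde_at {R : realType} (a b p eps : R) (u : R -> R -> R) (t : R)
    : Prop :=
  exists w q : R -> R,
    [/\ {within `[a, b], continuous w},
        weak_derivative a b (u t) w,
        w a = 0 /\ w b = 0,
        weak_derivative a b (plap p \o w) q
      & Lp_norm a b 2 (fun x =>
          (u (t + h) x - u t x) / h
          - (eps `^ p * q x - derive1 (potential p) (u t x))) @[h --> 0^'] --> 0%E].

(* t |-> u t is a locally absolutely continuous curve ]0, +oo[ -> L^2(a, b). *)
Definition locally_AC_L2 {R : realType} (a b : R) (u : R -> R -> R) : Prop :=
  forall s T, 0 < s -> s < T ->
  exists2 k : R -> R,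
    (@lebesgue_measure R).-integrable `[s, T] (EFin \o k) &
    forall t1 t2, s <= t1 -> t1 <= t2 -> t2 <= T ->
      (Lp_norm a b 2 (fun x => (u t2 x - u t1 x)%R)
       <= \int[@lebesgue_measure R]_(t in `[t1, t2]) (k t)%:E)%E.

(* Strong L^2 solution, in the sense of nonlinear semigroup theory, of
   u_t = eps^p (|u_x|^(p-2) u_x)_x - F'(u) with u_x(a, t) = u_x(b, t) = 0 and
   u(., 0) = u0; the value of the solution at time t and point x is u t x. *)
Definition solution {R : realType} (a b p eps : R) (u0 : R -> R)
    (u : R -> R -> R) : Prop :=
  [/\ forall t, 0 <= t -> in_Lp a b 2 (u t),
      {ae @lebesgue_measure R, forall x, x \in `[a, b] -> u 0 x = u0 x},
      forall t, 0 <= t ->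
        Lp_norm a b 2 (fun x => u s x - u t x)
          @[s --> within [set s | 0 <= s] (nbhs t)] --> 0%E,
      locally_AC_L2 a b u
    & {ae @lebesgue_measure R, forall t, 0 < t -> pde_at a b p eps u t}].

Definition jump {R : realType} (v : R -> R) (c : R) : Prop :=
  exists l r : R, [/\ v x @[x --> c^'-] --> l, v x @[x --> c^'+] --> r & l <> r].

(* v : [a, b] -> {-1, 1} is constant on each connected component of
   [a, b] \ {h 1, ..., h N} and jumps at each of h 1, ..., h N. *)
Definition piecewise_constant {R : realType} (a b : R) (N : nat) (h : nat -> R)
    (v : R -> R) : Prop :=
  [/\ forall x, a <= x <= b -> v x = -1 \/ v x = 1,
      forall x y, a <= x -> x <= y -> y <= b ->
        (forall i, (1 <= i <= N)%N -> ~~ (x <= h i <= y)) -> v x = v y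
    & forall i, (1 <= i <= N)%N -> jump v (h i)].

(* Main.v *)
Require Import Defs.
From HB Require Import structures.
From mathcomp Require Import all_boot all_order all_algebra.
From mathcomp Require Import all_classical all_reals all_analysis.
From mathcomp Require Import measurable_realfun.
From mathcomp Require Import lra ring.
Import Order.TTheory GRing.Theory Num.Theory.
Import numFieldNormedType.Exports.
Set Implicit Arguments.
Unset Strict Implicit.
Unset Printing Implicit Defensive.
Local Open Scope classical_set_scope.
Local Open Scope ring_scope.

(** The equation is the gradient flow, in L^2(a, b), of eps times the energy,
    and the theorem says that a gradient flow which starts with almost no excess
    of energy hardly moves.  There are three steps.

    1. A lower bound ([energy_lower_bound]).  A function W that is L^1-close to v
    has energy at least N c_p - C1 exp(-A p / 2 eps).  Let Psi be the primitive of
    the slope (p' F)^(1/p'), where 1/p + 1/p' = 1.  By Young's inequality the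
    energy between two points is at least the difference of Psi(W) between them,
    and Psi increases by exactly c_p from one well to the other.  On both sides
    of a jump W comes close to opposite wells, but need not reach them, and the
    missing part of c_p has to be found in the tails, the intervals of length
    about r next to the jump.  This is done with a calibration k(x) Psi(W(x)):
    if the weight k satisfies eps |k'| Psi <= (1 - k^p') F, the part of the
    potential energy that Young's inequality with the weight k leaves over pays
    for the variation of k ([calibration]).  Close to a well, F / Psi tends to
    (p - 1) lambda_p, and the weight can start from 0 at the far end of the tail
    and approach 1 exponentially, at a rate as close as desired to
    p lambda_p / eps ([tail_near_well]).  The defect is then exponentially small;
    the factor sqrt 2 between the bound r sqrt 2 lambda_p for A and the limit
    2 r lambda_p of this argument leaves room for concrete constants, as
    0.9^3 > 1 / sqrt 2 ([decay_rate_admissible]).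

    2. Dissipation ([solution_dissipation]).  For every lam > 0 the solution
    satisfies
      |u(t) - u(0)| <= t / (2 lam) + (lam / 2) eps (E(u(0)) - E(u(t)))
    in L^2 for almost every t.  Formally, |u_t| <= 1 / (2 lam) + (lam / 2) |u_t|^2
    and |u_t|^2 is the rate at which the energy eps E decreases.  To avoid
    differentiating the energy, only the subgradient inequality is used, which
    holds at each time at which the equation does, because F(y) + y^2 / 2 is
    convex ([potential_semiconvex], [subgradient_inequality]).  It makes the flow
    expand distances at most like e^t, so that the speed is bounded on
    intervals away from t = 0 ([flow_speed_bounded]); then the energy is controlled by the increments
    of the curve and its left difference quotients by the speed, which suffices
    to integrate ([left_dini_le]).  The energy at small times does not exceed
    the initial energy, by the same inequality ([flow_initial_energy]).

    3. Conclusion ([slow_motion]).  As long as the solution stays L^1-close to v,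
    its energy is at least N c_p - C1 e^(-X) with X = A p / 2 eps, so that at most
    (C + C1) e^(-X) of energy can be dissipated.  With lam = e^X / sqrt eps, the
    solution moves by O(sqrt eps) up to the time m e^X, so that it does not leave
    the neighbourhood of v at all.

    Weak derivatives are turned into derivatives of absolutely continuous
    representatives by testing with differences of smoothed steps
    ([weak_derivative_primitive]). *)

(** * Integrals over a compact interval *)

Definition itvL1 {R : realType} (a b : R) (f : R -> R) : Prop :=
  (@lebesgue_measure R).-integrable `[a, b] (EFin \o f).

Definition itvint {R : realType} (a b : R) (f : R -> R) : R :=
  \int[@lebesgue_measure R]_(x in `[a, b]) f x.

Section interval_integrals.
Context {R : realType}.
Implicit Types (a b c d x y : R) (f g : R -> R).
Local Notation mu := (@lebesgue_measure R).

Lemma itvL1_measurable a b f : itvL1 a b f -> measurable_fun `[a, b] f.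
Proof. by move=> /measurable_int /measurable_EFinP. Qed.

Lemma itvL1_sub a b c d f : a <= c -> d <= b -> itvL1 a b f -> itvL1 c d f.
Proof.
move=> ac db; apply: integrableS => //.
by apply: subset_itv; rewrite bnd_simp.
Qed.

Lemma eq_itvL1 a b f g : (forall x, a <= x <= b -> f x = g x) ->
  itvL1 a b f -> itvL1 a b g.
Proof.
move=> fg; apply: eq_integrable => // x.
by rewrite inE /= in_itv /= => /fg ->.
Qed.

Lemma eq_itvint a b f g : (forall x, a <= x <= b -> f x = g x) ->
  itvint a b f = itvint a b g.
Proof.
by move=> fg; apply: eq_Rintegral => x; rewrite inE /= in_itv /= => /fg.
Qed.

Lemma itvL1D a b f g : itvL1 a b f -> itvL1 a b g ->
  itvL1 a b (fun x => f x + g x).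
Proof. by move=> fi gi; exact: (integrableD _ fi gi). Qed.

Lemma itvL1Z a b f k : itvL1 a b f -> itvL1 a b (fun x => k * f x).
Proof. by move=> fi; exact: (integrableZl _ k fi). Qed.

Lemma itvL1N a b f : itvL1 a b f -> itvL1 a b (fun x => - f x).
Proof. by move=> fi; exact: (integrableN fi). Qed.

Lemma itvL1B a b f g : itvL1 a b f -> itvL1 a b g ->
  itvL1 a b (fun x => f x - g x).
Proof. by move=> fi gi; exact: (integrableB _ fi gi). Qed.

Lemma itvL1_norm a b f : itvL1 a b f -> itvL1 a b (fun x => `|f x|).
Proof. by move=> fi; exact: integrable_norm. Qed.

Lemma itvL1_cst a b k : itvL1 a b (fun=> k).
Proof.
apply: measurable_bounded_integrable => //.
  by rewrite /= lebesgue_measure_itv /=; case: ifP => // _; rewrite ltry.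
by exists `|k|; split; rewrite ?num_real// => M kM x _ /=; rewrite ltW.
Qed.

Lemma le_itvL1 a b f g : measurable_fun `[a, b] f ->
  (forall x, a <= x <= b -> `|f x| <= g x) -> itvL1 a b g -> itvL1 a b f.
Proof.
move=> mf fg; apply: le_integrable => //=; first exact/measurable_EFinP.
move=> x; rewrite /= in_itv /= => /fg h; rewrite lee_fin.
by rewrite (le_trans h)// ler_norm.
Qed.

Lemma itvL1_bounded a b f M : measurable_fun `[a, b] f ->
  (forall x, a <= x <= b -> `|f x| <= M) -> itvL1 a b f.
Proof. by move=> mf fM; exact: (le_itvL1 mf fM (itvL1_cst a b M)). Qed.

Lemma itvL1M_bounded a b f g M : itvL1 a b f -> measurable_fun `[a, b] g ->
  (forall x, a <= x <= b -> `|g x| <= M) -> itvL1 a b (fun x => f x * g x).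
Proof.
move=> fi mg gM; apply: (@le_itvL1 _ _ _ (fun x => M * `|f x|)).
- by apply: measurable_funM => //; exact: itvL1_measurable.
- by move=> x /gM h; rewrite normrM mulrC ler_wpM2r.
- by apply: itvL1Z; exact: itvL1_norm.
Qed.

Lemma itvintD a b f g : itvL1 a b f -> itvL1 a b g ->
  itvint a b (fun x => f x + g x) = itvint a b f + itvint a b g.
Proof. by move=> fi gi; exact: RintegralD. Qed.

Lemma itvintB a b f g : itvL1 a b f -> itvL1 a b g ->
  itvint a b (fun x => f x - g x) = itvint a b f - itvint a b g.
Proof. by move=> fi gi; exact: RintegralB. Qed.

Lemma itvintZ a b f k : itvL1 a b f ->
  itvint a b (fun x => k * f x) = k * itvint a b f.
Proof. by move=> fi; exact: RintegralZl. Qed.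

Lemma itvintN a b f : itvL1 a b f ->
  itvint a b (fun x => - f x) = - itvint a b f.
Proof.
move=> fi; rewrite -[RHS]mulN1r -itvintZ//.
by apply: eq_itvint => x _; rewrite mulN1r.
Qed.

Lemma itvint_cst a b k : a <= b -> itvint a b (fun=> k) = k * (b - a).
Proof.
move=> ab; rewrite /itvint Rintegral_cst//= lebesgue_measure_itv /= lte_fin.
have [//|ba] := ltP a b.
by rewrite mulr0 (_ : b = a) ?subrr ?mulr0//; apply/eqP; rewrite eq_le ba ab.
Qed.

Lemma le_itvint a b f g : itvL1 a b f -> itvL1 a b g ->
  (forall x, a <= x <= b -> f x <= g x) -> itvint a b f <= itvint a b g.
Proof.
by move=> fi gi fg; apply: le_Rintegral => // x; rewrite /= in_itv /=; exact: fg.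
Qed.

Lemma itvint_ge0 a b f : (forall x, a <= x <= b -> 0 <= f x) ->
  0 <= itvint a b f.
Proof. by move=> f0; apply: Rintegral_ge0 => x; rewrite /= in_itv; apply: f0. Qed.

Lemma norm_itvint a b f : itvL1 a b f ->
  `|itvint a b f| <= itvint a b (fun x => `|f x|).
Proof. by move=> fi; exact: le_normr_Rintegral. Qed.

Lemma itvint_split a b c f : a <= b -> b <= c -> itvL1 a c f ->
  itvint a c f = itvint a b f + itvint b c f.
Proof.
move=> ab bc fi; rewrite /itvint.
have h := @Rintegral_itvB R f (BLeft a) (BRight c) b fi.
rewrite !bnd_simp in h; move/(_ ab bc) : h => /eqP.
rewrite subr_eq => /eqP ->; rewrite addrC; congr (_ + _).
rewrite Rintegral_itv_obnd_cbnd//.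
apply: (integrableS _ _ _ fi) => //.
by apply: subset_itv; rewrite bnd_simp.
Qed.

Lemma itvint_le_sub a b c d f : a <= c -> c <= d -> d <= b -> itvL1 a b f ->
  (forall x, a <= x <= b -> 0 <= f x) -> itvint c d f <= itvint a b f.
Proof.
move=> ac cd db fi f0.
rewrite (@itvint_split a c b)//; last exact: le_trans db.
rewrite (@itvint_split c d b)//; last exact: itvL1_sub fi.
have h1 : 0 <= itvint a c f.
  apply: itvint_ge0 => x /andP[ax xc]; apply: f0; rewrite ax /=.
  by rewrite (le_trans xc)// (le_trans cd).
have h2 : 0 <= itvint d b f.
  apply: itvint_ge0 => x /andP[ax xc]; apply: f0; rewrite xc andbT.
  by rewrite (le_trans _ ax)// (le_trans ac).
by rewrite addrCA lerDl addr_ge0.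
Qed.

Lemma ae_mono (P Q : R -> Prop) : (forall x, P x -> Q x) ->
  {ae mu, forall x, P x} -> {ae mu, forall x, Q x}.
Proof. by move=> PQ; apply: negligibleS => x /= nQ /PQ. Qed.

Lemma ae_and (P Q : R -> Prop) : {ae mu, forall x, P x} ->
  {ae mu, forall x, Q x} -> {ae mu, forall x, P x /\ Q x}.
Proof.
move=> hP hQ; apply: negligibleS (negligibleU hP hQ) => x /= /not_andP[]; by [left|right].
Qed.

Lemma ae_itvL1 a b f g : measurable_fun `[a, b] g ->
  {ae mu, forall x, x \in `[a, b] -> f x = g x} ->
  itvL1 a b f -> itvL1 a b g.
Proof.
move=> mg fg fi; apply/integrableP; split; first exact/measurable_EFinP.
have /integrableP[/measurable_EFinP mf] := fi; apply: le_lt_trans.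
rewrite le_eqVlt; apply/orP; left; apply/eqP; apply: ae_eq_integral => //=.
- by do 2 apply: measurableT_comp => //.
- by do 2 apply: measurableT_comp => //.
- by apply: ae_mono fg => x h /h ->.
Qed.

Lemma ae_itvint a b f g : measurable_fun `[a, b] f ->
  measurable_fun `[a, b] g ->
  {ae mu, forall x, x \in `[a, b] -> f x = g x} ->
  itvint a b f = itvint a b g.
Proof.
move=> mf mg fg; congr fine; apply: ae_eq_integral => //=.
- exact/measurable_EFinP.
- exact/measurable_EFinP.
- by apply: ae_mono fg => x h /h ->.
Qed.

Lemma continuous_itvL1 a b f : {within `[a, b], continuous f} -> itvL1 a b f.
Proof. by move=> cf; apply: continuous_compact_integrable => //; exact: segment_compact. Qed.

Lemma itvint_EFin a b f : itvL1 a b f ->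
  (\int[mu]_(x in `[a, b]) (f x)%:E)%E = (itvint a b f)%:E.
Proof. by move=> fi; rewrite /itvint /Rintegral fineK//; exact: integrable_fin_num. Qed.

Lemma null_complement_dense (N : set R) x y : mu.-negligible N -> x < y ->
  exists z, [/\ x < z, z < y & ~ N z].
Proof.
move=> N0 xy; apply: contrapT => h.
have : mu.-negligible `]x, y[%classic.
  apply: negligibleS N0 => z /=; rewrite in_itv /= => /andP[xz zy].
  by apply: contrapT => Nz; apply: h; exists z.
move/negligibleP => /(_ (measurable_itv _)).
rewrite /= lebesgue_measure_itv /= lte_fin xy => /eqP.
by rewrite -EFinD eqe subr_eq0 => /eqP yx; rewrite yx ltxx in xy.
Qed.

End interval_integrals.

(** * Integration of left Dini derivatives *)

Section left_dini_le.
Context {R : realType}.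
Local Notation mu := (@lebesgue_measure R).
Implicit Types (s T x y : R) (k f e : R -> R).

Lemma itvL1_indic s T k (U : set R) : open U -> itvL1 s T k ->
  itvL1 s T (fun x => k x * \1_U x).
Proof.
move=> oU ki; apply: (@itvL1M_bounded _ _ _ _ _ 1) => //.
  by apply: measurable_funTS; apply: measurable_indic; exact: open_measurable.
by move=> x _; rewrite indicE; case: (_ \in _); rewrite ?normr1// normr0.
Qed.

(** Outer regularity and the absolute continuity of the integral of k. *)
Lemma null_small_cover s T k (N : set R) (eta : R) :
  itvL1 s T k -> mu.-negligible N -> 0 < eta ->
  exists U : set R, [/\ open U, N `<=` U &
    itvint s T (fun x => k x * \1_U x) < eta].
Proof.
move=> ki [N' [mN' N'0 NN']] eta0.
have kri : mu.-integrable setT (EFin \o (k \_ `[s, T])).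
  by rewrite -restrict_EFin; apply/(integrable_mkcond _ _).1.
have [d [d0 hd]] := integral_normr_continuous kri eta0.
have N'oo : (mu N' < +oo)%E by rewrite N'0 ltry.
have [U [oU N'U UN']] := lebesgue_regularity_outer mN' N'oo d0.
exists U; split => //; first exact: subset_trans NN' N'U.
have mU : measurable (U : set (measurableTypeR R)) by exact: open_measurable.
have Ud : (mu U < d%:E)%E.
  rewrite -(setUIDK U N') setIidr//.
  apply: le_lt_trans UN'; rewrite -[leRHS]add0e -N'0.
  by apply: measureU2 => //; exact: measurableD.
have := hd _ mU Ud; apply: le_lt_trans.
have -> : itvint s T (fun x => k x * \1_U x) =
  \int[mu]_(x in U) (k \_ `[s, T]) x.
  rewrite /itvint Rintegral_mkcond [RHS]Rintegral_mkcond.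
  apply: eq_Rintegral => x _; rewrite /patch indicE.
  by case: (x \in U); case: (x \in _); rewrite ?mulr1 ?mulr0.
apply: (le_trans (ler_norm _)); apply: le_normr_Rintegral => //.
exact: integrableS kri.
Qed.

Lemma itvint_small_right s T k c (eta : R) : itvL1 s T k -> s <= c -> c < T ->
  0 < eta -> \forall t \near c^'+, `|itvint c t k| < eta.
Proof.
move=> ki sc cT eta0.
have kri : mu.-integrable setT (EFin \o (k \_ `[s, T])).
  by rewrite -restrict_EFin; apply/(integrable_mkcond _ _).1.
have [d [d0 hd]] := integral_normr_continuous kri eta0.
near=> t.
have ct : c < t by near: t; exact: nbhs_right_gt.
have tT : t < T by near: t; exact: nbhs_right_lt.
have td : t < c + d by near: t; apply: nbhs_right_lt; rewrite ltrDl.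
have kct : itvL1 c t k by apply: itvL1_sub ki => //; exact: ltW.
apply: (le_lt_trans (norm_itvint kct)).
have -> : itvint c t (fun x => `|k x|) =
   \int[mu]_(x in `[c, t]) `|(k \_ `[s, T]) x|.
  apply: eq_Rintegral => x; rewrite inE /= in_itv /= => /andP[cx xt].
  by rewrite /patch mem_set//= in_itv /= (le_trans sc cx)/= (le_trans xt)// ltW.
apply: hd => //.
by rewrite /= lebesgue_measure_itv /= lte_fin ct lte_fin ltrBlDl.
Unshelve. all: by end_near. Qed.

(** This integrates left difference quotients of a function f of which only the
    restriction to a dense set G is of interest: an energy along a curve, say,
    that is meaningful only at the times at which an equation holds.  The null
    set Z of bad points is covered by an open set U on which the integral of k is
    less than eta.  Going down from T, the estimate [P] below is kept inside U by
    the bound of the increments of f by k, and outside U by the bound on the left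
    difference quotients; so the infimum c of the points down to which it holds
    is s. *)
Lemma left_dini_le s T k f (G Z : set R) : s <= T -> G s -> G T ->
  itvL1 s T k -> (forall x, s <= x <= T -> 0 <= k x) ->
  mu.-negligible Z -> (forall t, s < t < T -> ~ Z t -> G t) ->
  (forall t1 t2, G t1 -> G t2 -> s <= t1 -> t1 <= t2 -> t2 <= T ->
     f t2 - f t1 <= itvint t1 t2 k) ->
  (forall t, s < t < T -> ~ Z t -> forall eta : R, 0 < eta ->
     \forall t' \near t^'-, G t' -> f t - f t' <= eta * (t - t')) ->
  f T <= f s.
Proof.
move=> sT Gs GT ki k0 Z0 GZ fk fD.
suff main (eta : R) : 0 < eta -> f T - f s <= eta * (T - s + 1).
  rewrite leNgt; apply/negP => fsT.
  have p : 0 < T - s + 1 by rewrite ltr_wpDl// subr_ge0.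
  have := main ((f T - f s) / 2 / (T - s + 1)).
  rewrite !divr_gt0 ?subr_gt0// => /(_ isT); rewrite divfK ?gt_eqF//; lra.
move=> eta0.
have Z'0 : mu.-negligible (Z `|` ([set s] `|` [set T])).
  apply: negligibleU => //; apply: negligibleU; apply/negligibleP => //;
  exact: lebesgue_measure_set1.
(* both ends are put into U, so that a point outside U is interior and in G *)
have [U [oU ZU Ueta]] := null_small_cover ki Z'0 eta0.
pose kU x := k x * \1_U x.
have kUi : itvL1 s T kU by exact: itvL1_indic.
have kU0 x : s <= x <= T -> 0 <= kU x.
  by move=> /k0 kx; rewrite mulr_ge0// indicE; case: (_ \in _).
have dens x y : s <= x -> x < y -> y <= T -> exists z, [/\ x < z, z < y & G z].
  move=> sx xy yT; have [z [xz zy /not_orP[nZ _]]] := null_complement_dense Z'0 xy.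
  by exists z; split => //; apply: GZ => //; rewrite (le_lt_trans sx xz) (lt_le_trans zy).
pose kap t := itvint t T kU.
pose P t := f T - f t <= eta * (T - t) + kap t.
have PT : P T by rewrite /P !subrr mulr0 add0r itvint_ge0// => x /andP[Tx xT];
  rewrite kU0// xT (le_trans sT Tx).
pose B := [set t | s <= t <= T /\ forall tau, t <= tau -> tau <= T -> G tau -> P tau].
have BT : B T.
  split; first by rewrite sT lexx.
  by move=> tau h1 h2 _; rewrite (_ : tau = T)//; apply/eqP; rewrite eq_le h1 h2.
have hB : has_inf B by split; [exists T|exists s => x [/andP[]]].
pose c := inf B.
have sc : s <= c by apply: lb_le_inf; [exists T|move=> x [/andP[]]].
have cT : c <= T by apply: ge_inf => //; exists s => x [/andP[]].
have Bc t : B t -> c <= t by move=> Bt; apply: ge_inf => //; exists s => x [/andP[]].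
have Pc (tau : R) : c < tau -> tau <= T -> G tau -> P tau.
  move=> ctau tauT; have [b Bb bt] := inf_lt hB.1 ctau.
  by case: Bb => _; apply => //; exact: ltW.
suff Ps : P s.
  apply: (le_trans Ps); rewrite [leRHS]mulrDr mulr1 lerD2l /kap; exact: ltW.
have step t1 t : G t1 -> G t -> P t1 -> s <= t -> t <= t1 -> t1 <= T ->
    (forall x, t <= x <= t1 -> U x) -> P t.
  move=> G1 Gt P1 st tt1 t1T tU; rewrite /P /kap.
  rewrite (itvint_split tt1 t1T)//; last exact: itvL1_sub kUi.
  have -> : itvint t t1 kU = itvint t t1 k.
    by apply: eq_itvint => x xt; rewrite /kU indicE mem_set ?mulr1//; apply: tU.
  have h1 := fk _ _ Gt G1 st tt1 t1T.
  have h2 : eta * (T - t1) <= eta * (T - t) by rewrite ler_pM2l// lerB.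
  by move: P1; rewrite /P /kap; lra.
(* inside U: a point t1 of G to the right of c, or T itself, carries the estimate
   to all points of G in a neighbourhood of c *)
have [Uc|nUc] := pselect (U c).
  have [e /= e0 he] : \forall x \near c, U x by exact: oU.
  have [t1 [ct1 t1T t1e G1 P1]] : exists t1, [/\ c <= t1, t1 <= T, t1 < c + e, G t1 & P t1].
    move: cT; rewrite le_eqVlt => /orP[/eqP cT|cT].
      by exists T; rewrite -cT lexx ltrDl e0 cT.
    have m1 : c < Num.min T (c + e) by rewrite lt_min cT ltrDl e0.
    have m2 : Num.min T (c + e) <= T by rewrite ge_min lexx.
    have [t1 [h1 h2 h3]] := dens _ _ sc m1 m2.
    move: h2; rewrite lt_min => /andP[h2 h4].
    by exists t1; rewrite (ltW h1) (ltW h2) h4; split => //; apply: Pc => //; exact: ltW.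
  have UU x : c - e < x -> x <= t1 -> U x.
    move=> cx xt; apply: he => /=; rewrite /ball_ /= ltr_norml; apply/andP; split; lra.
  have PP t : G t -> s <= t -> c - e < t -> t <= t1 -> P t.
    move=> Gt st ct tt1; apply: (step t1) => // x /andP[tx xt1].
    by apply: UU => //; exact: lt_le_trans tx.
  have [ce|ce] := ltP (c - e) s.
    by apply: PP => //; exact: le_trans ct1.
  have : B (c - e / 2).
    split; first by apply/andP; split; lra.
    move=> tau h1 h2 Gt; have [h3|h3] := leP tau t1.
      apply: PP => //; lra.
    by apply: Pc => //; exact: le_lt_trans h3.
  by move/Bc; lra.
have nZc : ~ Z c by move=> Zc; apply: nUc; apply: ZU; left.
have sc' : s < c.
  rewrite lt_neqAle sc andbT; apply/negP => /eqP sc'.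
  by apply: nUc; apply: ZU; right; left.
have cT' : c < T.
  rewrite lt_neqAle cT andbT; apply/negP => /eqP cT'.
  by apply: nUc; apply: ZU; right; right.
have scT : s < c < T by rewrite sc' cT'.
have Gc : G c by exact: GZ.
(* outside U, c is in G; the estimate passes to the limit from the right because
   the integral of k over a short interval is small *)
have PPc : P c.
  rewrite /P; apply/ler_addgt0Pr => d d0.
  have [d' /= d'0 hd'] := itvint_small_right ki sc cT' d0.
  have m1 : c < Num.min T (c + d') by rewrite lt_min cT' ltrDl d'0.
  have m2 : Num.min T (c + d') <= T by rewrite ge_min lexx.
  have [t [ct]] := dens _ _ sc m1 m2.
  rewrite lt_min => /andP[tT td'] Gt.
  have Pt := Pc _ ct (ltW tT) Gt.
  have h1 := fk _ _ Gc Gt sc (ltW ct) (ltW tT).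
  have h2 : itvint c t k < d.
    apply: le_lt_trans (ler_norm _) _; apply: hd' => //=.
    by rewrite distrC gtr0_norm ?subr_gt0// ltrBlDl.
  have h3 : kap t <= kap c.
    rewrite /kap; apply: itvint_le_sub => //; [exact: ltW|exact: ltW| |].
      exact: itvL1_sub kUi.
    by move=> x /andP[cx xT]; apply: kU0; rewrite xT (le_trans sc cx).
  have h4 : eta * (T - t) <= eta * (T - c) by rewrite ler_pM2l// lerB// ltW.
  by move: Pt; rewrite /P; lra.
have [d /= d0 hd] := fD c scT nZc eta eta0.
have : B (Num.max s (c - d / 2)).
  split; first by rewrite le_max lexx /= ge_max sT /=; lra.
  move=> tau; rewrite ge_max => /andP[h1 h2] h3 Gt.
  have [h4|] := ltP tau c; last first.
    by rewrite le_eqVlt => /orP[/eqP <-//|h4]; exact: Pc.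
  have h5 : f c - f tau <= eta * (c - tau).
    apply: hd => //=; rewrite gtr0_norm ?subr_gt0//; lra.
  have h6 : kap c <= kap tau.
    rewrite /kap; apply: itvint_le_sub => //; first exact: ltW.
      exact: itvL1_sub kUi.
    by move=> x /andP[cx xT]; apply: kU0; rewrite xT (le_trans h1 cx).
  move: PPc; rewrite /P; rewrite (_ : eta * (T - tau) = eta * (T - c) + eta * (c - tau)); last by ring.
  lra.
move/Bc; rewrite le_max => /orP[|]; lra.
Qed.

End left_dini_le.

(** * Absolutely continuous functions *)

(** The lower limit of integration is infinite because the fundamental theorem of
    calculus for integrable functions is used in that form. *)
Definition itvprim {R : realType} (s T : R) (g : R -> R) (x : R) : R :=
  \int[@lebesgue_measure R]_(t in `]-oo, x]) (g \_ `[s, T]) t.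

(** The increments are dominated by those of the integral of one function; unlike
    the formulation with disjoint intervals, this passes at once to sums,
    products, Lipschitz images, and distances between curves in L^2. *)
Definition abs_cont {R : realType} (s T : R) (f : R -> R) : Prop :=
  exists2 k, itvL1 s T k &
    forall x y, s <= x -> x <= y -> y <= T -> `|f y - f x| <= itvint x y k.

Section absolute_continuity.
Context {R : realType}.
Local Notation mu := (@lebesgue_measure R).
Implicit Types (s T x y : R) (k f g e : R -> R).

Lemma itvL1_restrict s T g : itvL1 s T g ->
  mu.-integrable setT (EFin \o (g \_ `[s, T])).
Proof. by move=> gi; rewrite -restrict_EFin; apply/(integrable_mkcond _ _).1. Qed.

Lemma itvprimB s T g x y : itvL1 s T g -> s <= x -> x <= y -> y <= T ->
  itvprim s T g y - itvprim s T g x = itvint x y g.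
Proof.
move=> gi sx xy yT; rewrite /itvprim.
have gi' : mu.-integrable `]-oo, y] (EFin \o (g \_ `[s, T])).
  by apply: (integrableS _ _ _ (itvL1_restrict gi)).
have := @Rintegral_itvB R (g \_ `[s, T]) -oo%O (BRight y) x gi'.
rewrite !bnd_simp => -> //; rewrite Rintegral_itv_obnd_cbnd; last first.
  by apply: (integrableS _ _ _ (itvL1_restrict gi)).
apply: eq_Rintegral => z; rewrite inE /= in_itv /= => /andP[xz zy].
by rewrite /patch mem_set//= in_itv /= (le_trans sx xz) (le_trans zy yT).
Qed.

Lemma itvprim_is_derive s T g : itvL1 s T g ->
  {ae mu, forall x, s < x < T -> is_derive x 1 (itvprim s T g) (g x)}.
Proof.
move=> gi; have gr := itvL1_restrict gi.
have h1 y : mu.-integrable `]-oo, y] (EFin \o (g \_ `[s, T])).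
  exact: (integrableS _ _ _ gr).
have h2 := open_integrable_locally openT gr.
apply: ae_mono (FTC1Ny h1 h2) => x [dx ex] /andP[sx xT].
apply: DeriveDef; first exact: dx.
rewrite -derive1E ex /patch mem_set//= in_itv /=; by rewrite !ltW.
Qed.

Lemma abs_cont_itvprim s T g : itvL1 s T g -> abs_cont s T (itvprim s T g).
Proof.
move=> gi; exists (fun x => `|g x|); first exact: itvL1_norm.
move=> x y sx xy yT; rewrite itvprimB//; apply: norm_itvint.
exact: itvL1_sub gi.
Qed.

Lemma abs_cont_ge0 s T f : abs_cont s T f -> exists k,
  [/\ itvL1 s T k, forall x, 0 <= k x &
    forall x y, s <= x -> x <= y -> y <= T -> `|f y - f x| <= itvint x y k].
Proof.
move=> [k ki fk]; exists (fun x => `|k x|); split=> //.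
  exact: itvL1_norm.
move=> x y sx xy yT; apply: (le_trans (fk _ _ sx xy yT)).
have kxy : itvL1 x y k by exact: itvL1_sub ki.
by apply: le_itvint => //; [exact: itvL1_norm|move=> z _; exact: ler_norm].
Qed.

Lemma abs_cont_sub s T s' T' f : s <= s' -> T' <= T -> abs_cont s T f ->
  abs_cont s' T' f.
Proof.
move=> ss TT [k ki fk]; exists k; first exact: itvL1_sub ki.
by move=> x y sx xy yT; apply: fk => //; [exact: le_trans sx|exact: le_trans TT].
Qed.

Lemma eq_abs_cont s T f g : (forall x, s <= x <= T -> f x = g x) ->
  abs_cont s T f -> abs_cont s T g.
Proof.
move=> fg [k ki fk]; exists k => // x y sx xy yT.
rewrite -!fg ?(le_trans sx xy)// ?yT ?sx ?(le_trans xy yT)//; exact: fk.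
Qed.

Lemma abs_cont_bounded s T f : abs_cont s T f ->
  exists M, 0 <= M /\ forall x, s <= x <= T -> `|f x| <= M.
Proof.
move=> /abs_cont_ge0[k [ki k0 fk]]; exists (`|f s| + itvint s T k); split.
  by rewrite addr_ge0// itvint_ge0.
move=> x /andP[sx xT]; rewrite -[f x](subrK (f s)) addrC.
apply: (le_trans (ler_normD _ _)); rewrite lerD2l.
by apply: (le_trans (fk _ _ _ _ _)) => //; apply: itvint_le_sub.
Qed.

Lemma abs_contM s T f g : abs_cont s T f -> abs_cont s T g ->
  abs_cont s T (fun x => f x * g x).
Proof.
move=> fa ga; have [M [M0 fM]] := abs_cont_bounded fa.
have [N [N0 gN]] := abs_cont_bounded ga.
move: fa ga => /abs_cont_ge0[k [ki k0 fk]] /abs_cont_ge0[l [li l0 gl]].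
exists (fun x => N * k x + M * l x).
  by apply: itvL1D; exact: itvL1Z.
move=> x y sx xy yT.
have kxy : itvL1 x y k by exact: itvL1_sub ki.
have lxy : itvL1 x y l by exact: itvL1_sub li.
rewrite itvintD ?itvintZ//; [|exact: itvL1Z|exact: itvL1Z].
have -> : f y * g y - f x * g x = g y * (f y - f x) + f x * (g y - g x) by ring.
apply: (le_trans (ler_normD _ _)); rewrite !normrM lerD// ler_pM//.
- by apply: gN; rewrite (le_trans sx xy).
- exact: fk.
- by apply: fM; rewrite sx (le_trans xy).
- exact: gl.
Qed.

Lemma abs_contD s T f g : abs_cont s T f -> abs_cont s T g ->
  abs_cont s T (fun x => f x + g x).
Proof.
move=> [k ki fk] [l li gl]; exists (fun x => k x + l x); first exact: itvL1D.
move=> x y sx xy yT.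
rewrite itvintD; [|exact: itvL1_sub ki|exact: itvL1_sub li].
rewrite opprD addrACA; apply: (le_trans (ler_normD _ _)).
by rewrite lerD ?fk ?gl.
Qed.

Lemma abs_cont_lipschitz s T f L :
  (forall x y, s <= x -> x <= y -> y <= T -> `|f y - f x| <= L * (y - x)) ->
  abs_cont s T f.
Proof.
move=> fL; exists (fun=> L); first exact: itvL1_cst.
by move=> x y sx xy yT; rewrite itvint_cst// fL.
Qed.

Lemma abs_cont_cst s T (c : R) : abs_cont s T (fun=> c).
Proof.
by apply: (@abs_cont_lipschitz _ _ _ 0) => x y _ _ _; rewrite subrr normr0 mul0r.
Qed.

Lemma abs_contN s T f : abs_cont s T f -> abs_cont s T (fun x => - f x).
Proof.
move=> [k ki fk]; exists k => // x y sx xy yT.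
by rewrite -opprD normrN fk.
Qed.

Lemma abs_contB s T f g : abs_cont s T f -> abs_cont s T g ->
  abs_cont s T (fun x => f x - g x).
Proof. by move=> fa ga; apply: abs_contD => //; exact: abs_contN. Qed.

Lemma abs_cont_comp s T f (h : R -> R) L : 0 <= L -> abs_cont s T f ->
  (forall x y, s <= x <= T -> s <= y <= T ->
     `|h (f y) - h (f x)| <= L * `|f y - f x|) ->
  abs_cont s T (h \o f).
Proof.
move=> L0 [k ki fk] hL; exists (fun x => L * k x); first exact: itvL1Z.
move=> x y sx xy yT; rewrite itvintZ; last exact: itvL1_sub ki.
apply: (le_trans (hL _ _ _ _)); rewrite ?sx ?yT ?(le_trans xy yT) ?(le_trans sx xy)//.
by rewrite ler_wpM2l// fk.
Qed.

Lemma abs_cont_uniform s T f (eta : R) : abs_cont s T f -> 0 < eta ->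
  exists2 d : R, 0 < d & forall x y, s <= x <= T -> s <= y <= T ->
    `|y - x| < d -> `|f y - f x| < eta.
Proof.
move=> /abs_cont_ge0[k [ki k0 fk]] eta0.
have [d [d0 hd]] := integral_normr_continuous (itvL1_restrict ki) eta0.
exists d => //.
suff H x y : s <= x <= T -> s <= y <= T -> x <= y -> `|y - x| < d ->
    `|f y - f x| < eta.
  move=> x y xs ys; have [xy|/ltW yx] := leP x y; first exact: H.
  by move=> h; rewrite distrC; apply: H => //; rewrite distrC.
move=> /andP[sx xT] /andP[sy yT] xy yxd.
apply: (le_lt_trans (fk _ _ sx xy yT)).
have -> : itvint x y k = \int[mu]_(t in `[x, y]) `|(k \_ `[s, T]) t|.
  apply: eq_Rintegral => z; rewrite inE /= in_itv /= => /andP[xz zy].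
  by rewrite /patch mem_set ?ger0_norm//= in_itv /= (le_trans sx xz) (le_trans zy yT).
apply: hd => //; rewrite /= lebesgue_measure_itv /= lte_fin.
case: ifP => [xy'|_]; last by rewrite lte_fin.
by rewrite lte_fin -(gtr0_norm (_ : 0 < y - x)) ?subr_gt0.
Qed.

Lemma abs_cont_continuous s T f : abs_cont s T f ->
  {within `[s, T], continuous f}.
Proof.
move=> fa; apply/subspace_continuousP => x /=; rewrite in_itv /= => xs.
apply/cvgrPdist_lt => eta eta0; have [d d0 hd] := abs_cont_uniform fa eta0.
rewrite /prop_near1 /within /=; exists d => //= y xyd.
by rewrite in_itv /= => ys; rewrite distrC hd// distrC.
Qed.

(** The difference of f and the primitive of e has a nonpositive derivative almost
    everywhere, and [left_dini_le] integrates it: no differentiability theorem for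
    absolutely continuous functions is involved. *)
Lemma abs_cont_le s T f e : s <= T -> abs_cont s T f -> itvL1 s T e ->
  {ae mu, forall x, s < x < T -> exists2 l, is_derive x 1 f l & l <= e x} ->
  f T - f s <= itvint s T e.
Proof.
move=> sT fa ei fe; pose E := itvprim s T e.
have Ea := abs_cont_itvprim ei.
have /abs_cont_ge0[k [ki k0 gk]] := abs_contB fa Ea.
suff : f T - E T <= f s - E s by rewrite -(itvprimB ei)// /E; lra.
pose Z : set R := ~` [set x | (s < x < T -> exists2 l, is_derive x 1 f l & l <= e x) /\
  (s < x < T -> is_derive x 1 E (e x))].
have Z0 : mu.-negligible Z := ae_and fe (itvprim_is_derive ei).
apply: (@left_dini_le R s T k (fun x => f x - E x) setT Z sT I I ki (fun x _ => k0 x) Z0) => //.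
  move=> t1 t2 _ _ st tt tT; apply: le_trans (gk _ _ st tt tT).
  exact: ler_norm.
move=> t st /contrapT[/(_ st)[l fl le] /(_ st) El] eta eta0.
have dfl : is_derive t 1 (fun x => f x - E x) (l - e t) by exact: is_deriveB.
have [/cvg_ex[d dl] ed] := dfl.
have {ed} dE : d = l - e t.
  by rewrite -ed; apply/esym/cvg_lim => //; exact: Rhausdorff.
have d0 : d <= 0 by rewrite dE subr_le0.
move: dl => /cvgrPdist_lt /(_ _ eta0) [rr /= rr0 hr].
exists rr => //= t' tt' t't _.
have tt0 : 0 < t - t' by rewrite subr_gt0.
have h1 : ball_ [eta Num.Def.normr] 0 rr (t' - t) by rewrite /ball_ /= sub0r normrN distrC.
have h2 : t' - t != 0 by rewrite subr_eq0 lt_eqF.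
have := hr _ h1 h2; rewrite [(t' - t)%:A]mulr1 subrK => /ltr_normlP.
set q := (_ *: _)%R => -[hq _].
have -> : f t - E t - (f t' - E t') = q * (t - t').
  rewrite /q /GRing.scale /= mulrAC -(opprB t' t) mulrN mulVf// mulN1r; ring.
have q1 : q <= eta by lra.
by rewrite ler_pM2r.
Qed.

Lemma abs_cont_ftc s T f e : s <= T -> abs_cont s T f -> itvL1 s T e ->
  {ae mu, forall x, s < x < T -> is_derive x 1 f (e x)} ->
  f T - f s = itvint s T e.
Proof.
move=> sT fa ei fe; apply/eqP; rewrite eq_le; apply/andP; split.
  by apply: abs_cont_le => //; apply: ae_mono fe => x h /h; exists (e x).
rewrite -lerN2 -itvintN// opprB.
have h : {ae mu, forall x, s < x < T ->
    exists2 l, is_derive x 1 (fun x => - f x) l & l <= - e x}.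
  by apply: ae_mono fe => x h /h d; exists (- e x) => //; exact: is_deriveN.
by have := abs_cont_le sT (abs_contN fa) (itvL1N ei) h; rewrite opprK addrC.
Qed.

End absolute_continuity.

(** * Smoothed steps *)

Section bumps.
Context {R : realType}.
Implicit Types x y z r c : R.

Lemma is_derive_cvg (f : R -> R) x l :
  h^-1 *: (f (h *: 1 + x) - f x) @[h --> 0^'] --> l -> is_derive x 1 f l.
Proof.
move=> h; apply: DeriveDef; first by apply/cvg_ex; exists l.
by apply/cvg_lim => //; exact: Rhausdorff.
Qed.

Lemma is_derive_continuous (f : R -> R) x l : is_derive x 1 f l ->
  {for x, continuous f}.
Proof.
by move=> [d _]; apply: differentiable_continuous; exact/derivable1_diffP.
Qed.

Lemma is_derive_mvt (f f' : R -> R) x y : (forall z, is_derive z 1 f (f' z)) ->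
  x <= y -> exists2 c, x <= c <= y & f y - f x = f' c * (y - x).
Proof.
move=> df xy; have cf : {within `[x, y], continuous f}.
  by apply: continuous_subspaceT => z; exact: is_derive_continuous (df z).
have [c cxy ->] := MVT_segment xy (fun z _ => df z) cf.
by exists c => //; rewrite in_itv /= in cxy.
Qed.

Lemma is_derive_quad (f : R -> R) x l C :
  (forall y, `|f y - f x - l * (y - x)| <= C * (y - x) ^+ 2) ->
  is_derive x 1 f l.
Proof.
move=> fC.
apply: is_derive_cvg; apply/cvgrPdist_lt => e e0; near=> h.
have h0 : h != 0 by near: h; exact: nbhs_dnbhs_neq.
have C1 : 0 < `|C| + 1 by rewrite ltr_wpDl.
have hC : `|h| < e / (`|C| + 1).
  near: h; apply: dnbhs0_lt; by rewrite divr_gt0.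
rewrite [h *: 1]mulr1.
have := fC (h + x); rewrite addrK => hb.
have -> : l - h^-1 *: (f (h + x) - f x) = - (h^-1 * (f (h + x) - f x - l * h)).
  by rewrite /GRing.scale /= [in RHS]mulrBr mulrCA mulVf// mulr1 opprB.
rewrite normrN normrM normfV ltr_pdivrMl ?normr_gt0//.
apply: (le_lt_trans hb); rewrite -real_normK ?num_real// expr2 mulrA mulrC.
rewrite ltr_pM2l ?normr_gt0//; apply: (@le_lt_trans _ _ ((`|C| + 1) * `|h|)).
  by rewrite ler_wpM2r// (le_trans (ler_norm _))// lerDl.
by rewrite mulrC -ltr_pdivlMr.
Unshelve. all: by end_near. Qed.

Definition pos_part x : R := (x + `|x|) / 2.

Lemma pos_partP x : (0 <= x /\ pos_part x = x) \/ (x <= 0 /\ pos_part x = 0).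
Proof.
rewrite /pos_part; have [x0|x0] := ger0P x; [left|right].
  split => //; lra.
by split; [exact: ltW|lra].
Qed.

Lemma continuous_pos_part c : continuous (fun z => pos_part (z - c)).
Proof.
move=> z; apply: cvgM; last exact: cvg_cst.
have h : (fun z : R => z - c) @ z --> z - c.
  by apply: cvgB; [exact: cvg_id|exact: cvg_cst].
by apply: cvgD => //; exact: (cvg_norm h).
Qed.

Lemma is_derive_sqr_pos_part c z :
  is_derive z 1 (fun z => pos_part (z - c) ^+ 2) (2 * pos_part (z - c)).
Proof.
apply: (@is_derive_quad _ _ _ 1) => y; rewrite mul1r.
have -> : y - z = (y - c) - (z - c) by ring.
move: (y - c) (z - c) => u v.
have [[u0 ->]|[u0 ->]] := pos_partP u; have [[v0 ->]|[v0 ->]] := pos_partP v.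
all: have h1 := sqr_ge0 u; have h2 := sqr_ge0 v; have h3 := sqr_ge0 (u - v).
- rewrite ler_norml; apply/andP; split; lra.
- have h4 := mulr_ge0_le0 u0 v0; rewrite ler_norml; apply/andP; split; lra.
- have h4 := mulr_le0_ge0 u0 v0; rewrite ler_norml; apply/andP; split; lra.
- rewrite ler_norml; apply/andP; split; lra.
Qed.

(** A C^1 step from 0 to 1 on [x - r, x + r], whose derivative is the tent of
    integral 1; positive parts replace a definition by cases. *)
Definition ramp x r z : R :=
  (pos_part (z - (x - r)) ^+ 2 - 2 * pos_part (z - x) ^+ 2
   + pos_part (z - (x + r)) ^+ 2) / (2 * r ^+ 2).

Definition tent x r z : R :=
  (pos_part (z - (x - r)) - 2 * pos_part (z - x) + pos_part (z - (x + r)))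
  / r ^+ 2.

Lemma is_derive_ramp x r z : 0 < r -> is_derive z 1 (ramp x r) (tent x r z).
Proof.
move=> r0; pose f1 := fun z => pos_part (z - (x - r)) ^+ 2.
pose f2 := fun z => pos_part (z - x) ^+ 2.
pose f3 := fun z => pos_part (z - (x + r)) ^+ 2.
have d1 : is_derive z 1 f1 _ := is_derive_sqr_pos_part _ _.
have d2 : is_derive z 1 f2 _ := is_derive_sqr_pos_part _ _.
have d3 : is_derive z 1 f3 _ := is_derive_sqr_pos_part _ _.
have -> : ramp x r = (2 * r ^+ 2)^-1 \*: (f1 + (-2 \*: f2) + f3).
  apply/funext => t; rewrite /ramp /f1 /f2 /f3 /= !fctE /GRing.scale /=.
  by rewrite mulrC; congr (_ * _); rewrite /GRing.scale /=; ring.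
apply: is_derive_eq; rewrite /tent /GRing.scale /=.
by field; rewrite gt_eqF.
Qed.

Lemma continuous_tent x r : continuous (tent x r).
Proof.
move=> z; apply: cvgM; last exact: cvg_cst.
apply: cvgD; last exact: continuous_pos_part.
apply: cvgB; first exact: continuous_pos_part.
by apply: cvgM; [exact: cvg_cst|exact: continuous_pos_part].
Qed.

(* the three positive parts in a tent or a step *)
Local Ltac pos_part_cases x r z :=
  have [[? ->]|[? ->]] := pos_partP (z - (x - r));
  have [[? ->]|[? ->]] := pos_partP (z - x);
  have [[? ->]|[? ->]] := pos_partP (z - (x + r)).

Lemma tent_ge0 x r z : 0 < r -> 0 <= tent x r z.
Proof.
move=> r0; apply: divr_ge0; last by rewrite exprn_ge0// ltW.
pos_part_cases x r z; lra.
Qed.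

Lemma tent_le x r z : 0 < r -> tent x r z <= r^-1.
Proof.
move=> r0; rewrite /tent ler_pdivrMr ?exprn_gt0//.
have -> : r^-1 * r ^+ 2 = r by field; rewrite gt_eqF.
pos_part_cases x r z; lra.
Qed.

Lemma tent_out x r z : 0 < r -> r <= `|z - x| -> tent x r z = 0.
Proof.
move=> r0 h; suff -> : tent x r z = 0 / r ^+ 2 by rewrite mul0r.
congr (_ / _); move: h; have [h|h] := ger0P (z - x) => h2.
all: pos_part_cases x r z; lra.
Qed.

Lemma ramp_left x r z : 0 < r -> z <= x - r -> ramp x r z = 0.
Proof.
move=> r0 h; rewrite /ramp.
pos_part_cases x r z; try (exfalso; lra).
  have -> : z - (x - r) = 0 by lra.
  by rewrite !expr0n/= mulr0 subrr addr0 mul0r.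
by rewrite !expr0n/= mulr0 subrr addr0 mul0r.
Qed.

Lemma ramp_right x r z : 0 < r -> x + r <= z -> ramp x r z = 1.
Proof.
move=> r0 h; rewrite /ramp.
pos_part_cases x r z; try (exfalso; lra).
  by field; rewrite gt_eqF.
have -> : z = x + r by lra.
by field; rewrite gt_eqF.
Qed.

End bumps.

(** * Weak derivatives *)

Section weak_derivatives.
Context {R : realType}.
Local Notation mu := (@lebesgue_measure R).
Implicit Types (a b s T x y z r : R) (f g u : R -> R).

Lemma abs_cont_itvL1 s T f : abs_cont s T f -> itvL1 s T f.
Proof. by move=> fa; apply: continuous_itvL1; exact: abs_cont_continuous. Qed.

Lemma abs_cont_measurable s T f : abs_cont s T f -> measurable_fun `[s, T] f.
Proof. by move=> /abs_cont_itvL1/itvL1_measurable. Qed.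

Lemma itvL1M_abs_cont s T f g : itvL1 s T f -> abs_cont s T g ->
  itvL1 s T (fun x => f x * g x).
Proof.
move=> fi ga; have [M [_ gM]] := abs_cont_bounded ga.
by apply: itvL1M_bounded gM => //; exact: abs_cont_measurable.
Qed.

Lemma abs_cont_by_parts s T f g f' g' : s <= T -> abs_cont s T f -> abs_cont s T g ->
  itvL1 s T f' -> itvL1 s T g' ->
  {ae mu, forall x, s < x < T -> is_derive x 1 f (f' x)} ->
  {ae mu, forall x, s < x < T -> is_derive x 1 g (g' x)} ->
  f T * g T - f s * g s =
  itvint s T (fun x => f' x * g x) + itvint s T (fun x => f x * g' x).
Proof.
move=> sT fa ga fi gi df dg.
have i1 : itvL1 s T (fun x => f' x * g x) by exact: itvL1M_abs_cont.
have i2 : itvL1 s T (fun x => f x * g' x).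
  by apply: eq_itvL1 (itvL1M_abs_cont gi fa) => x _; rewrite mulrC.
rewrite -itvintD//.
have h := @abs_cont_ftc R s T (fun x => f x * g x) (fun x => f' x * g x + f x * g' x) sT.
apply: h; [exact: abs_contM|exact: itvL1D|].
apply: ae_mono (ae_and df dg) => x [h1 h2] xs.
have d1 := h1 xs; have d2 := h2 xs.
have d3 : is_derive x 1 (f * g) _ := is_deriveM d1 d2.
apply: is_derive_eq d3 _; rewrite /GRing.scale /=; ring.
Qed.

Lemma deriv_bounded_lipschitz f (f' : R -> R) (L : R) x y : (forall z, is_derive z 1 f (f' z)) ->
  (forall z, x <= z <= y -> `|f' z| <= L) -> x <= y ->
  `|f y - f x| <= L * (y - x).
Proof.
move=> df dL xy; have [c cxy ->] := is_derive_mvt df xy.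
have yx0 : 0 <= y - x by rewrite subr_ge0.
by rewrite normrM (ger0_norm yx0) ler_wpM2r// dL.
Qed.

Lemma is_derive_expRM (c z : R) :
  is_derive z 1 (fun t => expR (c * t)) (c * expR (c * z)).
Proof.
have d1 : is_derive z 1 (fun t : R => c * t) c.
  have : is_derive z 1 (c \*: (@id R)) (c *: 1) by exact: is_deriveZ.
  by rewrite /GRing.scale /= mulr1.
have d2 := is_derive_expR (c * z).
by have := is_derive1_comp d2 d1; rewrite mulrC.
Qed.

Lemma abs_cont_expR (c : R) s T : abs_cont s T (fun t => expR (c * t)).
Proof.
pose M := expR (`|c| * (`|s| + `|T|)).
apply: (@abs_cont_lipschitz _ _ _ _ (`|c| * M)) => x y sx xy yT.
have d (z : R) := is_derive_expRM c z.
apply: (deriv_bounded_lipschitz d) => // z /andP[xz zy].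
rewrite normrM ler_wpM2l// ger0_norm ?expR_ge0// ler_expR.
apply: (le_trans (ler_norm _)); rewrite normrM ler_wpM2l//.
have h1 := ler_norm T; have h2 := ler_norm (- s); rewrite normrN in h2.
have h3 := normr_ge0 s; have h4 := normr_ge0 T.
rewrite ler_norml; apply/andP; split; lra.
Qed.

Lemma tent_norm x r z : 0 < r -> `|tent x r z| <= r^-1.
Proof. by move=> r0; rewrite ger0_norm ?tent_le// tent_ge0. Qed.

Lemma abs_cont_ramp a b x r : 0 < r -> abs_cont a b (ramp x r).
Proof.
move=> r0; apply: (@abs_cont_lipschitz _ _ _ _ r^-1) => y z _ yz _.
have dr (t : R) : is_derive t 1 (ramp x r) (tent x r t) by exact: is_derive_ramp.
exact: (deriv_bounded_lipschitz dr (fun t _ => tent_norm x t r0) yz).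
Qed.

Lemma measurable_tent a b x r : measurable_fun `[a, b] (tent x r).
Proof.
apply: measurable_funTS; apply: continuous_measurable_fun; exact: continuous_tent.
Qed.

Lemma davg_itvint a b f x r : 0 < r -> a <= x - r -> x + r <= b -> itvL1 a b f ->
  davg (f \_ `[a, b]) x r =
  ((2 * r)^-1 * itvint (x - r) (x + r) (fun z => `|f z - f x|))%:E.
Proof.
move=> r0 h1 h2 fi; pose D z := `|f z - f x|.
have Di : itvL1 a b D by apply: itvL1_norm; apply: itvL1B => //; exact: itvL1_cst.
have Dri : itvL1 (x - r) (x + r) D by exact: itvL1_sub Di.
rewrite /davg /iavg lebesgue_measure_ball ?ltW// -(mulr_natl r) inver.
rewrite gt_eqF ?mulr_gt0// EFinM; congr (_ * _)%E; rewrite ball_itv.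
transitivity (\int[mu]_(y in `](x - r)%R, (x + r)%R[) (D y)%:E)%E.
  apply: eq_integral => y; rewrite inE /= in_itv /= => /andP[y1 y2].
  by rewrite /= /D /patch !mem_set//= in_itv /=; apply/andP; split; lra.
have Dri2 : mu.-integrable `]x - r, x + r[ (EFin \o D).
  by apply: (integrableS _ _ _ Dri) => //; apply: subset_itv; rewrite bnd_simp.
have Dri3 : mu.-integrable `]x - r, x + r] (EFin \o D).
  by apply: (integrableS _ _ _ Dri) => //; apply: subset_itv; rewrite bnd_simp.
rewrite integral_itv_bndo_bndc; last exact: measurable_int Dri2.
rewrite integral_itv_obnd_cbnd; last exact: measurable_int Dri3.
exact: itvint_EFin.
Qed.

(** The average against a tent differs from f x by at most twice the average of
    |f - f x| over [x - r, x + r]. *)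
Lemma tent_average a b f x (eta : R) : a < x < b -> itvL1 a b f ->
  lebesgue_pt (f \_ `[a, b]) x -> 0 < eta ->
  \forall r \near 0^'+, `|itvint a b (fun z => f z * tent x r z) - f x| < eta.
Proof.
move=> /andP[ax xb] fi fx eta0.
have e20 : 0 < eta / 2 by rewrite divr_gt0.
have := fx; rewrite /lebesgue_pt => /fine_cvgP[ffin /cvgrPdist_lt/(_ _ e20) hlt].
near=> r.
have r0 : 0 < r by near: r; exact: nbhs_right_gt.
have rxa : r < x - a by near: r; apply: nbhs_right_lt; rewrite subr_gt0.
have rxb : r < b - x by near: r; apply: nbhs_right_lt; rewrite subr_gt0.
have rfin : davg (f \_ `[a, b]) x r \is a fin_num by near: r.
have : `|0 - fine (davg (f \_ `[a, b]) x r)| < eta / 2 by near: r; exact: hlt.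
rewrite sub0r normrN => hr.
pose D z := `|f z - f x|.
have h1 : a <= x - r by lra. have h2 : x + r <= b by lra.
have h3 : x - r <= x + r by lra.
have Di : itvL1 a b D by apply: itvL1_norm; apply: itvL1B => //; exact: itvL1_cst.
have Dri : itvL1 (x - r) (x + r) D by exact: itvL1_sub Di.
have dE : davg (f \_ `[a, b]) x r = ((2 * r)^-1 * itvint (x - r) (x + r) D)%:E.
  exact: davg_itvint.
have ti : itvL1 a b (tent x r).
  apply: itvL1_bounded; [exact: measurable_tent|move=> z _; exact: tent_norm].
have t1 : itvint a b (tent x r) = 1.
  rewrite -(@abs_cont_ftc _ a b (ramp x r))//; last first.
  - by apply: aeW => z _; exact: is_derive_ramp.
  - exact: abs_cont_ramp.
  - lra.
  by rewrite ramp_right ?ramp_left ?subr0//; lra.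
have fti : itvL1 a b (fun z => f z * tent x r z).
  by apply: itvL1M_bounded; [|exact: measurable_tent|move=> z _; exact: tent_norm].
rewrite -[f x]mulr1 -t1 -itvintZ// -itvintB//; last exact: itvL1Z.
apply: (le_lt_trans (norm_itvint _)); first by apply: itvL1B => //; exact: itvL1Z.
have gi : itvL1 a b (fun z => `|f z * tent x r z - f x * tent x r z|).
  by apply: itvL1_norm; apply: itvL1B => //; exact: itvL1Z.
have out p q : a <= p -> p <= q -> q <= b -> (forall z, p <= z <= q -> r <= `|z - x|) ->
    itvint p q (fun z => `|f z * tent x r z - f x * tent x r z|) = 0.
  move=> ap pq qb pqo; rewrite (@eq_itvint _ _ _ _ (fun=> 0)).
    by rewrite itvint_cst// mul0r.
  by move=> z /pqo h; rewrite tent_out// !mulr0 subrr normr0.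
rewrite (@itvint_split _ a (x - r) b)//; last lra.
rewrite out//; last first.
- by move=> z /andP[z1 z2]; rewrite ler0_norm; lra.
- lra.
rewrite add0r (@itvint_split _ (x - r) (x + r) b)//; last exact: itvL1_sub gi.
rewrite [X in _ + X]out//; last first.
- by move=> z /andP[z1 z2]; rewrite ger0_norm; lra.
- lra.
rewrite addr0.
apply: (@le_lt_trans _ _ (r^-1 * itvint (x - r) (x + r) D)).
  rewrite -itvintZ//; apply: le_itvint; [exact: itvL1_sub gi|exact: itvL1Z|].
  move=> z _; rewrite -mulrBl normrM mulrC; apply: ler_wpM2r; first by [].
  exact: tent_norm.
move: hr; rewrite dE /= ger0_norm; last first.
  apply: mulr_ge0; last by apply: itvint_ge0 => z _; exact: normr_ge0.
  by rewrite invr_ge0 mulr_ge0// ltW.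
rewrite invfM -mulrA; lra.
Unshelve. all: by end_near. Qed.

Lemma test_function_ramps a b x y r : 0 < r -> r < x - a -> r < b - x ->
  r < y - a -> r < b - y -> test_function a b (fun z => ramp x r z - ramp y r z).
Proof.
move=> r0 r1 r2 r3 r4; have d z :
    is_derive z 1 (fun z => ramp x r z - ramp y r z) (tent x r z - tent y r z).
  have d1 := is_derive_ramp x z r0; have d2 := is_derive_ramp y z r0.
  exact: (is_deriveB d1 d2).
split.
- by move=> z; case: (d z).
- have -> : derive1 (fun z => ramp x r z - ramp y r z) =
      (fun z => tent x r z - tent y r z).
    by apply/funext => z; rewrite derive1E; exact: derive_val.
  by move=> z; apply: cvgB; exact: continuous_tent.
- clear d; exists (Num.min x y - r), (Num.max x y + r); split.
  + by rewrite ltrBrDr lt_min; apply/andP; split; lra.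
  + by rewrite -ltrBrDr gt_max; apply/andP; split; lra.
  + move=> z /nandP[]; rewrite -ltNge.
      rewrite ltrBrDr lt_min => /andP[zx zy].
      by rewrite !ramp_left ?subrr//; lra.
    rewrite -ltrBrDr gt_max => /andP[zx zy].
    by rewrite !ramp_right ?subrr//; lra.
Qed.

(** The difference of two steps is a test function with derivative the difference
    of the tents; integrating by parts shows that the distributional derivative of
    u minus the primitive of g does not see it. *)
Lemma tent_pairing a b u g x y r : weak_derivative a b u g ->
  0 < r -> r < x - a -> r < b - x -> r < y - a -> r < b - y ->
  itvint a b (fun z => (u z - itvprim a b g z) * tent x r z) =
  itvint a b (fun z => (u z - itvprim a b g z) * tent y r z).
Proof.
move=> [ui gi ug] r0 r1 r2 r3 r4.
have ab : a <= b by lra.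
have tphi := test_function_ramps r0 r1 r2 r3 r4.
have Ga := abs_cont_itvprim gi.
have Gi := abs_cont_itvL1 Ga.
have dG := itvprim_is_derive gi.
pose phi z := ramp x r z - ramp y r z.
pose dphi z := tent x r z - tent y r z.
have dp z : is_derive z 1 phi (dphi z).
  have d1 := is_derive_ramp x z r0; have d2 := is_derive_ramp y z r0.
  exact: (is_deriveB d1 d2).
have dphiE : derive1 phi = dphi.
  by apply/funext => z; rewrite derive1E; exact: derive_val.
have pa : abs_cont a b phi by apply: abs_contB; exact: abs_cont_ramp.
have ti c : itvL1 a b (tent c r).
  apply: (@itvL1_bounded _ _ _ _ r^-1); first exact: measurable_tent.
  by move=> z _; exact: tent_norm.
have dpi : itvL1 a b dphi by exact: itvL1B.
have := ug _ tphi; rewrite dphiE -/(itvint a b (fun x => u x * dphi x)).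
rewrite -/(itvint a b (fun x => g x * phi x)).
have dpa : {ae mu, forall x, a < x < b -> is_derive x 1 phi (dphi x)}.
  by apply: aeW => z _; exact: dp.
have := abs_cont_by_parts ab Ga pa gi dpi dG dpa.
have -> : phi b = 0 by rewrite /phi !ramp_right ?subrr//; clear -r2 r4; lra.
have -> : phi a = 0 by rewrite /phi !ramp_left ?subrr//; clear -r1 r3; lra.
rewrite !mulr0 subrr => h1 h2.
have fi : itvL1 a b (fun z => u z - itvprim a b g z) by exact: itvL1B.
have ft c : itvL1 a b (fun z => (u z - itvprim a b g z) * tent c r z).
  apply: (@itvL1M_bounded _ _ _ _ _ r^-1) => //; first exact: measurable_tent.
  by move=> z _; exact: tent_norm.
apply/eqP; rewrite -subr_eq0 -itvintB//; apply/eqP.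
have b2 z : `|dphi z| <= r^-1 + r^-1.
  by apply: (le_trans (ler_normB _ _)); rewrite lerD// tent_norm.
have mdp : measurable_fun `[a, b] dphi by exact: itvL1_measurable.
have ud : itvL1 a b (fun z => u z * dphi z).
  by apply: (itvL1M_bounded ui mdp) => z _; exact: b2.
have Gd : itvL1 a b (fun z => itvprim a b g z * dphi z).
  by apply: (itvL1M_bounded Gi mdp) => z _; exact: b2.
rewrite (@eq_itvint _ _ _ _ (fun z => u z * dphi z - itvprim a b g z * dphi z)).
  by rewrite itvintB// h2; move: h1; set A := itvint _ _ _; set B := itvint _ _ _;
     clear; lra.
by move=> z _; rewrite /dphi; ring.
Qed.

(** The fundamental lemma of the calculus of variations, in dimension one.  All
    averages of u minus the primitive of g against tents of the same width are
    equal, hence this difference takes the same value at all its Lebesgue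
    points. *)
Lemma weak_derivative_primitive a b u g : a < b -> weak_derivative a b u g ->
  exists c, {ae mu, forall x, a < x < b -> u x = c + itvprim a b g x}.
Proof.
move=> ab /[dup] wd [ui gi ug]; pose f x := u x - itvprim a b g x.
have Ga := abs_cont_itvprim gi.
have Gi := abs_cont_itvL1 Ga.
have fi : itvL1 a b f by exact: itvL1B.
have lp := lebesgue_differentiation
  (open_integrable_locally openT (itvL1_restrict fi)).
have dG := itvprim_is_derive gi.
have key x y : a < x < b -> a < y < b -> lebesgue_pt (f \_ `[a, b]) x ->
    lebesgue_pt (f \_ `[a, b]) y -> f x <= f y.
  move=> /[dup] xab /andP[ax xb] /[dup] yab /andP[ay yb] lx ly.
  apply/ler_addgt0Pr => e e0; have e20 : 0 < e / 2 by rewrite divr_gt0.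
  near (0 : R)^'+ => r.
  have r0 : 0 < r by near: r; exact: nbhs_right_gt.
  have r1 : r < x - a by near: r; apply: nbhs_right_lt; rewrite subr_gt0.
  have r2 : r < b - x by near: r; apply: nbhs_right_lt; rewrite subr_gt0.
  have r3 : r < y - a by near: r; apply: nbhs_right_lt; rewrite subr_gt0.
  have r4 : r < b - y by near: r; apply: nbhs_right_lt; rewrite subr_gt0.
  have hx : `|itvint a b (fun z => f z * tent x r z) - f x| < e / 2.
    near: r; exact: (tent_average xab fi lx e20).
  have hy : `|itvint a b (fun z => f z * tent y r z) - f y| < e / 2.
    near: r; exact: (tent_average yab fi ly e20).
  move: hx hy; rewrite (tent_pairing wd r0 r1 r2 r3 r4).
  set I := itvint _ _ _; clearbody I => /ltr_normlP[h1 h2] /ltr_normlP[h3 h4].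
  clear -h1 h4 h2 h3; lra.
pose Z : set R := ~` [set x | lebesgue_pt (f \_ `[a, b]) x].
have Z0 : mu.-negligible Z := lp.
have [x0 [ax0 x0b /contrapT lx0]] := null_complement_dense Z0 ab.
exists (f x0); apply: ae_mono lp => x lx xab.
have x0ab : a < x0 < b by rewrite ax0.
have -> : f x0 = f x.
  by apply: le_anti; rewrite (key _ _ x0ab xab lx0 lx) (key _ _ xab x0ab lx lx0).
by rewrite /f subrK.
Unshelve. all: by end_near. Qed.

End weak_derivatives.

(** * Translations *)

Section translation.
Context {R : realType}.
Local Notation mu := (@lebesgue_measure R).
Implicit Types (s T h : R) (k : R -> R).

Lemma measurable_shift h :
  measurable_fun setT ((fun x => x + h) : measurableTypeR R -> measurableTypeR R).
Proof. by apply: measurable_funD. Qed.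

(** The translated measure agrees with the Lebesgue measure on intervals. *)
Lemma lebesgue_measure_shift h (A : set R) : measurable A ->
  pushforward mu ((fun x => x + h) : measurableTypeR R -> measurableTypeR R) A = mu A.
Proof.
move=> mA; have mh := measurable_shift h.
pose mh' := isMeasurableFun.Build _ _ _ _ _ mh.
pose f : {mfun measurableTypeR R >-> measurableTypeR R} :=
  MeasurableFun.Pack (MeasurableFun.Class mh').
apply/esym/(@lebesgue_measure_unique _ (pushforward mu f)) => //= _ [[x y]] _ <-.
rewrite /pushforward /=.
have -> : [set` `]x, y]%R] = `]x, y]%classic by [].
have -> : (fun x0 => x0 + h) @^-1` `]x, y] = `]x - h, y - h]%classic.
  by apply/seteqP; split => z /=; rewrite !in_itv /= ltrBlDr lerBrDr.
by rewrite !lebesgue_measure_itv /= !lte_fin ltrD2r -!EFinD; case: ifP => // _; congr EFin; ring.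
Qed.

Lemma itvint_shift s T h k : s <= T -> itvL1 (s + h) (T + h) k ->
  itvL1 s T (fun x => k (x + h)) /\
  itvint s T (fun x => k (x + h)) = itvint (s + h) (T + h) k.
Proof.
move=> sT ki; have mh := measurable_shift h.
pose phi := (fun x => x + h) : measurableTypeR R -> measurableTypeR R.
pose D := `[s + h, T + h]%classic : set (measurableTypeR R).
have mD : measurable D by exact: measurable_itv.
have phiD : phi @^-1` D = `[s, T]%classic.
  by apply/seteqP; split => x; rewrite /phi /D /= !in_itv /= !lerD2r.
pose K := k \_ D.
have Ki : mu.-integrable setT (EFin \o K) by exact: itvL1_restrict.
have mK : measurable_fun setT (EFin \o K) by exact: measurable_int Ki.
have mKphi : measurable_fun setT ((EFin \o K) \o phi) by exact: measurableT_comp.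
have absK : (\int[pushforward mu phi]_(y in D) `|(EFin \o K) y| =
    \int[mu]_(y in D) `|(EFin \o K) y|)%E.
  by apply: eq_measure_integral => A mA _; exact: lebesgue_measure_shift.
have Kphi : mu.-integrable (phi @^-1` D) ((EFin \o K) \o phi).
  apply/integrableP; split.
    by rewrite phiD; exact: measurable_funTS.
  have := @ge0_integral_pushforward _ _ _ _ _ phi mh mu D (fun y => `|(EFin \o K) y|%E) mD.
  move=> <- //; last by apply: measurable_funTS; apply: measurableT_comp.
  rewrite absK; have /integrableP[] : mu.-integrable D (EFin \o K) => //.
  exact: integrableS Ki.
have eK x : s <= x <= T -> K (phi x) = k (x + h).
  by move=> xs; rewrite /K patchE mem_set// -[D _]/((phi @^-1` D) x) phiD /= in_itv.
split.
  apply: (@eq_itvL1 _ _ _ (K \o phi)) => //; move: Kphi; rewrite phiD; exact.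
transitivity (itvint s T (K \o phi)).
  by apply: eq_itvint => x xs; rewrite /= eK.
transitivity (itvint (s + h) (T + h) K); last first.
  by apply: eq_itvint => x xs; rewrite /K patchE mem_set// /D /= in_itv.
rewrite /itvint /Rintegral; congr fine.
have := @integral_pushforward _ _ _ _ _ phi mh mu D (EFin \o K) mK Kphi mD.
rewrite phiD => <-.
by apply: eq_measure_integral => A mA _; exact: lebesgue_measure_shift.
Qed.

End translation.

(** * Gradient flows of semiconvex functionals *)

(** Functions on [a, b] are not identified when they agree almost everywhere, so
    the inner product [ip] is only semidefinite; [D] singles out the square
    integrable ones, outside of which it has no meaning. *)
Section semi_inner_product.
Context {R : realType} {V : lmodType R} (D : V -> Prop) (ip : V -> V -> R).
Hypothesis DD : forall f g, D f -> D g -> D (f + g).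
Hypothesis DZ : forall (c : R) f, D f -> D (c *: f).
Hypothesis ipC : forall f g, ip f g = ip g f.
Hypothesis ip_ge0 : forall f, 0 <= ip f f.
Hypothesis ipDl : forall f g h, D f -> D g -> D h ->
  ip (f + g) h = ip f h + ip g h.
Hypothesis ipZl : forall (c : R) f g, D f -> D g -> ip (c *: f) g = c * ip f g.
Implicit Types (f g : V) (c : R).

Lemma ip_domN f : D f -> D (- f).
Proof. by move=> Df; rewrite -scaleN1r; exact: DZ. Qed.

Lemma ip_domB f g : D f -> D g -> D (f - g).
Proof. by move=> Df Dg; apply: DD => //; exact: ip_domN. Qed.

Lemma ipNl f g : D f -> D g -> ip (- f) g = - ip f g.
Proof. by move=> Df Dg; rewrite -scaleN1r ipZl// mulN1r. Qed.

Lemma ipZr c f g : D f -> D g -> ip f (c *: g) = c * ip f g.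
Proof. by move=> Df Dg; rewrite ipC ipZl// ipC. Qed.

Lemma ipDr f g h : D f -> D g -> D h -> ip f (g + h) = ip f g + ip f h.
Proof. by move=> Df Dg Dh; rewrite ipC ipDl// !(ipC f). Qed.

Lemma ipNr f g : D f -> D g -> ip f (- g) = - ip f g.
Proof. by move=> Df Dg; rewrite ipC ipNl// ipC. Qed.

Lemma ip_sqD f g : D f -> D g -> ip (f + g) (f + g) = ip f f + 2 * ip f g + ip g g.
Proof.
move=> Df Dg; have Dfg := DD Df Dg.
by rewrite ipDl// !ipDr// (ipC g f); ring.
Qed.

Definition ipnorm f : R := Num.sqrt (ip f f).

Lemma ipnorm_ge0 f : 0 <= ipnorm f.
Proof. exact: sqrtr_ge0. Qed.

Lemma ipnorm_sq f : ipnorm f ^+ 2 = ip f f.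
Proof. by rewrite /ipnorm sqr_sqrtr. Qed.

Lemma ipnormZ c f : D f -> ipnorm (c *: f) = `|c| * ipnorm f.
Proof.
move=> Df; rewrite /ipnorm ipZl ?ipZr//; last exact: DZ.
by rewrite mulrA -expr2 sqrtrM ?sqr_ge0// sqrtr_sqr.
Qed.

Lemma ipnormN f : D f -> ipnorm (- f) = ipnorm f.
Proof. by move=> Df; rewrite -scaleN1r ipnormZ// normrN1 mul1r. Qed.

Lemma ipnormB f g : D f -> D g -> ipnorm (f - g) = ipnorm (g - f).
Proof. by move=> Df Dg; rewrite -ipnormN ?opprB//; exact: ip_domB. Qed.

Lemma ip_cauchy f g : D f -> D g -> `|ip f g| <= ipnorm f * ipnorm g.
Proof.
move=> Df Dg.
have H : ip f g ^+ 2 <= ip f f * ip g g.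
  have q c : 0 <= c ^+ 2 * ip f f + 2 * c * ip f g + ip g g.
    have := ip_ge0 (c *: f + g); rewrite ip_sqD//; last exact: DZ.
    rewrite !ipZl//; last exact: DZ.
    by rewrite ipZr//; congr (0 <= _); ring.
  have [f0|f0] := eqVneq (ip f f) 0.
    rewrite f0 mul0r; have [->|fg0] := eqVneq (ip f g) 0; first by rewrite expr0n.
    have := q (- (ip g g + 1) / (2 * ip f g)).
    rewrite f0 mulr0 add0r.
    have -> : 2 * (- (ip g g + 1) / (2 * ip f g)) * ip f g = - (ip g g + 1) by field.
    by move: (ip g g) => x; lra.
  have fp : 0 < ip f f by rewrite lt_neqAle eq_sym f0 ip_ge0.
  have := q (- ip f g / ip f f).
  have -> : (- ip f g / ip f f) ^+ 2 * ip f f + 2 * (- ip f g / ip f f) * ip f g + ip g g =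
    (ip f f * ip g g - ip f g ^+ 2) / ip f f by field.
  by rewrite pmulr_lge0 ?invr_gt0// subr_ge0.
have := @ler_wsqrtr R _ _ H.
by rewrite sqrtr_sqr sqrtrM.
Qed.

Lemma ipnormD f g : D f -> D g -> ipnorm (f + g) <= ipnorm f + ipnorm g.
Proof.
move=> Df Dg.
rewrite -(@ler_pXn2r _ 2) ?nnegrE ?addr_ge0 ?ipnorm_ge0//.
rewrite ipnorm_sq ip_sqD// sqrrD !ipnorm_sq lerD2r lerD2l.
have := le_trans (ler_norm _) (ip_cauchy Df Dg); lra.
Qed.

Lemma ipnorm_dist f g : D f -> D g -> `|ipnorm f - ipnorm g| <= ipnorm (f - g).
Proof.
move=> Df Dg; have h1 := ipnormD (ip_domB Df Dg) Dg.
have h2 := ipnormD (ip_domB Dg Df) Df.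
rewrite (ipnormB Dg Df) !subrK in h2; rewrite !subrK in h1.
by rewrite ler_norml; apply/andP; split; lra.
Qed.

Definition curve_derivative (v : R -> V) (t : R) (w : V) : Prop :=
  forall eta : R, 0 < eta -> exists2 d : R, 0 < d & forall h : R, h != 0 ->
    `|h| < d -> ipnorm (h^-1 *: (v (t + h) - v t) - w) <= eta.

(** The error is absorbed into the direction, so that later estimates need no
    division by h. *)
Lemma curve_derivative_expansion (v : R -> V) t w (eta : R) :
  (\forall h \near 0, D (v (t + h))) -> D w ->
  curve_derivative v t w -> 0 < eta -> exists2 d : R, 0 < d &
    forall h : R, `|h| < d -> exists rho,
      [/\ D rho, ipnorm rho <= eta & v (t + h) - v t = h *: (w + rho)].
Proof.
move=> [d1 /= d10 Dv] Dw vw eta0; have [d d0 hd] := vw _ eta0.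
exists (Num.min d d1); first by rewrite lt_min d0.
have Dvt : D (v t).
  by have := Dv 0; rewrite addr0; apply => /=; rewrite subrr normr0.
have Dz : D 0 by rewrite -(scale0r w); exact: DZ.
have z0 : ipnorm 0 = 0 by rewrite -(scale0r w) ipnormZ// normr0 mul0r.
move=> h; rewrite lt_min => /andP[hd' hd1].
have [->|h0] := eqVneq h 0.
  by exists 0; rewrite addr0 scale0r subrr z0 ltW.
have Dvh : D (v (t + h)) by apply: Dv; rewrite /= sub0r normrN.
exists (h^-1 *: (v (t + h) - v t) - w); split.
- by apply: ip_domB => //; apply: DZ; exact: ip_domB.
- exact: hd.
- by rewrite [w + _]addrC subrK scalerA mulfV// scale1r.
Qed.

Lemma is_derive_ip_sq (v : R -> V) t w :
  (\forall h \near 0, D (v (t + h))) -> D w ->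
  curve_derivative v t w ->
  is_derive t 1 (fun t => ip (v t) (v t)) (2 * ip w (v t)).
Proof.
move=> Dv Dw vw.
have Dvt : D (v t).
  by case: Dv => d1 /= d10 Dv; have := Dv 0; rewrite addr0; apply => /=; rewrite subrr normr0.
apply: is_derive_cvg; apply/cvgrPdist_le => e e0.
pose M := ipnorm (v t) + 1; pose N := (ipnorm w + 1) ^+ 2.
have M0 : 0 < M by rewrite ltr_wpDl// ipnorm_ge0.
have N0 : 0 < N by rewrite exprn_gt0// ltr_wpDl// ipnorm_ge0.
pose eta := Num.min 1 (e / (4 * M)).
have eta0 : 0 < eta by rewrite lt_min ltr01 divr_gt0// mulr_gt0.
have [d d0 hd] := curve_derivative_expansion Dv Dw vw eta0.
near=> h.
have h0 : h != 0 by near: h; exact: nbhs_dnbhs_neq.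
have h1 : `|h| < d by near: h; exact: dnbhs0_lt.
have h2 : `|h| < e / (2 * N) by near: h; apply: dnbhs0_lt; rewrite divr_gt0// mulr_gt0.
rewrite [h *: 1]mulr1 (addrC h).
have [rho [Drho rhoe vE]] := hd _ h1.
have Dwr := DD Dw Drho.
have -> : v (t + h) = v t + h *: (w + rho) by apply/eqP; rewrite [X in _ == X]addrC -subr_eq vE.
rewrite ip_sqD//; last exact: DZ.
rewrite ipZl ?ipZr//; last exact: DZ.
rewrite (ipC (v t)) ipDl//.
have -> : 2 * ip w (v t) - h^-1 *:
   (ip (v t) (v t) + 2 * (h * (ip w (v t) + ip rho (v t))) +
    h * (h * ip (w + rho) (w + rho)) - ip (v t) (v t)) =
   - (2 * ip rho (v t) + h * ip (w + rho) (w + rho)).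
  by rewrite /GRing.scale /=; field.
rewrite normrN (le_trans (ler_normD _ _))//.
have b1 : `|2 * ip rho (v t)| <= e / 2.
  rewrite normrM ger0_norm//; apply: (@le_trans _ _ (2 * (eta * M))).
    rewrite ler_pM2l//; apply: (le_trans (ip_cauchy Drho Dvt)).
    by apply: ler_pM; rewrite ?ipnorm_ge0// /M lerDl.
  have : eta * M <= e / (4 * M) * M by rewrite ler_pM2r// /eta ge_min lexx orbT.
  have -> : e / (4 * M) * M = e / 4 by field; rewrite gt_eqF.
  lra.
have b2 : `|h * ip (w + rho) (w + rho)| <= e / 2.
  rewrite normrM (ger0_norm (ip_ge0 _)); apply: (@le_trans _ _ (e / (2 * N) * N)).
    apply: ler_pM => //; first exact: ltW.
    rewrite -ipnorm_sq /N ler_pXn2r ?nnegrE ?ipnorm_ge0//; last first.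
      by rewrite addr_ge0// ipnorm_ge0.
    rewrite (le_trans (ipnormD Dw Drho))// lerD2l (le_trans rhoe)//.
    by rewrite /eta ge_min lexx.
  by have -> : e / (2 * N) * N = e / 2 by field; rewrite gt_eqF.
by have := lerD b1 b2; rewrite -splitr.
Unshelve. all: by end_near. Qed.

Local Notation mu := (@lebesgue_measure R).

Lemma curve_derivativeB (v1 v2 : R -> V) t w1 w2 :
  (\forall h \near 0, D (v1 (t + h))) -> (\forall h \near 0, D (v2 (t + h))) ->
  D w1 -> D w2 -> curve_derivative v1 t w1 -> curve_derivative v2 t w2 ->
  curve_derivative (fun t => v1 t - v2 t) t (w1 - w2).
Proof.
move=> Dv1 Dv2 Dw1 Dw2 d1 d2 eta eta0.
have e2 : 0 < eta / 2 by rewrite divr_gt0.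
have [e1' e10 h1] := curve_derivative_expansion Dv1 Dw1 d1 e2.
have [e2' e20 h2] := curve_derivative_expansion Dv2 Dw2 d2 e2.
exists (Num.min e1' e2'); first by rewrite lt_min e10.
move=> h h0; rewrite lt_min => /andP[/h1[r1 [Dr1 r1e E1]] /h2[r2 [Dr2 r2e E2]]].
have -> : h^-1 *: (v1 (t + h) - v2 (t + h) - (v1 t - v2 t)) - (w1 - w2) = r1 - r2.
  have z (x y x' y' : V) : x + x' - (y + y') - (x - y) = x' - y'.
    by rewrite [- (y + y')]opprD addrACA [LHS]addrC addKr.
  have -> : v1 (t + h) = v1 t + h *: (w1 + r1).
    by apply/eqP; rewrite [X in _ == X]addrC -subr_eq E1.
  have -> : v2 (t + h) = v2 t + h *: (w2 + r2).
    by apply/eqP; rewrite [X in _ == X]addrC -subr_eq E2.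
  by rewrite z -scalerBr scalerA mulVf// scale1r z.
apply: (le_trans (ipnormD Dr1 (ip_domN Dr2))); rewrite ipnormN//.
by rewrite (splitr eta) lerD.
Qed.

Lemma negligible_shift (N : set R) h : mu.-negligible N ->
  mu.-negligible [set t | N (t + h)].
Proof.
move=> [A [mA A0 NA]].
exists ((fun t : measurableTypeR R => t + h : measurableTypeR R) @^-1` A); split.
- rewrite -[X in measurable X]setTI; exact: measurable_shift.
- by rewrite -A0 -(lebesgue_measure_shift h mA).
- by move=> t /NA.
Qed.

(** The curve u is a gradient flow of a functional phi for which phi + |.|^2 / 2 is
    convex: at each time t of the set G of full measure, - du t is a subgradient of
    phi at u t.  Only the values phi (u t) at such times are recorded. *)
Variables (u du : R -> V) (G : set R) (phi : R -> R).
Hypothesis uD : forall t, 0 <= t -> D (u t).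
Hypothesis u_abs_cont : forall s T : R, 0 < s -> s < T -> exists2 k, itvL1 s T k &
  forall x y, s <= x -> x <= y -> y <= T -> ipnorm (u y - u x) <= itvint x y k.
Hypothesis G_gt0 : forall t, G t -> 0 < t.
Hypothesis G_ae : mu.-negligible [set t | 0 < t /\ ~ G t].
Hypothesis duD : forall t, G t -> D (du t).
Hypothesis u_der : forall t, G t -> curve_derivative u t (du t).
Hypothesis phi_sub : forall t s, G t -> G s ->
  phi t - ip (du t) (u s - u t) - 2^-1 * ip (u s - u t) (u s - u t) <= phi s.

Lemma near_curve_dom t : 0 < t -> \forall h \near 0, D (u (t + h)).
Proof.
move=> t0; exists t => //= h; rewrite /ball_ /= sub0r normrN => ht.
by apply: uD; move: ht; rewrite ltr_norml => /andP[h1 _]; lra.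
Qed.

Lemma near_curve_domB t w : 0 < t -> D w -> \forall h \near 0, D (u (t + h) - w).
Proof.
move=> /near_curve_dom Dt Dw; near=> h; apply: ip_domB => //; near: h; exact: Dt.
Unshelve. all: by end_near. Qed.

Lemma u_abs_cont_le s T : 0 < s -> s <= T -> exists k, [/\ itvL1 s T k, forall x, 0 <= k x &
  forall x y, s <= x -> x <= y -> y <= T -> ipnorm (u y - u x) <= itvint x y k].
Proof.
move=> s0 sT; have sT1 : s < T + 1 by rewrite ltr_pwDr.
have [k ki uk] := u_abs_cont s0 sT1; exists (fun x => `|k x|); split => //.
  by apply: itvL1_norm; apply: itvL1_sub ki; rewrite ?lerDl.
move=> x y sx xy yT; have yT1 : y <= T + 1 by rewrite (le_trans yT)// lerDl.
apply: (le_trans (uk _ _ sx xy yT1)).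
have kxy : itvL1 x y k by exact: itvL1_sub ki.
by apply: le_itvint => //; [exact: itvL1_norm|move=> z _; exact: ler_norm].
Qed.

Lemma abs_cont_dist s T w : 0 < s -> s <= T -> D w ->
  abs_cont s T (fun t => ipnorm (u t - w)).
Proof.
move=> s0 sT Dw; have [k [ki _ uk]] := u_abs_cont_le s0 sT.
exists k => // x y sx xy yT; apply: le_trans (uk _ _ sx xy yT).
have Dx : D (u x) by apply: uD; rewrite (le_trans (ltW s0)).
have Dy : D (u y) by apply: uD; rewrite (le_trans (ltW s0))// (le_trans sx).
apply: (le_trans (ipnorm_dist (ip_domB Dy Dw) (ip_domB Dx Dw))).
by rewrite opprB addrA subrK.
Qed.

Lemma abs_cont_increment s T h : 0 < s -> s <= T -> 0 <= h ->
  abs_cont s T (fun t => ipnorm (u (t + h) - u t)).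
Proof.
move=> s0 sT h0; have [k [ki _ uk]] := u_abs_cont_le s0 sT.
have sh0 : 0 < s + h by rewrite ltr_wpDr.
have sTh : s + h <= T + h by rewrite lerD2r.
have [l [li _ ul]] := u_abs_cont_le sh0 sTh.
have [li' _] := itvint_shift sT li.
exists (fun x => l (x + h) + k x); first exact: itvL1D.
move=> x y sx xy yT.
have Dx z : s <= z -> D (u z) by move=> sz; apply: uD; rewrite (le_trans (ltW s0)).
have sy : s <= y by exact: le_trans xy.
have sxh : s <= x + h by rewrite (le_trans sx)// lerDl.
have syh : s <= y + h by rewrite (le_trans sy)// lerDl.
apply: (le_trans (ipnorm_dist (ip_domB (Dx _ syh) (Dx _ sy)) (ip_domB (Dx _ sxh) (Dx _ sx)))).
have -> : u (y + h) - u y - (u (x + h) - u x) = (u (y + h) - u (x + h)) - (u y - u x).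
  by rewrite !opprB addrACA [RHS]addrACA; congr (_ + _); exact: addrC.
have D1 : D (u (y + h) - u (x + h)) by apply: ip_domB; exact: Dx.
have D2 : D (u y - u x) by apply: ip_domB; exact: Dx.
apply: (le_trans (ipnormD D1 (ip_domN D2))); rewrite ipnormN//.
rewrite itvintD; [|exact: itvL1_sub li'|exact: itvL1_sub ki].
apply: lerD; last exact: uk.
rewrite (itvint_shift xy _).2; last by apply: itvL1_sub li; rewrite lerD2r.
by apply: ul; rewrite ?lerD2r.
Qed.

(** The sum of the subgradient inequalities at the times t and t + h bounds the
    derivative of |u (t + h) - u t|^2 by twice its value. *)
Lemma flow_expansion s T h : 0 < s -> s <= T -> 0 < h ->
  ipnorm (u (T + h) - u T) <= expR (T - s) * ipnorm (u (s + h) - u s).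
Proof.
move=> s0 sT h0.
pose v t := u (t + h) - u t; pose f t := expR (-2 * t) * ip (v t) (v t).
have Dv t : 0 <= t -> D (v t).
  by move=> t0; apply: ip_domB; apply: uD => //; rewrite addr_ge0// ltW.
suff fle : f T <= f s.
  rewrite -(@ler_pXn2r _ 2) ?nnegrE ?mulr_ge0 ?ipnorm_ge0 ?expR_ge0//.
  rewrite exprMn !ipnorm_sq -/(v T) -/(v s).
  have -> : expR (T - s) ^+ 2 = expR (2 * T) * expR (-2 * s).
    by rewrite -expRD -expRM_natl; congr expR; rewrite -mulr_natl; ring.
  rewrite -mulrA -ler_pdivrMl ?expR_gt0// -expRN -mulNr; exact: fle.
have fa : abs_cont s T f.
  apply: abs_contM; first exact: abs_cont_expR.
  have ni := abs_cont_increment s0 sT (ltW h0).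
  by apply: eq_abs_cont (abs_contM ni ni) => x _; rewrite -expr2 ipnorm_sq.
have := @abs_cont_le _ s T f (fun=> 0) sT fa (itvL1_cst _ _ _).
rewrite itvint_cst// mul0r subr_le0; apply.
apply: negligibleS (negligibleU G_ae (negligible_shift h G_ae)) => t /= Ht.
apply: contrapT => /not_orP[H1 H2]; apply: Ht => /andP[st tT].
have t0 : 0 < t by exact: lt_trans st.
have th0 : 0 < t + h by rewrite addr_gt0.
have Gt : G t by apply: contrapT => nG; apply: H1.
have Gth : G (t + h) by apply: contrapT => nG; apply: H2.
have Dt := near_curve_dom t0.
have Dth : \forall h' \near 0, D (u (t + h' + h)).
  by have [d /= d0 hd] := near_curve_dom th0; exists d => // z /hd; rewrite addrAC.
have dth : curve_derivative (fun t => u (t + h)) t (du (t + h)).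
  move=> eta /(u_der Gth)[d d0 hd]; exists d => // h' h'0 h'd.
  by rewrite addrAC; exact: hd.
have dv := curve_derivativeB Dth Dt (duD Gth) (duD Gt) dth (u_der Gt).
have Dv' : \forall h' \near 0, D (v (t + h')).
  have [d /= d0 hd] := Dt; have [d' /= d'0 hd'] := Dth.
  exists (Num.min d d'); first by rewrite /= lt_min d0.
  move=> z; rewrite /ball_ /= lt_min => /andP[/hd ? /hd' ?]; exact: ip_domB.
have Dw : D (du (t + h) - du t) by apply: ip_domB; exact: duD.
have d1 := is_derive_ip_sq Dv' Dw dv.
have d2 := is_derive_expRM (-2) t.
have d3 := is_deriveM d2 d1.
eexists; first exact: d3.
rewrite /GRing.scale /=.
have -> : expR (-2 * t) * (2 * ip (du (t + h) - du t) (v t)) +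
    ip (v t) (v t) * (-2 * expR (-2 * t)) =
  expR (-2 * t) * (2 * (ip (du (t + h) - du t) (v t) - ip (v t) (v t))) by ring.
rewrite pmulr_rle0 ?expR_gt0// pmulr_rle0// subr_le0.
have Dvt : D (v t) by apply: Dv; exact: ltW.
have Ddt := duD Gt; have Ddth := duD Gth; have DNdt := ip_domN Ddt.
have DNv := ip_domN Dvt.
have p1 := phi_sub Gt Gth; have p2 := phi_sub Gth Gt.
rewrite -/(v t) in p1; have e2 : u t - u (t + h) = - v t by rewrite opprB.
rewrite e2 !ipNr// ipNl// in p2; rewrite ipDl// ipNl//.
lra.
Qed.

(** The increment h of [flow_expansion] tends to 0. *)
Lemma flow_speed_bounded s T : G s -> s <= T ->
  exists M, 0 <= M /\ forall t, G t -> s <= t -> t <= T -> ipnorm (du t) <= M.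
Proof.
move=> Gs sT; have s0 := G_gt0 Gs.
exists (expR (T - s) * (ipnorm (du s) + 1)); split.
  by rewrite mulr_ge0 ?expR_ge0// addr_ge0// ipnorm_ge0.
move=> t Gt st tT; apply/ler_addgt0Pr => e e0.
have t0 := G_gt0 Gt.
have [d1 d10 h1] := curve_derivative_expansion (near_curve_dom s0) (duD Gs) (u_der Gs) ltr01.
have [d2 d20 h2] := curve_derivative_expansion (near_curve_dom t0) (duD Gt) (u_der Gt) e0.
pose h := Num.min d1 d2 / 2.
have hp : 0 < h by rewrite divr_gt0// lt_min d10.
have hd1 : `|h| < d1.
  rewrite gtr0_norm// /h ltr_pdivrMr// gt_min; apply/orP; left; lra.
have hd2 : `|h| < d2.
  rewrite gtr0_norm// /h ltr_pdivrMr// gt_min; apply/orP; right; lra.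
have [r1 [Dr1 r1e E1]] := h1 _ hd1; have [r2 [Dr2 r2e E2]] := h2 _ hd2.
have := flow_expansion s0 st hp.
have Ds := duD Gs; have Dt := duD Gt.
have D1 := DD Ds Dr1; have D2 := DD Dt Dr2.
rewrite E1 E2 !ipnormZ// gtr0_norm// mulrCA ler_pM2l// => hc.
have -> : du t = du t + r2 - r2 by rewrite addrK.
apply: (le_trans (ipnormD D2 (ip_domN Dr2))); rewrite ipnormN//.
apply: lerD => //; apply: (le_trans hc).
apply: ler_pM; rewrite ?expR_ge0 ?ipnorm_ge0 ?ler_expR ?lerD2r//.
by rewrite (le_trans (ipnormD Ds Dr1))// lerD2l.
Qed.

(** Were phi differentiable along the curve, its derivative would be - |du|^2, and
    the claim would be the integral of |du| <= 1 / (2 lam) + (lam / 2) |du|^2.  The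
    function f of the proof compares both sides.  The subgradient inequality at
    the later of two times, with the bound of the speed, controls its increments;
    at a good time t, tested with u t' for t' < t, it gives
    phi t - phi t' <= - (t - t') |du t|^2 up to a small multiple of t - t'. *)
Lemma flow_dissipation s T lam : G s -> G T -> s <= T -> 0 < lam ->
  ipnorm (u T - u s) <= (T - s) / (2 * lam) + lam / 2 * (phi s - phi T).
Proof.
move=> Gs GT sT lam0; have s0 := G_gt0 Gs.
have [M [M0 uM]] := flow_speed_bounded Gs sT.
have [k [ki k0 uk]] := u_abs_cont_le s0 sT.
have Dp t : s <= t -> D (u t) by move=> st; apply: uD; rewrite (le_trans (ltW s0)).
pose B := itvint s T k.
have B0 : 0 <= B by apply: itvint_ge0.
pose f t := ipnorm (u t - u s) - (t - s) / (2 * lam) + lam / 2 * phi t.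
have c0 : 0 <= lam / 2 by rewrite divr_ge0// ltW.
pose K := 1 + lam / 2 * (M + B).
have K0 : 0 <= K by rewrite addr_ge0// mulr_ge0// addr_ge0.
have D0 : D 0 by rewrite -(subrr (u s)); apply: ip_domB; exact: Dp.
have z0 : ipnorm 0 = 0 by rewrite -(scale0r (u s)) ipnormZ ?normr0 ?mul0r//; exact: Dp.
suff : f T <= f s.
  by rewrite /f !subrr z0 mul0r; lra.
apply: (@left_dini_le _ s T (fun x => K * k x) f G [set t | 0 < t /\ ~ G t]) => //.
- exact: itvL1Z.
- by move=> x _; rewrite mulr_ge0.
- move=> t /andP[st _] nt; apply: contrapT => nG; apply: nt; split => //; exact: lt_trans st.
- move=> t1 t2 G1 G2 st1 t12 t2T.
  have k12 : itvL1 t1 t2 k by exact: itvL1_sub ki.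
  have st2 : s <= t2 by exact: le_trans t12.
  have u12 := uk _ _ st1 t12 t2T.
  have D12 : D (u t2 - u t1) by apply: ip_domB; exact: Dp.
  have D21 : D (u t1 - u t2) by apply: ip_domB; exact: Dp.
  have h1 : ipnorm (u t2 - u s) - ipnorm (u t1 - u s) <= itvint t1 t2 k.
    apply: le_trans u12; apply: (le_trans (ler_norm _)).
    apply: (le_trans (ipnorm_dist _ _)); rewrite ?opprB ?addrA ?subrK//;
    by apply: ip_domB; exact: Dp.
  have IB : itvint t1 t2 k <= B by apply: itvint_le_sub => // x _.
  have h2 : phi t2 - phi t1 <= (M + B) * itvint t1 t2 k.
    have ps := phi_sub G2 G1.
    have c1 := ip_cauchy (duD G2) D21; rewrite (ipnormB (Dp _ st1) (Dp _ st2)) in c1.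
    have c2 : ip (u t1 - u t2) (u t1 - u t2) <= B * itvint t1 t2 k.
      rewrite -ipnorm_sq (ipnormB (Dp _ st1) (Dp _ st2)) expr2.
      by apply: ler_pM; rewrite ?ipnorm_ge0// (le_trans u12).
    have c3 : ip (du t2) (u t1 - u t2) <= M * itvint t1 t2 k.
      apply: (le_trans (ler_norm _)); apply: (le_trans c1).
      by apply: ler_pM; rewrite ?ipnorm_ge0//; exact: uM.
    have i0 : 0 <= B * itvint t1 t2 k by rewrite mulr_ge0// itvint_ge0.
    rewrite mulrDl; lra.
  rewrite itvintZ// /K mulrDl mul1r -mulrA.
  have h3 : (t1 - s) / (2 * lam) <= (t2 - s) / (2 * lam).
    by rewrite ler_wpM2r ?lerD2r// invr_ge0 mulr_ge0// ltW.
  have h4 := ler_wpM2l c0 h2.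
  by rewrite /f; move: h1 h3 h4; rewrite mulrBr; lra.
- move=> t /andP[st tT] nt eta eta0.
  have t0 : 0 < t by exact: lt_trans st.
  have Gt : G t by apply: contrapT => nG; apply: nt.
  have Dt := duD Gt.
  pose n := ipnorm (du t); have n0 : 0 <= n by exact: ipnorm_ge0.
  pose q := 1 + lam / 2 * n; have q0 : 0 < q by rewrite ltr_pwDl// mulr_ge0.
  (* the errors that e causes in |du|, and in (lam / 2) |du|^2, add up to q e *)
  pose e := Num.min 1 (eta / (2 * q)).
  have e0 : 0 < e by rewrite lt_min ltr01 divr_gt0// mulr_gt0.
  have e1 : e <= 1 by rewrite /e ge_min lexx.
  have eq2 : q * e <= eta / 2.
    have : e <= eta / (2 * q) by rewrite /e ge_min lexx orbT.
    by rewrite -(ler_pM2l q0) => /le_trans; apply; rewrite le_eqVlt; apply/orP; left; apply/eqP; field; rewrite gt_eqF.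
  have [d d0 hd] := curve_derivative_expansion (near_curve_dom t0) Dt (u_der Gt) e0.
  pose Q := lam / 4 * (n + 1) ^+ 2.
  have Q0 : 0 < Q by rewrite mulr_gt0 ?divr_gt0// exprn_gt0// ltr_wpDl.
  near=> t'; move=> Gt'.
  have tt' : t' < t by near: t'; exact: nbhs_left_lt.
  have st' : s < t' by near: t'; exact: nbhs_left_gt.
  have td : t - d < t' by near: t'; apply: nbhs_left_gt; rewrite ltrBlDr ltrDl.
  have tQ : t - eta / (2 * Q) < t'.
    by near: t'; apply: nbhs_left_gt; rewrite ltrBlDr ltrDl divr_gt0// mulr_gt0.
  pose del := t - t'; have del0 : 0 < del by rewrite subr_gt0.
  have hdel : `|- del| < d by rewrite normrN gtr0_norm// /del; lra.
  have [rho [Drho rhoe]] := hd _ hdel.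
  have -> : t + - del = t' by rewrite /del opprB addrC subrK.
  move=> uE.
  have Dwr := DD Dt Drho.
  have nwr : ipnorm (du t + rho) <= n + e.
    by apply: (le_trans (ipnormD Dt Drho)); rewrite lerD2l.
  have inc : ipnorm (u t' - u t) <= del * (n + e).
    by rewrite uE ipnormZ// normrN gtr0_norm// ler_pM2l.
  have Dp' : D (u t') by apply: Dp; exact: ltW.
  have Dpt : D (u t) by apply: Dp; exact: ltW.
  have Dps : D (u s) by exact: Dp.
  have h1 : ipnorm (u t - u s) - ipnorm (u t' - u s) <= del * (n + e).
    apply: le_trans inc; rewrite (ipnormB Dp' Dpt).
    apply: (le_trans (ler_norm _)).
    apply: (le_trans (ipnorm_dist (ip_domB Dpt Dps) (ip_domB Dp' Dps))).
    by rewrite opprB addrA subrK.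
  have h2 : phi t - phi t' <= - (del * (n ^+ 2 - n * e)) + 2^-1 * (del * (n + 1)) ^+ 2.
    have ps := phi_sub Gt Gt'.
    have c1 : ip (du t) (u t' - u t) <= - (del * (n ^+ 2 - n * e)).
      rewrite uE ipZr// mulNr lerN2 ler_pM2l// ipDr// -ipnorm_sq -/n lerD2l.
      have := ip_cauchy Dt Drho; rewrite ler_norml => /andP[+ _] => ip1; apply: le_trans ip1.
      by rewrite lerN2 ler_wpM2l.
    have c2 : ip (u t' - u t) (u t' - u t) <= (del * (n + 1)) ^+ 2.
      have dn0 : 0 <= del * (n + 1) by apply: mulr_ge0; [exact: ltW|exact: addr_ge0].
      rewrite -ipnorm_sq ler_pXn2r ?nnegrE ?ipnorm_ge0//.
      by apply: (le_trans inc); rewrite ler_pM2l// lerD2l.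
    by move: ps c1 c2; set X := ip (du t) _; set Y := ip (u t' - u t) _; lra.
  have h3 := ler_wpM2l c0 h2.
  have h4 : del * Q <= eta / 2.
    have : del <= eta / (2 * Q) by apply: ltW; rewrite /del; lra.
    by rewrite -(ler_pM2r Q0) => /le_trans; apply; rewrite le_eqVlt; apply/orP; left; apply/eqP; field; rewrite gt_eqF.
  have amgm : n <= (2 * lam)^-1 + lam / 2 * n ^+ 2.
    rewrite -subr_ge0.
    have -> : (2 * lam)^-1 + lam / 2 * n ^+ 2 - n = (lam * n - 1) ^+ 2 / (2 * lam).
      by field; rewrite gt_eqF.
    by rewrite divr_ge0 ?sqr_ge0// mulr_ge0// ltW.
  have tot : del * ((n + e) - (2 * lam)^-1 + lam / 2 * (- (n ^+ 2 - n * e)) + del * Q) <= eta * del.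
    rewrite mulrC ler_pM2r//; move: eq2; rewrite /q mulrDl mul1r => eq2.
    have -> : lam / 2 * - (n ^+ 2 - n * e) = lam / 2 * n * e - lam / 2 * n ^+ 2 by ring.
    by move: amgm h4 eq2; set X := (2 * lam)^-1; set Y := lam / 2 * n ^+ 2;
       set Z := lam / 2 * n * e; set W := del * Q; lra.
  apply: le_trans tot.
  have -> : f t - f t' = (ipnorm (u t - u s) - ipnorm (u t' - u s)) - del / (2 * lam)
      + lam / 2 * (phi t - phi t').
    by rewrite /f /del; ring.
  apply: (@le_trans _ _ (del * (n + e) - del / (2 * lam) + lam / 2 *
    (- (del * (n ^+ 2 - n * e)) + 2^-1 * (del * (n + 1)) ^+ 2))).
    by rewrite lerD// lerB.
  by rewrite le_eqVlt; apply/orP; left; apply/eqP; rewrite /Q; field; rewrite gt_eqF.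
Unshelve. all: by end_near. Qed.

Variable phi0 : R.
Hypothesis u_cont0 : forall eta : R, 0 < eta -> exists2 d : R, 0 < d &
  forall t, 0 <= t -> t < d -> ipnorm (u t - u 0) <= eta.
Hypothesis phi0_sub : forall t, G t ->
  phi t - ip (du t) (u 0 - u t) - 2^-1 * ip (u 0 - u t) (u 0 - u t) <= phi0.

Lemma good_time_dense x y : 0 <= x -> x < y -> exists z, [/\ x < z, z < y & G z].
Proof.
move=> x0 xy; have [z [xz zy nz]] := null_complement_dense G_ae xy.
exists z; split => //; apply: contrapT => nG; apply: nz; split => //.
exact: le_lt_trans xz.
Qed.

(** Otherwise phi stays above phi0 + eta at all good times before s0.  Since the
    functional has the value phi0 at u 0, the subgradient inequality makes
    |u t - u 0|^2 decrease at a rate of at least eta, for as long as it is at most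
    eta; but this square is at most eta s1 / 4 already at a time sg <= s1 / 2, and
    cannot go on decreasing at this rate until s1. *)
Lemma flow_initial_energy s0 eta : 0 < s0 -> 0 < eta ->
  exists s, [/\ G s, s < s0 & phi s <= phi0 + eta].
Proof.
move=> s00 eta0; apply: contrapT => H.
have phig s : G s -> s < s0 -> phi0 + eta < phi s.
  by move=> Gs ss; rewrite ltNge; apply/negP => h; apply: H; exists s.
have D0 : D (u 0) by exact: uD.
pose psi t := ip (u t - u 0) (u t - u 0).
have small e : 0 < e -> exists2 d, 0 < d & forall t, 0 <= t -> t < d -> psi t <= e.
  move=> e0; have se : 0 < Num.sqrt e by rewrite sqrtr_gt0.
  have [d d0 hd] := u_cont0 se; exists d => // t t0 td.
  rewrite /psi -ipnorm_sq -(sqr_sqrtr (ltW e0)) ler_pXn2r ?nnegrE ?ipnorm_ge0 ?sqrtr_ge0//.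
  exact: hd.
have [d d0 hd] := small _ eta0.
pose s1 := Num.min s0 d / 2.
have m0 : 0 < Num.min s0 d by rewrite lt_min s00.
have s10 : 0 < s1 by rewrite divr_gt0.
have s1m : s1 < Num.min s0 d by rewrite /s1; lra.
move: (s1m); rewrite lt_min => /andP[s1s0 s1d].
have e4 : 0 < eta * s1 / 4 by rewrite divr_gt0// mulr_gt0.
have [d' d'0 hd'] := small _ e4.
pose sg := Num.min (s1 / 2) (d' / 2).
have sg0 : 0 < sg by rewrite lt_min !divr_gt0.
have sgs : sg <= s1 / 2 by rewrite /sg ge_min lexx.
have sgd : sg < d'.
  by apply: (@le_lt_trans _ _ (d' / 2)); [rewrite /sg ge_min lexx orbT|lra].
have psg : psi sg <= eta * s1 / 4 by apply: hd' => //; exact: ltW.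
have sgs1 : sg <= s1 by lra.
have fa : abs_cont sg s1 psi.
  have ni := abs_cont_dist sg0 sgs1 D0.
  by apply: eq_abs_cont (abs_contM ni ni) => x _; rewrite -expr2 ipnorm_sq.
have : psi s1 - psi sg <= itvint sg s1 (fun=> - eta).
  apply: (@abs_cont_le _ sg s1 psi (fun=> - eta) sgs1 fa (itvL1_cst _ _ _)).
  apply: negligibleS G_ae => t /= Ht.
  have /andP[st ts] : sg < t < s1 by apply: contrapT => nt; apply: Ht => /nt.
  have t0 : 0 < t by exact: lt_trans st.
  split => // Gt; apply: Ht => _.
  have Dt := duD Gt.
  have dv : curve_derivative (fun t => u t - u 0) t (du t).
    move=> e /(u_der Gt)[d1 d10 h1]; exists d1 => // h h0 /(h1 _ h0).
    by rewrite opprB addrA subrK.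
  have Dut : D (u t) by apply: uD; exact: ltW.
  have Dt0 : D (u t - u 0) by exact: ip_domB.
  have d1 := is_derive_ip_sq (near_curve_domB t0 D0) Dt dv.
  eexists; first exact: d1.
  have ps := phi0_sub Gt; have pg := phig _ Gt (lt_trans ts s1s0).
  have e1 : u 0 - u t = - (u t - u 0) by rewrite opprB.
  have DN := ip_domN Dt0.
  rewrite e1 !ipNr// ipNl// opprK opprK in ps.
  have pe : psi t <= eta by apply: hd; [exact: ltW|exact: lt_trans ts s1d].
  move: ps pg pe; rewrite /psi; set X := ip (du t) _; set Y := ip _ _; lra.
rewrite itvint_cst// mulNr => hh.
have p1 : 0 <= psi s1 by exact: ip_ge0.
have : eta * (s1 / 2) <= eta * (s1 - sg) by rewrite ler_pM2l//; lra.
have := mulr_gt0 eta0 s10; move: hh psg p1; set X := eta * (s1 - sg); rewrite mulrA.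
set Y := eta * s1; lra.
Qed.

(** The starting time of [flow_dissipation] tends to 0 along good times of energy
    close to phi0 or below. *)
Lemma flow_dissipation0 t lam : G t -> 0 < lam ->
  ipnorm (u t - u 0) <= t / (2 * lam) + lam / 2 * (phi0 - phi t).
Proof.
move=> Gt lam0; have t0 := G_gt0 Gt; have c0 : 0 < lam / 2 by rewrite divr_gt0.
apply/ler_addgt0Pr => e e0.
have e2 : 0 < e / 2 by rewrite divr_gt0.
have el : 0 < e / lam by rewrite divr_gt0.
have [d d0 hd] := u_cont0 e2.
have m0 : 0 < Num.min t d by rewrite lt_min t0.
have [s [Gs]] := flow_initial_energy m0 el.
rewrite lt_min => /andP[st sd] ps; have s0 := G_gt0 Gs.
have h1 := flow_dissipation Gs Gt (ltW st) lam0.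
have h2 := hd _ (ltW s0) sd.
have D0 : D (u 0) by exact: uD.
have Ds : D (u s) by apply: uD; exact: ltW.
have Dt : D (u t) by apply: uD; exact: ltW.
have -> : u t - u 0 = (u t - u s) + (u s - u 0) by rewrite addrA subrK.
apply: (le_trans (ipnormD (ip_domB Dt Ds) (ip_domB Ds D0))).
have h3 : (t - s) / (2 * lam) <= t / (2 * lam).
  by rewrite ler_wpM2r ?invr_ge0 ?mulr_ge0 ?(ltW lam0)// gerBl ltW.
have h4 : lam / 2 * (phi s - phi t) <= lam / 2 * (phi0 - phi t) + e / 2.
  have -> : e / 2 = lam / 2 * (e / lam) by field; rewrite gt_eqF.
  by rewrite -mulrDr ler_pM2l//; move: ps; set X := e / lam; lra.
move: h1 h2 h3 h4; set A := (t - s) / _; set B := lam / 2 * (phi s - _).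
by set C := t / _; lra.
Qed.

End semi_inner_product.

(** * The power function and the double-well potential *)

Section power_functions.
Context {R : realType}.
Implicit Types (p r s x y z : R).

Lemma continuous_norm_powR r x : x != 0 -> {for x, continuous (fun s => `|s| `^ r)}.
Proof.
move=> x0; have nx0 : 0 < `|x| by rewrite normr_gt0.
apply: (@continuous_comp _ _ _ (fun s : R => `|s|) (fun s => s `^ r)).
  exact: norm_continuous.
apply: differentiable_continuous; apply/derivable1_diffP.
by apply: derivable_powR; rewrite in_itv /= nx0.
Qed.

Lemma norm_powR_cvg0 r : 0 < r -> `|s| `^ r @[s --> (0 : R)] --> (0 : R).
Proof.
move=> r0; apply/cvgrPdist_lt => e e0.
exists (e `^ r^-1) => /=; first exact: powR_gt0.
move=> s; rewrite /ball_ /= !sub0r !normrN => h.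
rewrite ger0_norm ?powR_ge0//.
have -> : e = (e `^ r^-1) `^ r by rewrite -powRrM mulVf ?gt_eqF// powRr1// ltW.
by apply: gt0_ltr_powR => //; rewrite nnegrE ?normr_ge0 ?powR_ge0.
Qed.

Lemma continuous_norm_powR_ge r : 0 < r -> continuous (fun s : R => `|s| `^ r).
Proof.
move=> r0 x; have [->|x0] := eqVneq x 0; last exact: continuous_norm_powR.
have e0 : (fun s : R => `|s| `^ r) 0 = 0 by rewrite normr0 powR0 ?gt_eqF.
by have := norm_powR_cvg0 r0; rewrite -[X in _ --> X]e0; exact.
Qed.

Lemma plapM p x : 1 < p -> plap p x * x = `|x| `^ p.
Proof.
move=> p1; rewrite /plap; have [->|x0] := eqVneq x 0.
  by rewrite normr0 !mulr0 powR0// gt_eqF// (lt_trans ltr01).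
rewrite -mulrA -expr2 -real_normK ?num_real// -powR_mulrn//.
by rewrite -powRD ?subrK// normr_eq0 x0 implybT.
Qed.

Lemma plap_norm p x : 1 < p -> `|plap p x| = `|x| `^ (p - 1).
Proof.
move=> p1; rewrite /plap; have [->|x0] := eqVneq x 0.
  by rewrite mulr0 normr0 powR0// gt_eqF// subr_gt0.
rewrite normrM (ger0_norm (powR_ge0 _ _)) -[X in _ * X](@powRr1 _ `|x|)//.
rewrite -powRD; last by rewrite normr_eq0 x0 implybT.
by congr (_ `^ _); ring.
Qed.

Lemma plap0 p : plap p 0 = 0 :> R.
Proof. by rewrite /plap mulr0. Qed.

Lemma continuous_plap p : 1 < p -> continuous (@plap R p).
Proof.
move=> p1 x; have [->|x0] := eqVneq x 0; last first.
  by apply: cvgM; [exact: continuous_norm_powR|exact: cvg_id].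
rewrite /continuous_at plap0; apply: norm_cvg0.
have -> : (fun x : R => `|plap p x|) = (fun x => `|x| `^ (p - 1)).
  by apply/funext => s; exact: plap_norm.
by apply: norm_powR_cvg0; rewrite subr_gt0.
Qed.

(** Young's inequality for |y| and |x|^(p-1). *)
Lemma plap_tangent p x y : 1 < p ->
  `|x| `^ p / p + plap p x * (y - x) <= `|y| `^ p / p.
Proof.
move=> p1; have p0 : 0 < p by exact: lt_trans p1.
have pm : 0 < p - 1 by rewrite subr_gt0.
have q0 : 0 < p / (p - 1) by rewrite divr_gt0.
have pq : p^-1 + (p / (p - 1))^-1 = 1 by field; rewrite !gt_eqF.
have := conjugate_powR (normr_ge0 y) (powR_ge0 `|x| (p - 1)) p0 q0 pq.
have -> : (`|x| `^ (p - 1)) `^ (p / (p - 1)) = `|x| `^ p.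
  by rewrite -powRrM; congr (_ `^ _); field; rewrite gt_eqF.
have h : plap p x * y <= `|y| * `|x| `^ (p - 1).
  by rewrite -plap_norm// mulrC -normrM ler_norm.
rewrite mulrBr plapM//.
have -> : `|x| `^ p / (p / (p - 1)) = `|x| `^ p - `|x| `^ p / p.
  by field; rewrite !gt_eqF.
move: h; set A := plap p x * y; set B := `|y| * _; set X := `|x| `^ p.
set Y := `|y| `^ p / p; lra.
Qed.

Lemma plap_mono p x y : 1 < p -> x <= y -> plap p x <= plap p y.
Proof.
move=> p1; rewrite le_eqVlt => /orP[/eqP -> //|xy].
have h1 := plap_tangent x y p1; have h2 := plap_tangent y x p1.
rewrite -subr_ge0 -(pmulr_lge0 _ (_ : 0 < y - x)) ?subr_gt0//.
move: h1 h2; set A := plap p x; set B := plap p y.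
by rewrite -(opprB y x) mulrN mulrBl; lra.
Qed.

(** The difference quotient of f lies between the values of g at its two points.
    Differentiating powers of absolute values in this way avoids the case x = 0,
    where the exponent p - 2 may be negative. *)
Lemma is_derive_tangent (f g : R -> R) x : continuous g ->
  (forall x y, f x + g x * (y - x) <= f y) -> is_derive x 1 f (g x).
Proof.
move=> cg fg.
apply: is_derive_cvg; apply/cvgrPdist_le => e e0.
have /cvgrPdist_le/(_ _ e0)[d /= d0 hd] := cg x.
near=> h.
have h0 : h != 0 by near: h; exact: nbhs_dnbhs_neq.
have hh : `|h| < d by near: h; exact: dnbhs0_lt.
rewrite [h *: 1]mulr1.
have gd : `|g x - g (h + x)| <= e by apply: hd => /=; rewrite opprD addrCA subrr addr0 normrN.
have h1 := fg x (h + x); have h2 := fg (h + x) x.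
have e1 : h + x - x = h by ring.
have e2 : x - (h + x) = - h by ring.
rewrite e1 in h1; rewrite e2 in h2.
have q1 : 0 <= f (h + x) - f x - g x * h by lra.
have q2 : f (h + x) - f x - g x * h <= (g (h + x) - g x) * h.
  by rewrite mulrBl; move: h2; rewrite mulrN; lra.
have -> : g x - h^-1 *: (f (h + x) - f x) = - (h^-1 * (f (h + x) - f x - g x * h)).
  by rewrite /GRing.scale /=; field.
rewrite normrN normrM normfV ler_pdivrMl ?normr_gt0// ger0_norm//.
apply: (le_trans q2); apply: (le_trans (ler_norm _)).
by rewrite normrM mulrC ler_wpM2l// distrC.
Unshelve. all: by end_near. Qed.

Lemma is_derive_norm_powR p x : 1 < p ->
  is_derive x 1 (fun s => `|s| `^ p / p) (plap p x).
Proof.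
move=> p1; apply: is_derive_tangent; first exact: continuous_plap.
by move=> y z; exact: plap_tangent.
Qed.

Definition dpotential p x : R := plap p (x ^+ 2 - 1) * x.

Lemma is_derive_sqr1 x : is_derive x 1 (fun s : R => s ^+ 2 - 1) (2 * x).
Proof.
apply: (@is_derive_quad _ _ _ _ 1) => y.
have -> : y ^+ 2 - 1 - (x ^+ 2 - 1) - 2 * x * (y - x) = (y - x) ^+ 2 by ring.
by rewrite mul1r ger0_norm ?sqr_ge0.
Qed.

Lemma is_derive_potential p x : 1 < p ->
  is_derive x 1 (potential p) (dpotential p x).
Proof.
move=> p1; have d1 := is_derive_sqr1 x.
have d2 := is_derive_norm_powR (x ^+ 2 - 1) p1.
have d3 := @is_derive1_comp _ (fun s => `|s| `^ p / p) (fun s => s ^+ 2 - 1) x _ _ d2 d1.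
have -> : potential p = 2^-1 \*: ((fun s => `|s| `^ p / p) \o (fun s : R => s ^+ 2 - 1)).
  apply/funext => s; rewrite /potential /= /GRing.scale /= invfM; ring.
apply: is_derive_eq; rewrite /dpotential /GRing.scale /=.
by field.
Qed.

Lemma derive1_potential p : 1 < p -> derive1 (potential p) = dpotential p.
Proof.
move=> p1; apply/funext => x; rewrite derive1E.
have d := is_derive_potential x p1; exact: derive_val.
Qed.

Lemma continuous_potential p : 1 < p -> continuous (@potential R p).
Proof.
by move=> p1 x; exact: is_derive_continuous (is_derive_potential x p1).
Qed.

Lemma continuous_dpotential p : 1 < p -> continuous (@dpotential p).
Proof.
move=> p1 x; apply: cvgM; last exact: cvg_id.
apply: (@continuous_comp _ _ _ (fun s : R => s ^+ 2 - 1) (plap p)).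
  exact: is_derive_continuous (is_derive_sqr1 x).
exact: continuous_plap.
Qed.

Lemma potential_ge0 p x : 1 < p -> 0 <= potential p x.
Proof.
move=> p1; rewrite /potential mulr_ge0 ?powR_ge0// invr_ge0 mulr_ge0//.
by rewrite ltW// (lt_trans ltr01).
Qed.

(** The function F' y + y is odd, and on the half-line y >= 0 it is the product of
    y and of a nondecreasing function, which is nonnegative since
    y^2 - 1 >= - 1. *)
Lemma dpotential_mono p x y : 1 < p -> x <= y ->
  dpotential p x + x <= dpotential p y + y.
Proof.
move=> p1; pose m z := plap p (z ^+ 2 - 1) + 1 : R.
have mE z : dpotential p z + z = m z * z by rewrite /dpotential /m; ring.
have plN1 : plap p (-1) = -1 by rewrite /plap normrN1 powR1 mul1r.
have m0 z : 0 <= m z.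
  rewrite /m -[1]opprK -plN1 subr_ge0; apply: plap_mono => //.
  by have := sqr_ge0 z; lra.
have mN z : m (- z) = m z by rewrite /m sqrrN.
have pos a b : 0 <= a -> a <= b -> m a * a <= m b * b.
  move=> a0 ab; apply: ler_pM => //; rewrite /m lerD2r plap_mono// lerB//.
  by rewrite ler_pXn2r ?nnegrE// (le_trans a0).
rewrite !mE; have [x0|x0] := leP 0 x; first exact: pos.
have [y0|y0] := leP 0 y => xy.
  apply: (@le_trans _ _ 0); last exact: mulr_ge0.
  by apply: mulr_ge0_le0 => //; exact: ltW.
have h1 : 0 <= - y by rewrite oppr_ge0 ltW.
have h2 : - y <= - x by rewrite lerN2.
by have := pos _ _ h1 h2; rewrite !mN !mulrN lerN2.
Qed.

(** F y + y^2 / 2 has a nondecreasing derivative. *)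
Lemma potential_semiconvex p x y : 1 < p ->
  potential p x + dpotential p x * (y - x) - 2^-1 * (y - x) ^+ 2 <= potential p y.
Proof.
move=> p1; pose H z := potential p z + z ^+ 2 / 2 : R.
have dH z : is_derive z 1 H (dpotential p z + z).
  have d1 := is_derive_potential z p1; have d2 := is_derive_sqr1 z.
  have -> : H = potential p + 2^-1 \*: (fun s : R => s ^+ 2 - 1) + cst 2^-1.
    by apply/funext => s; rewrite /H /= !fctE /= /GRing.scale /=; field.
  by apply: is_derive_eq; rewrite /GRing.scale /=; field.
suff : H x + (dpotential p x + x) * (y - x) <= H y.
  rewrite /H; set A := dpotential p x; set B := potential p x; set C := potential p y.
  nra.
have [xy|/ltW yx] := leP x y.
  have [c /andP[xc cy] HE] := is_derive_mvt dH xy.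
  have := @ler_wpM2r _ (y - x) _ _ _ (dpotential_mono p1 xc).
  by rewrite subr_ge0 => /(_ xy); rewrite -HE; lra.
have [c /andP[yc cx] HE] := is_derive_mvt dH yx.
have := @ler_wpM2r _ (x - y) _ _ _ (dpotential_mono p1 cx).
rewrite subr_ge0 => /(_ yx); rewrite -HE -(opprB x y) mulrN; lra.
Qed.

End power_functions.

(** * The primitive Psi and Young's inequality *)

Section primitive_Psi.
Context {R : realType} (p : R).
Hypothesis p1 : 1 < p.
Local Notation mu := (@lebesgue_measure R).
Local Notation lam := (lambda_const p).
Implicit Types (x y z d q eps k : R).

Let p0 : 0 < p. Proof. exact: lt_trans p1. Qed.
Let pm : 0 < p - 1. Proof. by rewrite subr_gt0. Qed.

Definition conj_exp : R := p / (p - 1).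

Lemma conj_exp_gt0 : 0 < conj_exp. Proof. by rewrite divr_gt0. Qed.

Lemma lambda_gt0 : 0 < lam.
Proof. by rewrite /lambda_const mulr_gt0// powR_gt0. Qed.

Lemma lambda_powR : lam `^ p * (p - 1) = 2 `^ (p - 1).
Proof.
rewrite /lambda_const powRM ?powR_ge0// -!powRrM.
have -> : - p^-1 * p = -1 by field; rewrite gt_eqF.
have -> : (1 - p^-1) * p = p - 1 by field; rewrite gt_eqF.
by rewrite powR_inv1 ?ltW// divfK// gt_eqF.
Qed.

(** The function (p' F)^(1/p') on [-1, 1], and 0 elsewhere, in closed form.  The
    cut-off makes its primitive [Psi] bounded and globally Lipschitz. *)
Definition dPsi y : R := `|lam / 2 * pos_part (1 - y ^+ 2)| `^ (p - 1).

Lemma dPsi_ge0 y : 0 <= dPsi y. Proof. exact: powR_ge0. Qed.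

Lemma dPsiN y : dPsi (- y) = dPsi y. Proof. by rewrite /dPsi sqrrN. Qed.

Lemma dPsi_out y : 1 <= `|y| -> dPsi y = 0.
Proof.
move=> h; have y2 : 1 <= y ^+ 2 by rewrite -real_normK ?num_real// expr_ge1.
rewrite /dPsi; have [[u0 ->]|[u0 ->]] := pos_partP (1 - y ^+ 2).
  have -> : 1 - y ^+ 2 = 0 by lra.
  by rewrite mulr0 normr0 powR0// gt_eqF.
by rewrite mulr0 normr0 powR0// gt_eqF.
Qed.

Lemma continuous_dPsi : continuous dPsi.
Proof.
move=> y; apply: (@continuous_comp _ _ _ (fun y => lam / 2 * pos_part (1 - y ^+ 2))
   (fun s => `|s| `^ (p - 1))).
  apply: cvgM; first exact: cvg_cst.
  have h1 : (fun y : R => 1 - y ^+ 2) @ y --> 1 - y ^+ 2.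
    by apply: cvgB; [exact: cvg_cst|exact: exprn_continuous].
  have h2 : (fun z : R => pos_part z) @ (1 - y ^+ 2) --> pos_part (1 - y ^+ 2).
    have := @continuous_pos_part R 0 (1 - y ^+ 2); rewrite /continuous_at subr0.
    by under eq_fun do rewrite subr0.
  exact: (cvg_comp _ _ h1 h2).
exact: continuous_norm_powR_ge.
Qed.

Lemma pos_part_ge0 z : 0 <= pos_part z.
Proof. by have [[? ->]|[? ->]] := pos_partP z. Qed.

Lemma dPsi_conj_exp y : dPsi y `^ conj_exp = (lam / 2) `^ p * pos_part (1 - y ^+ 2) `^ p.
Proof.
rewrite /dPsi -powRrM.
have -> : (p - 1) * conj_exp = p by rewrite /conj_exp; field; rewrite gt_eqF.
have l0 : 0 <= lam / 2 by rewrite divr_ge0// ltW// lambda_gt0.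
have h0 := mulr_ge0 l0 (pos_part_ge0 (1 - y ^+ 2)).
rewrite ger0_norm// powRM//; exact: pos_part_ge0.
Qed.

Lemma lambda_half_powR : (lam / 2) `^ p / conj_exp = (2 * p)^-1.
Proof.
rewrite powRM ?(ltW lambda_gt0) ?invr_ge0// /conj_exp.
have := lambda_powR; have -> : 2 `^ (p - 1) = 2 `^ p / 2 :> R.
  by rewrite -[X in _ / X]powRr1// -powRB//; apply/implyP => _.
have -> : 2^-1 `^ p = (2 `^ p)^-1 :> R by rewrite -powR_inv1// -powRrM mulN1r powRN.
have h2 : 0 < 2 `^ p :> R by exact: powR_gt0.
move=> h; have -> : lam `^ p = 2 `^ p / 2 / (p - 1) by rewrite -h mulfK// gt_eqF.
by field; rewrite !gt_eqF.
Qed.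

Lemma dPsi_potential y : `|y| <= 1 -> dPsi y `^ conj_exp / conj_exp = potential p y.
Proof.
move=> h; rewrite dPsi_conj_exp mulrAC lambda_half_powR /potential; congr (_ * _ `^ _).
have y2 : y ^+ 2 <= 1 by rewrite -real_normK ?num_real// expr_le1.
have [[u0 ->]|[u0 ->]] := pos_partP (1 - y ^+ 2).
  by rewrite distrC ger0_norm.
have -> : y ^+ 2 - 1 = 0 by lra.
by rewrite normr0.
Qed.

Lemma dPsi_potential_le y : dPsi y `^ conj_exp / conj_exp <= potential p y.
Proof.
have [h|/ltW h] := leP `|y| 1; first by rewrite dPsi_potential.
rewrite dPsi_out// powR0 ?gt_eqF ?conj_exp_gt0// mul0r; exact: potential_ge0.
Qed.

(** Young's inequality for eps^((p-1)/p) |q| and k dPsi(y) eps^(-(p-1)/p); only the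
    fraction k^p' of the potential energy is used. *)
Lemma young_energy eps k y q : 0 < eps -> 0 <= k ->
  k * (dPsi y * `|q|) <=
  eps `^ (p - 1) * `|q| `^ p / p + k `^ conj_exp * (potential p y / eps).
Proof.
move=> e0 k0; pose al := eps `^ ((p - 1) / p).
have al0 : 0 < al by exact: powR_gt0.
have pq : p^-1 + conj_exp^-1 = 1 by rewrite /conj_exp; field; rewrite !gt_eqF.
have a0 : 0 <= al * `|q| by rewrite mulr_ge0// ltW.
have b0 : 0 <= k * dPsi y / al by rewrite divr_ge0 ?mulr_ge0 ?dPsi_ge0// ltW.
have := conjugate_powR a0 b0 p0 conj_exp_gt0 pq.
have -> : al * `|q| * (k * dPsi y / al) = k * (dPsi y * `|q|) by field; rewrite gt_eqF.
have alp : al `^ p = eps `^ (p - 1) by rewrite /al -powRrM divfK// gt_eqF.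
have alc : al^-1 `^ conj_exp = eps^-1.
  rewrite -(powR_inv1 (ltW al0)) -powRrM /al -powRrM.
  have -> : (p - 1) / p * (-1 * conj_exp) = -1 by rewrite /conj_exp; field; rewrite !gt_eqF.
  by rewrite powR_inv1// ltW.
rewrite powRM ?(ltW al0)// alp => /le_trans; apply.
rewrite lerD2l powRM ?mulr_ge0 ?dPsi_ge0 ?invr_ge0 ?(ltW al0)// alc powRM ?dPsi_ge0//.
have -> : k `^ conj_exp * dPsi y `^ conj_exp / eps / conj_exp =
  k `^ conj_exp / eps * (dPsi y `^ conj_exp / conj_exp) by ring.
have -> : k `^ conj_exp * (potential p y / eps) = k `^ conj_exp / eps * potential p y by ring.
by apply: ler_wpM2l; [rewrite divr_ge0 ?powR_ge0// ltW|exact: dPsi_potential_le].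
Qed.

Lemma dPsi_restrict : dPsi \_ `[-1, 1] = dPsi.
Proof.
apply/funext => y; rewrite patchE; case: ifPn => // h; rewrite dPsi_out//.
rewrite leNgt; apply: contra h => h; rewrite inE /= in_itv /= -ler_norml; exact: ltW.
Qed.

Lemma dPsi_itvL1 a b : itvL1 a b dPsi.
Proof. by apply: continuous_itvL1; apply: continuous_subspaceT; exact: continuous_dPsi. Qed.

Definition Psi y : R := itvprim (-1) 1 dPsi y.

Lemma is_derive_Psi y : is_derive y 1 Psi (dPsi y).
Proof.
have om1 : mu.-integrable `]-oo, y + 1] (EFin \o dPsi).
  rewrite -dPsi_restrict; apply: integrableS (itvL1_restrict (dPsi_itvL1 _ _)) => //.
have y1 : y < y + 1 by rewrite ltrDl.
have := continuous_FTC1 y1 om1; rewrite ltNyr => /(_ isT (@continuous_dPsi y))[d1 d2].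
have PsiE : Psi = (fun x => \int[mu]_(t in `]-oo, x]) dPsi t).
  by apply/funext => x; rewrite /Psi /itvprim dPsi_restrict.
rewrite PsiE; apply: DeriveDef; [exact: d1|by rewrite -derive1E d2].
Qed.

Lemma Psi_mono x y : x <= y -> Psi x <= Psi y.
Proof.
move=> xy; have [c _ e] := is_derive_mvt is_derive_Psi xy.
by rewrite -subr_ge0 e mulr_ge0 ?dPsi_ge0// subr_ge0.
Qed.

Lemma Psi_left y : y <= -1 -> Psi y = 0.
Proof.
move=> y1; rewrite /Psi /itvprim; transitivity (\int[mu]_(t in `]-oo, y]) (cst 0 t : R)).
  apply: eq_Rintegral => z; rewrite inE /= in_itv /= => zy.
  by rewrite dPsi_restrict dPsi_out// ler_normr; apply/orP; right; lra.
by rewrite /Rintegral /= integral0.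
Qed.

Lemma Psi_ge0 y : 0 <= Psi y.
Proof.
have [h|/ltW h] := leP y (-1); first by rewrite Psi_left.
by rewrite -(Psi_left (lexx _)); exact: Psi_mono.
Qed.

(** The energy c_p of a transition is the increment of Psi between the wells. *)
Lemma Psi1 : Psi 1 = c_const p.
Proof.
rewrite -[LHS]subr0 -[X in _ - X](Psi_left (lexx _)) /Psi itvprimB//; last exact: dPsi_itvL1.
rewrite /c_const -RintegralZl//; last first.
  apply: (@continuous_itvL1 _ (-1) 1); apply: continuous_subspaceT => y.
  have r0 : 0 < (p - 1) / p by rewrite divr_gt0.
  have -> : (fun s : R => potential p s `^ ((p - 1) / p)) =
      (fun s => `|s| `^ ((p - 1) / p)) \o potential p.
    by apply/funext => s; rewrite /= ger0_norm// potential_ge0.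
  apply: (@continuous_comp _ _ _ (potential p) (fun s => `|s| `^ ((p - 1) / p))).
    exact: continuous_potential.
  exact: continuous_norm_powR_ge.
apply: eq_itvint => y /andP[y1 y2].
have yn : `|y| <= 1 by rewrite ler_norml y1.
rewrite -dPsi_potential// -powRM ?divr_ge0 ?powR_ge0 ?(ltW p0) ?(ltW pm)//.
rewrite mulrC divfK ?gt_eqF ?conj_exp_gt0// -powRrM.
have -> : conj_exp * ((p - 1) / p) = 1 by rewrite /conj_exp; field; rewrite !gt_eqF.
by rewrite powRr1// dPsi_ge0.
Qed.

End primitive_Psi.

(** * Calibrations *)

Section calibration.
Context {R : realType} (p : R).
Hypothesis p1 : 1 < p.
Local Notation mu := (@lebesgue_measure R).
Local Notation lam := (lambda_const p).
Local Notation Psi := (@Psi R p).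
Local Notation dPsi := (@dPsi R p).
Local Notation p' := (conj_exp p).
Implicit Types (x y z d q eps k : R).

Let p0 : 0 < p. Proof. exact: lt_trans p1. Qed.
Let pm : 0 < p - 1. Proof. by rewrite subr_gt0. Qed.

Lemma dPsi_le y : dPsi y <= (lam / 2) `^ (p - 1).
Proof.
have l0 : 0 <= lam / 2 by rewrite divr_ge0// ltW// lambda_gt0.
rewrite /dPsi; apply: ge0_ler_powR; rewrite ?nnegrE ?(ltW pm)//.
rewrite normrM (ger0_norm l0) ler_piMr// ger0_norm ?pos_part_ge0//.
have [[u0 ->]|[u0 ->]] := pos_partP (1 - y ^+ 2) => //.
by have := sqr_ge0 y; lra.
Qed.

Lemma Psi_lipschitz x y : `|Psi y - Psi x| <= (lam / 2) `^ (p - 1) * `|y - x|.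
Proof.
have H a b : a <= b -> `|Psi b - Psi a| <= (lam / 2) `^ (p - 1) * `|b - a|.
  move=> ab; have [c _ ->] := is_derive_mvt (is_derive_Psi p1) ab.
  by rewrite normrM ler_wpM2r// ger0_norm ?dPsi_ge0// dPsi_le.
have [xy|/ltW yx] := leP x y; first exact: H.
by rewrite distrC [in leRHS]distrC; exact: H.
Qed.

(** The slope is even, so the reflection y |-> - y exchanges the wells. *)
Lemma PsiN y : Psi y + Psi (- y) = c_const p.
Proof.
pose f z := Psi z + Psi (- z).
have df z : is_derive z 1 f 0.
  have d1 := is_derive_Psi p1 z; have d2 := is_derive_Psi p1 (- z).
  have d3 : is_derive z 1 (-%R : R -> R) (-1) by exact: is_deriveNid.
  have d4 := @is_derive1_comp _ Psi (-%R) z _ _ d2 d3.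
  have d5 := is_deriveD d1 d4; apply: is_derive_eq d5 _.
  by rewrite dPsiN mulrN1 subrr.
have H a b : a <= b -> f a = f b.
  move=> ab; have [c _ /eqP] := is_derive_mvt df ab.
  by rewrite mul0r subr_eq0 => /eqP.
have <- : f 1 = c_const p by rewrite /f Psi1// Psi_left// addr0.
have [h|/ltW h] := leP y 1; [exact: H|exact/esym/H].
Qed.

Lemma Psi_le_c y : Psi y <= c_const p.
Proof. by rewrite -(PsiN y) lerDl Psi_ge0. Qed.

Lemma c_const_ge0 : 0 <= c_const p :> R.
Proof. by rewrite -(PsiN 0) addr_ge0// Psi_ge0. Qed.

(** At the point -1 + d the slope is at most (lam d)^(p-1), as
    1 - (-1 + d)^2 <= 2 d. *)
Lemma Psi_near_well d : 0 <= d -> d <= 2 -> Psi (-1 + d) <= lam `^ (p - 1) * (d `^ p / p).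
Proof.
move=> d0 d2; pose B (t : R) : R := lam `^ (p - 1) * (`|t| `^ p / p) - Psi (t + -1).
pose dB (t : R) : R := lam `^ (p - 1) * plap p t - dPsi (t + -1).
have dBP (t : R) : is_derive t 1 B (dB t).
  have h1 := is_derive_norm_powR t p1; have h2 := is_derive_Psi p1 (t + -1).
  have h3 : is_derive t 1 (fun t : R => t + -1) 1 by exact: is_derive_shift.
  have h4 := @is_derive1_comp _ Psi (fun t : R => t + -1) t _ _ h2 h3.
  have h5 := is_deriveZ (lam `^ (p - 1)) h1.
  by have h6 := is_deriveB h5 h4; apply: is_derive_eq h6 _; rewrite mulr1.
have [c /andP[c0 cd] E] := is_derive_mvt dBP d0.
suff : 0 <= B d.
  by rewrite /B ger0_norm// subr_ge0 addrC.
have B0 : B 0 = 0.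
  by rewrite /B normr0 powR0 ?gt_eqF// mul0r mulr0 add0r Psi_left ?subr0 ?oppr0// add0r.
have -> : B d = dB c * d by move: E; rewrite B0 !subr0.
apply: mulr_ge0 => //.
rewrite subr_ge0 /dPsi; have -> : lam `^ (p - 1) * plap p c = `|lam * c| `^ (p - 1).
  have pc : 0 <= plap p c by apply: mulr_ge0; rewrite ?powR_ge0.
  have l0 := ltW (lambda_gt0 p1).
  rewrite normrM (ger0_norm l0) (@powRM _ lam `|c|)//.
  by rewrite -(plap_norm _ p1) (ger0_norm pc).
move: (lambda_gt0 p1); move: lam => l l0.
apply: ge0_ler_powR; rewrite ?nnegrE ?(ltW pm)//.
rewrite (normrM (l / 2)) (normrM l 2^-1) (normrM l c) (gtr0_norm l0) -mulrA ler_pM2l//.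
rewrite (ger0_norm c0) (@ger0_norm _ 2^-1) ?invr_ge0// (ger0_norm (pos_part_ge0 _)).
have [[u0 ->]|[u0 ->]] := pos_partP (1 - (c + -1) ^+ 2); last by rewrite mulr0.
by have := sqr_ge0 c; rewrite sqrrD; lra.
Qed.

(** For d up to this radius, (1 - d / 2)^p >= 1 - p d / 2 >= 9 / 10. *)
Definition well_radius : R := (5 * p)^-1.

Lemma well_radius_gt0 : 0 < well_radius.
Proof. by rewrite invr_gt0 mulr_gt0. Qed.

Lemma well_radius_lt1 : well_radius < 1.
Proof.
have h : 1 < 5 * p by move: (p1) => h; lra.
by rewrite invf_lt1// (lt_trans ltr01).
Qed.

(** Near the well -1 both sides are of the order of the p-th power of the distance
    to the well, with the quotient (p - 1) lambda_p in the limit; the factor 9 / 10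
    makes the inequality hold in a neighbourhood of fixed size. *)
Lemma Psi_potential y : y <= -1 + well_radius ->
  (p - 1) * (9 / 10 * lam) * Psi y <= potential p y.
Proof.
move=> yd; have [h|/ltW h] := leP y (-1).
  by rewrite Psi_left// mulr0 potential_ge0.
pose d := y + 1; have d0 : 0 <= d by rewrite /d; lra.
have dw : d <= well_radius by rewrite /d; lra.
have w1 := well_radius_lt1.
have yE : y = -1 + d by rewrite /d; ring.
have hP := Psi_near_well d0 (ltac:(lra) : d <= 2).
have l0 := lambda_gt0 p1.
have l1 : lam `^ p = lam * lam `^ (p - 1) by rewrite mulr_powRB1// ltW.
have FE : potential p y = (p - 1) * lam * (lam `^ (p - 1) * (d `^ p / p)) * (1 - d / 2) `^ p.
  rewrite /potential yE.
  have -> : (-1 + d) ^+ 2 - 1 = - (2 * d * (1 - d / 2)) by field.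
  rewrite normrN ger0_norm; last by apply: mulr_ge0; [rewrite mulr_ge0|lra].
  rewrite powRM ?mulr_ge0//; last lra.
  rewrite powRM//; have -> : 2 `^ p = 2 * (lam `^ p * (p - 1)).
    by rewrite lambda_powR// mulr_powRB1.
  by rewrite l1; field; rewrite !gt_eqF.
have bern : 9 / 10 <= (1 - d / 2) `^ p.
  have := plap_tangent 1 (1 - d / 2) p1.
  rewrite /plap normr1 !powR1 /= mul1r mul1r ger0_norm; last lra.
  rewrite ler_pdivlMr// (_ : (p^-1 + 1 * (1 - d / 2 - 1)) * p = 1 - p * d / 2); last first.
    by field; rewrite gt_eqF.
  apply: le_trans.
  have : p * d <= p * well_radius by rewrite ler_pM2l.
  by rewrite (_ : p * well_radius = 1 / 5); [lra|rewrite /well_radius; field; rewrite gt_eqF].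
rewrite FE -yE in hP *.
have c0 : 0 <= (p - 1) * lam by rewrite mulr_ge0// ltW.
apply: (@le_trans _ _ ((p - 1) * lam * (lam `^ (p - 1) * (d `^ p / p)) * (9 / 10))).
  have := ler_wpM2l c0 hP; set X := (p - 1) * lam * Psi y; set Y := (p - 1) * lam * (_ * _).
  have -> : (p - 1) * (9 / 10 * lam) * Psi y = 9 / 10 * X by rewrite /X; ring.
  lra.
apply: ler_wpM2l => //; apply: mulr_ge0 => //; apply: mulr_ge0; first exact: powR_ge0.
by rewrite divr_ge0 ?powR_ge0// ltW.
Qed.

Definition energy_density eps (W g : R -> R) z : R :=
  eps `^ (p - 1) * `|g z| `^ p / p + potential p (W z) / eps.

Definition abs_cont_deriv x y (W g : R -> R) : Prop :=
  [/\ abs_cont x y W, itvL1 x y g &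
      {ae mu, forall z, x < z < y -> is_derive z 1 W (g z)}].

Lemma abs_cont_deriv_sub x y x' y' W g : x <= x' -> y' <= y -> abs_cont_deriv x y W g ->
  abs_cont_deriv x' y' W g.
Proof.
move=> xx yy [Wa gi dW]; split; [exact: abs_cont_sub Wa|exact: itvL1_sub gi|].
apply: ae_mono dW => z h /andP[xz zy]; apply: h.
by rewrite (le_lt_trans xx xz) (lt_le_trans zy yy).
Qed.

Lemma abs_cont_derivN x y W g : abs_cont_deriv x y W g ->
  abs_cont_deriv x y (fun z => - W z) (fun z => - g z).
Proof.
move=> [Wa gi dW]; split; [exact: abs_contN|exact: itvL1N|].
by apply: ae_mono dW => z h /h d; exact: is_deriveN.
Qed.

Lemma energy_densityN eps (W g : R -> R) : energy_density eps (fun z => - W z) (fun z => - g z) = energy_density eps W g.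
Proof. by apply/funext => z; rewrite /energy_density normrN /potential sqrrN. Qed.

Lemma energy_density_ge0 eps W g z : 0 < eps -> 0 <= energy_density eps W g z.
Proof.
move=> e0; apply: addr_ge0; apply: divr_ge0; rewrite ?(ltW p0) ?(ltW e0)//.
  by rewrite mulr_ge0 ?powR_ge0.
exact: potential_ge0.
Qed.

(** The derivative of kap Psi(W) is kap' Psi(W) + kap dPsi(W) W'.  By Young's
    inequality the second term is at most the gradient energy plus the fraction
    kap^p' of the potential energy; the hypothesis on kap says that the rest of the
    potential energy pays for the first term. *)
Lemma calibration eps (W g kap dkap : R -> R) x y : 0 < eps -> x <= y ->
  abs_cont_deriv x y W g -> itvL1 x y (energy_density eps W g) -> abs_cont x y kap ->
  (forall z, is_derive z 1 kap (dkap z)) ->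
  (forall z, x <= z <= y -> 0 <= kap z /\
     `|dkap z| * Psi (W z) <= (1 - kap z `^ p') * (potential p (W z) / eps)) ->
  `|kap y * Psi (W y) - kap x * Psi (W x)| <= itvint x y (energy_density eps W g).
Proof.
move=> e0 xy [Wa gi dW] ei ka dk kP.
pose f z := kap z * Psi (W z).
have fa : abs_cont x y f.
  apply: abs_contM => //; apply: (@abs_cont_comp _ _ _ _ Psi ((lam / 2) `^ (p - 1))) => //.
    exact: powR_ge0.
  by move=> z t _ _; exact: Psi_lipschitz.
have df z : is_derive z 1 W (g z) ->
    is_derive z 1 f (dkap z * Psi (W z) + kap z * (dPsi (W z) * g z)).
  move=> dWz; have d1 := is_derive_Psi p1 (W z).
  have d2 := @is_derive1_comp _ Psi W z _ _ d1 dWz.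
  have d3 := is_deriveM (dk z) d2.
  apply: is_derive_eq d3 _; rewrite /GRing.scale /=; ring.
have bd z : x <= z <= y ->
   `|dkap z * Psi (W z) + kap z * (dPsi (W z) * g z)| <= energy_density eps W g z.
  move=> /kP[k0 hk]; apply: (le_trans (ler_normD _ _)).
  rewrite !normrM (ger0_norm (Psi_ge0 p1 _)) (ger0_norm k0) (ger0_norm (dPsi_ge0 _ _)).
  have := young_energy p1 (W z) (g z) e0 k0; rewrite /energy_density.
  move: hk; rewrite mulrBl mul1r; set A := `|dkap z| * _; set B := kap z * _.
  by set X := eps `^ _ * _ / _; set Y := _ `^ p' * _; set Z := _ / eps; lra.
have bd2 z : x < z < y -> `|dkap z * Psi (W z) + kap z * (dPsi (W z) * g z)| <= energy_density eps W g z.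
  by move=> /andP[xz zy]; apply: bd; rewrite !ltW.
rewrite ler_norml; apply/andP; split; last first.
  apply: (abs_cont_le xy fa ei); apply: ae_mono dW => z h xz.
  exists (dkap z * Psi (W z) + kap z * (dPsi (W z) * g z)); first exact: df (h xz).
  exact: le_trans (ler_norm _) (bd2 _ xz).
rewrite lerNl opprB.
have -> : kap x * Psi (W x) - kap y * Psi (W y) = - f y - - f x by rewrite opprK addrC.
apply: (abs_cont_le xy (abs_contN fa) ei); apply: ae_mono dW => z h xz.
exists (- (dkap z * Psi (W z) + kap z * (dPsi (W z) * g z))).
  by have d1 := df _ (h xz); exact: is_deriveN.
by apply: le_trans (bd2 _ xz); rewrite -normrN ler_norm.
Qed.

End calibration.

(** * Tails near a well *)

(** The unoriented integral, with which both sides of a jump are treated at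
    once. *)
Definition uitvint {R : realType} (s t : R) (f : R -> R) : R :=
  itvint (Num.min s t) (Num.max s t) f.

Section tails.
Context {R : realType} (p : R).
Hypothesis p1 : 1 < p.
Local Notation lam := (lambda_const p).
Local Notation Psi := (@Psi R p).
Local Notation p' := (conj_exp p).
Implicit Types (x y z d q eps k s t : R).

Let p0 : 0 < p. Proof. exact: lt_trans p1. Qed.
Let pm : 0 < p - 1. Proof. by rewrite subr_gt0. Qed.

Lemma uitvint_le s t f : s <= t -> uitvint s t f = itvint s t f.
Proof. by move=> st; rewrite /uitvint min_l ?max_r. Qed.

Lemma uitvintC s t f : uitvint s t f = uitvint t s f.
Proof. by rewrite /uitvint minC maxC. Qed.

(** The inequality of Modica and Mortola is the calibration with weight 1. *)
Lemma Psi_le_energy eps (W g : R -> R) x y : 0 < eps -> x <= y ->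
  abs_cont_deriv x y W g -> itvL1 x y (energy_density p eps W g) ->
  `|Psi (W y) - Psi (W x)| <= itvint x y (energy_density p eps W g).
Proof.
move=> e0 xy Wg ei.
have := @calibration _ _ p1 eps W g (cst 1) (cst 0) x y e0 xy Wg ei.
rewrite !mul1r; apply; first exact: abs_cont_cst.
by move=> z _; rewrite /= normr0 mul0r powR1 subrr mul0r.
Qed.

Lemma Psi_between_le_energy eps (W g : R -> R) x y s t : 0 < eps ->
  x <= s <= y -> x <= t <= y ->
  abs_cont_deriv x y W g -> itvL1 x y (energy_density p eps W g) ->
  Psi (W s) - Psi (W t) <= itvint x y (energy_density p eps W g).
Proof.
move=> e0.
have H s' t' : x <= s' -> s' <= t' -> t' <= y ->
    abs_cont_deriv x y W g -> itvL1 x y (energy_density p eps W g) ->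
    `|Psi (W t') - Psi (W s')| <= itvint x y (energy_density p eps W g).
  move=> xs st ty Wg ei.
  apply: (le_trans (Psi_le_energy e0 st (abs_cont_deriv_sub xs ty Wg) (itvL1_sub xs ty ei))).
  by apply: itvint_le_sub => // z _; exact: energy_density_ge0.
move=> /andP[xs sy] /andP[xt ty] Wg ei.
have [st|/ltW ts] := leP s t.
  by apply: le_trans (H _ _ xs st ty Wg ei); rewrite distrC ler_norm.
by apply: le_trans (H _ _ xt ts sy Wg ei); rewrite ler_norm.
Qed.

(** Weights that relax to 1 exponentially satisfy |kap'| = (th / eps) (1 - kap), which
    turns the condition of [calibration] into an algebraic one on the rate th. *)
Lemma calibration_exp eps (W g : R -> R) x y (B c th kmin : R) s t :
  0 < eps -> 0 <= kmin -> 0 <= B -> `|c| = th / eps ->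
  (forall k w, kmin <= k <= 1 -> w <= -1 + well_radius p ->
    th * (1 - k) * Psi w <= (1 - k `^ p') * potential p w) ->
  x <= s <= y -> x <= t <= y ->
  abs_cont_deriv x y W g -> itvL1 x y (energy_density p eps W g) ->
  (forall z, x <= z <= y -> W z <= -1 + well_radius p) ->
  (forall z, Num.min s t <= z <= Num.max s t -> kmin <= 1 - B * expR (c * z)) ->
  (1 - B * expR (c * t)) * Psi (W t) - (1 - B * expR (c * s)) * Psi (W s)
   <= uitvint s t (energy_density p eps W g).
Proof.
move=> e0 km0 B0 cE H.
have G s' t' : x <= s' -> s' <= t' -> t' <= y ->
  abs_cont_deriv x y W g -> itvL1 x y (energy_density p eps W g) ->
  (forall z, x <= z <= y -> W z <= -1 + well_radius p) ->
  (forall z, s' <= z <= t' -> kmin <= 1 - B * expR (c * z)) ->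
  `|(1 - B * expR (c * t')) * Psi (W t') - (1 - B * expR (c * s')) * Psi (W s')|
   <= itvint s' t' (energy_density p eps W g).
  move=> xs st ty Wg ei Ww kp.
  pose kap z := 1 - B * expR (c * z).
  have := @calibration _ _ p1 eps W g kap (fun z => - (B * (c * expR (c * z)))) s' t' e0 st
    (abs_cont_deriv_sub xs ty Wg) (itvL1_sub xs ty ei).
  apply.
  - apply: abs_contB; first exact: abs_cont_cst.
    by apply: abs_contM; [exact: abs_cont_cst|exact: abs_cont_expR].
  - move=> z; have d1 := is_derive_expRM c z.
    have d2 := is_deriveB (is_derive_cst (1 : R) z 1) (is_deriveZ B d1).
    by apply: is_derive_eq d2 _; rewrite sub0r.
  - move=> z zst; have kz := kp _ zst; split; first exact: le_trans kz.
    have xzy : x <= z <= y.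
      by case/andP: zst => sz zt; rewrite (le_trans xs sz) (le_trans zt ty).
    have Be0 : 0 <= B * expR (c * z) by rewrite mulr_ge0// expR_ge0.
    have k1 : kmin <= kap z <= 1 by rewrite kz /kap lerBlDr lerDl.
    have -> : `|- (B * (c * expR (c * z)))| = th * (1 - kap z) / eps.
      rewrite normrN mulrCA normrM cE (ger0_norm Be0) /kap opprB addrC subrK.
      by rewrite mulrAC.
    rewrite mulrA mulrAC ler_wpM2r ?invr_ge0 ?(ltW e0)//.
    exact: H (Ww _ xzy).
move=> /andP[xs sy] /andP[xt ty] Wg ei Ww kp.
have [st|/ltW ts] := leP s t.
  rewrite uitvint_le//; apply: (le_trans (ler_norm _)); apply: G => //.
  by move=> z; move: (kp z); rewrite min_l ?max_r.
rewrite uitvintC uitvint_le//; apply: (le_trans (ler_norm _)); rewrite distrC; apply: G => //.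
by move=> z; move: (kp z); rewrite min_r ?max_l.
Qed.

(** The rate th1 is available for all weights, since 1 - k^p' >= 1 - k.  For weights
    close to 1, 1 - k^p' is almost p' (1 - k), which improves the rate by the factor
    p' = p / (p - 1); the level k1 from which this holds up to another factor 9 / 10
    solves k1^(p'-1) = 9 / 10. *)
Let nu : R := 9 / 10 * lam.
Let th1 : R := (p - 1) * nu.
Let th2 : R := 9 / 10 * (p * nu).
Let k1 : R := (9 / 10) `^ (p - 1).

Let nu0 : 0 < nu. Proof. by apply: mulr_gt0; [exact: divr_gt0|exact: lambda_gt0]. Qed.
Let th10 : 0 < th1. Proof. exact: mulr_gt0. Qed.
Let th20 : 0 < th2.
Proof. by apply: mulr_gt0; [exact: divr_gt0|exact: mulr_gt0]. Qed.
Let k10 : 0 < k1. Proof. by apply: powR_gt0; exact: divr_gt0. Qed.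
Let k11 : k1 < 1.
Proof.
have h : (9 / 10 : R) < 1 by lra.
apply: (@lt_le_trans _ _ (1 `^ (p - 1))); last by rewrite powR1.
by apply: gt0_ltr_powR; rewrite ?nnegrE// divr_ge0.
Qed.

Lemma rate_any_weight k w : 0 <= k <= 1 -> w <= -1 + well_radius p ->
  th1 * (1 - k) * Psi w <= (1 - k `^ p') * potential p w.
Proof.
move=> /andP[k0 kl1] hw; have h := Psi_potential p1 hw.
have kk : 0 <= 1 - k by rewrite subr_ge0.
apply: (@le_trans _ _ ((1 - k) * potential p w)).
  by rewrite mulrAC mulrC ler_wpM2l.
apply: ler_wpM2r; first exact: potential_ge0.
have [->|kn0] := eqVneq k 0; first by rewrite powR0 ?gt_eqF ?conj_exp_gt0// subr0.
rewrite lerB// ge1r_powR//; last by rewrite /conj_exp ler_pdivlMr// mul1r gerBl.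
by rewrite kl1 andbT lt_neqAle eq_sym kn0.
Qed.

Lemma rate_weight_near1 k w : k1 <= k <= 1 -> w <= -1 + well_radius p ->
  th2 * (1 - k) * Psi w <= (1 - k `^ p') * potential p w.
Proof.
move=> /andP[kk1 kl1] hw; have h := Psi_potential p1 hw.
have k0 : 0 < k by exact: lt_le_trans kk1.
have kk : 0 <= 1 - k by rewrite subr_ge0.
have pc1 : 1 < p' by rewrite /conj_exp ltr_pdivlMr// mul1r gtrBl.
have pc0 := conj_exp_gt0 p1.
have T : p' * (9 / 10) * (1 - k) <= 1 - k `^ p'.
  have := plap_tangent k 1 pc1; rewrite normr1 powR1 /= (gtr0_norm k0).
  have -> : plap p' k = k `^ (p' - 1).
    rewrite /plap (gtr0_norm k0) -[X in _ * X](@powRr1 _ k) ?(ltW k0)//.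
    rewrite -powRD; last by rewrite (gt_eqF k0) implybT.
    by congr (_ `^ _); ring.
  have e9 : 9 / 10 <= k `^ (p' - 1).
    have -> : 9 / 10 = k1 `^ (p' - 1) :> R.
      rewrite /k1 -powRrM (_ : (p - 1) * (p' - 1) = 1) ?powRr1 ?divr_ge0//.
      by rewrite /conj_exp; field; rewrite gt_eqF.
    apply: ge0_ler_powR; rewrite ?nnegrE ?(ltW k0) ?(ltW k10)//.
    by rewrite subr_ge0 ltW.
  rewrite -(ler_pM2l pc0) mulrDr mulrCA mulfV ?gt_eqF// mulr1.
  rewrite [X in _ <= X -> _]mulrCA mulfV ?gt_eqF// mulr1 => hh.
  have := ler_wpM2l (ltW pc0) (ler_wpM2r kk e9).
  by rewrite -mulrA; move: hh; set A := p' * (_ * (1 - k)); lra.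
apply: (@le_trans _ _ (p' * (9 / 10) * (1 - k) * potential p w)); last first.
  by apply: ler_wpM2r => //; exact: potential_ge0.
have -> : th2 * (1 - k) * Psi w = p' * (9 / 10) * (1 - k) * (th1 * Psi w).
  by rewrite /th2 /th1 /conj_exp; field; rewrite gt_eqF.
apply: ler_wpM2l => //; rewrite mulr_ge0// mulr_ge0 ?divr_ge0// ltW//.
Qed.

(** The length, in units of eps, over which a weight of rate th1 grows from 0 to
    k1. *)
Definition layer_width : R := - ln (1 - k1) / th1.

Lemma layer_width_gt0 : 0 < layer_width.
Proof.
rewrite divr_gt0// oppr_gt0 -(ln1 R) ltr_ln ?posrE ?subr_gt0//.
by rewrite gtrBl.
Qed.

Let expR_layer_width : expR (- (th1 * layer_width)) = 1 - k1.
Proof.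
rewrite /layer_width mulrC divfK ?gt_eqF// opprK lnK// posrE subr_gt0//.
Qed.

(** Nothing is known at s0, so the weight is 0 there.  It grows to k1 at the rate
    th1 up to the point m, over a distance of order eps, and then approaches 1 at
    the rate th2; what is lost is the defect of the weight at s1. *)
Lemma tail_near_well eps (W g : R -> R) x y s0 s1 : 0 < eps ->
  (s0 = x /\ s1 = y) \/ (s0 = y /\ s1 = x) ->
  layer_width * eps <= y - x ->
  abs_cont_deriv x y W g -> itvL1 x y (energy_density p eps W g) ->
  (forall z, x <= z <= y -> W z <= -1 + well_radius p) ->
  Psi (W s1) - c_const p * expR (th2 * layer_width) * expR (- (th2 * (y - x) / eps))
    <= itvint x y (energy_density p eps W g).
Proof.
move=> e0 hs hl Wg ei Ww.
(* sg is the direction from s0 to s1 *)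
have : exists sg : R, [/\ `|sg| = 1, s1 = s0 + sg * (y - x),
   x <= s0 <= y & x <= s1 <= y /\ (forall z, (x <= z <= y) = (0 <= sg * (z - s0) <= y - x))].
  have xy : x <= y.
    by rewrite -subr_ge0; apply: le_trans hl; rewrite mulr_ge0 ?(ltW layer_width_gt0)// ltW.
  case: hs => -[-> ->].
    exists 1; split; [exact: normr1|by rewrite mul1r addrC subrK| |split].
    + by rewrite lexx xy.
    + by rewrite lexx xy.
    + by move=> z; rewrite mul1r subr_ge0 lerD2r.
  exists (-1); split; [exact: normrN1|by rewrite mulN1r opprB addrC subrK| |split].
  + by rewrite lexx xy.
  + by rewrite lexx xy.
  + by move=> z; rewrite mulN1r opprB subr_ge0 andbC lerD2l lerN2.
move=> [sg [sg1 s1E hs0 [hs1 zE]]].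
have sg2 : sg * sg = 1 by rewrite -expr2 -real_normK ?num_real// sg1 expr1n.
have sg0 : sg != 0 by rewrite -normr_eq0 sg1 oner_eq0.
pose m := s0 + sg * (layer_width * eps).
have lw0 : 0 <= layer_width * eps by rewrite mulr_ge0 ?(ltW layer_width_gt0)// ltW.
have mE : sg * (m - s0) = layer_width * eps.
  by rewrite /m addrAC subrr add0r mulrA sg2 mul1r.
have s1E' : sg * (s1 - s0) = y - x by rewrite s1E addrAC subrr add0r mulrA sg2 mul1r.
have hm : x <= m <= y by rewrite zE mE lw0 hl.
have btw u v z : x <= u <= y -> x <= v <= y -> sg * (u - s0) <= sg * (v - s0) ->
    Num.min u v <= z <= Num.max u v ->
    sg * (u - s0) <= sg * (z - s0) <= sg * (v - s0).
  move=> _ _; have [sgE|sgE] : sg = 1 \/ sg = -1.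
    by move/eqP: sg2; rewrite -expr2 sqrf_eq1 => /orP[/eqP|/eqP]; [left|right].
    rewrite sgE !mul1r lerD2r => uv; rewrite min_l// max_r// !lerD2r//.
  rewrite sgE !mulN1r !opprB lerD2l lerN2 => uv; rewrite min_r// max_l// !lerD2l !lerN2.
  by rewrite andbC.
have F (c z : R) : c * sg * z = c * (sg * z) by rewrite mulrA.
(* from s0 to m, the weight grows from 0 to k1 *)
have P1 : k1 * Psi (W m) <= uitvint s0 m (energy_density p eps W g).
  pose c := - (th1 / eps) * sg; pose B := expR (- (c * s0)).
  have BE z : B * expR (c * z) = expR (- (th1 / eps * (sg * (z - s0)))).
    by rewrite /B -expRD /c; congr expR; ring.
  have cE : `|c| = th1 / eps.
    by rewrite /c normrM sg1 mulr1 normrN ger0_norm// divr_ge0// ltW.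
  have := @calibration_exp eps W g x y B c th1 0 s0 m e0 (lexx _) (expR_ge0 _) cE
     rate_any_weight hs0 hm Wg ei Ww.
  rewrite !BE subrr !mulr0 oppr0 expR0 subrr mul0r subr0.
  rewrite mE.
  have -> : th1 / eps * (layer_width * eps) = th1 * layer_width by field; rewrite gt_eqF.
  rewrite expR_layer_width opprB addrC subrK; apply => z.
  move=> /(btw _ _ _ hs0 hm); rewrite subrr mulr0 mE.
  move=> /(_ lw0)/andP[h _]; rewrite BE subr_ge0 -[leRHS]expR0 ler_expR oppr_le0.
  by rewrite mulr_ge0// divr_ge0// ltW.
(* from m to s1, the weight grows from k1 *)
have P2 : (1 - (1 - k1) * expR (- (th2 / eps * (y - x - layer_width * eps)))) * Psi (W s1)
    - k1 * Psi (W m) <= uitvint m s1 (energy_density p eps W g).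
  pose c := - (th2 / eps) * sg; pose B := (1 - k1) * expR (- (c * m)).
  have BE z : B * expR (c * z) = (1 - k1) * expR (- (th2 / eps * (sg * (z - m)))).
    by rewrite /B -mulrA -expRD /c; congr (_ * expR _); ring.
  have cE : `|c| = th2 / eps.
    by rewrite /c normrM sg1 mulr1 normrN ger0_norm// divr_ge0// ltW.
  have kk : 0 <= 1 - k1 by rewrite subr_ge0 ltW.
  have B0 : 0 <= B by rewrite mulr_ge0// expR_ge0.
  have := @calibration_exp eps W g x y B c th2 k1 m s1 e0 (ltW k10) B0 cE
     rate_weight_near1 hm hs1 Wg ei Ww.
  rewrite !BE subrr !mulr0 oppr0 expR0 mulr1 (_ : 1 - (1 - k1) = k1); last by ring.
  have -> : sg * (s1 - m) = y - x - layer_width * eps.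
    by rewrite -s1E' -mE -mulrBr; congr (_ * _); ring.
  apply=> z; have hms : sg * (m - s0) <= sg * (s1 - s0).
    by rewrite mE s1E'.
  move=> /(btw _ _ _ hm hs1 hms)/andP[h _]; rewrite BE.
  have : expR (- (th2 / eps * (sg * (z - m)))) <= 1.
    rewrite -[leRHS]expR0 ler_expR oppr_le0 mulr_ge0//; first by rewrite divr_ge0// ltW.
    by rewrite -subr_ge0 -mulrBr in h; rewrite (_ : z - m = z - s0 - (m - s0))//; ring.
  by move=> /(ler_wpM2l kk); rewrite mulr1; lra.
have addJ : uitvint s0 m (energy_density p eps W g) + uitvint m s1 (energy_density p eps W g) =
    itvint x y (energy_density p eps W g).
  case/andP: hm => xm my; case: hs => -[-> ->].
    by rewrite !uitvint_le// -itvint_split.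
  by rewrite uitvintC addrC (uitvintC m) !uitvint_le// -itvint_split.
rewrite -addJ; apply: le_trans (lerD P1 P2).
have -> : expR (- (th2 / eps * (y - x - layer_width * eps))) =
   expR (th2 * layer_width) * expR (- (th2 * (y - x) / eps)).
  by rewrite -expRD; congr expR; field; rewrite gt_eqF.
set X := expR (th2 * _); set Y := expR (- _).
have XY0 : 0 <= X * Y by rewrite mulr_ge0// expR_ge0.
have h1 : (1 - k1) * (X * Y) * Psi (W s1) <= c_const p * X * Y.
  rewrite -mulrA mulrC -[leRHS]mulrA (mulrC (c_const p)).
  have := Psi_le_c p1 (W s1); have := Psi_ge0 p1 (W s1) => q1 q2.
  rewrite -mulrA ler_wpM2l//.
  apply: le_trans q2; rewrite ler_piMr//; have := k10; lra.
rewrite [X in _ <= X](_ : _ = Psi (W s1) - (1 - k1) * (X * Y) * Psi (W s1)); last by ring.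
by rewrite lerB.
Qed.

End tails.

(** * The energy of one transition *)

Section lower_bound.
Context {R : realType} (p : R).
Hypothesis p1 : 1 < p.
Local Notation lam := (lambda_const p).
Local Notation Psi := (@Psi R p).
Implicit Types (x y z d q eps k s t : R).

Let p0 : 0 < p. Proof. exact: lt_trans p1. Qed.

Lemma Psi_well_radius_gt0 : 0 < Psi (-1 + well_radius p).
Proof.
have w0 := well_radius_gt0 p1; have w1 := well_radius_lt1 p1.
have h : -1 + well_radius p / 2 <= -1 + well_radius p by lra.
have [c /andP[c1 c2] E] := is_derive_mvt (is_derive_Psi p1) h.
have -> : Psi (-1 + well_radius p) = dPsi p c * (well_radius p / 2) + Psi (-1 + well_radius p / 2).
  by apply/eqP; rewrite -subr_eq E; apply/eqP; congr (_ * _); lra.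
apply: ltr_pwDl; last exact: Psi_ge0.
apply: mulr_gt0; last exact: divr_gt0.
apply: powR_gt0; rewrite normr_gt0 gt_eqF//.
apply: mulr_gt0; first by rewrite divr_gt0// lambda_gt0.
have c0 : c < 0 by lra.
have c3 : -1 < c by lra.
have sq : c ^+ 2 < 1 by nra.
have [[u0 ->]|[u0 _]] := pos_partP (1 - c ^+ 2); lra.
Qed.

(** From a point closer than rho to the well, an excursion out of the neighbourhood
    of radius [well_radius] costs at least Psi (-1 + rho), as much as the tail can yield. *)
Lemma near_well_threshold : exists rho : R, [/\ 0 < rho, rho < 1 &
  2 * Psi (-1 + rho) <= Psi (-1 + well_radius p)].
Proof.
have w0 := well_radius_gt0 p1; have w1 := well_radius_lt1 p1.
have P0 := Psi_well_radius_gt0.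
pose L := (lam / 2) `^ (p - 1).
have L0 : 0 < L by rewrite powR_gt0// divr_gt0// lambda_gt0.
exists (Num.min (well_radius p) (Psi (-1 + well_radius p) / (2 * L))); split.
- by rewrite lt_min w0 divr_gt0// mulr_gt0.
- by rewrite gt_min w1.
set rho := Num.min _ _.
have r0 : 0 < rho by rewrite lt_min w0 divr_gt0// mulr_gt0.
have rl : rho <= Psi (-1 + well_radius p) / (2 * L) by rewrite /rho ge_min lexx orbT.
have := Psi_lipschitz p1 (-1) (-1 + rho).
rewrite (@Psi_left _ p p1 (-1))// subr0 ger0_norm ?Psi_ge0// addrAC subrr add0r gtr0_norm// => h.
have : 2 * L * rho <= Psi (-1 + well_radius p).
  by rewrite mulrC -ler_pdivlMr// mulr_gt0.
by move: h; rewrite -/L; nra.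
Qed.

(** The rate th2 of the previous part: one factor 9 / 10 comes from the size of the
    neighbourhood of the well, the other from the level k1 of the weight. *)
Definition decay_rate : R := 9 / 10 * (p * (9 / 10 * lam)).

Lemma decay_rate_gt0 : 0 < decay_rate.
Proof. by rewrite /decay_rate; have := lambda_gt0 p1; have := p0; nra. Qed.

Definition tail_const : R := c_const p * expR (decay_rate * layer_width p).

Lemma tail_const_ge0 : 0 <= tail_const.
Proof. by rewrite mulr_ge0 ?c_const_ge0 ?expR_ge0. Qed.

(** Either W stays near the well, or it makes an excursion, which by the choice of
    rho costs at least Psi (W s1). *)
Lemma tail_energy rho eps (W g : R -> R) x y s0 s1 : 0 < eps ->
  2 * Psi (-1 + rho) <= Psi (-1 + well_radius p) ->
  (s0 = x /\ s1 = y) \/ (s0 = y /\ s1 = x) ->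
  x <= y -> layer_width p * eps <= y - x ->
  abs_cont_deriv x y W g -> itvL1 x y (energy_density p eps W g) ->
  W s1 <= -1 + rho ->
  Psi (W s1) - tail_const * expR (- (decay_rate * (y - x) / eps))
    <= itvint x y (energy_density p eps W g).
Proof.
move=> e0 hrho hs xy hl Wg ei W1.
have [H|H] := pselect (forall z, x <= z <= y -> W z <= -1 + well_radius p).
  exact: (tail_near_well p1 e0 hs hl Wg ei H).
have [z zxy zW] : exists2 z, x <= z <= y & -1 + well_radius p < W z.
  apply: contrapT => N; apply: H => z zxy; rewrite leNgt; apply/negP => h.
  by apply: N; exists z.
have s1xy : x <= s1 <= y by case: hs => -[_ ->]; rewrite lexx xy.
have h1 := Psi_between_le_energy p1 e0 zxy s1xy Wg ei.
have h2 := Psi_mono p1 (ltW zW); have h3 := Psi_mono p1 W1.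
have h4 : 0 <= tail_const * expR (- (decay_rate * (y - x) / eps)).
  by rewrite mulr_ge0 ?tail_const_ge0// expR_ge0.
lra.
Qed.

(** The left tail contributes Psi (W xm), the middle Psi (W xp) - Psi (W xm), and
    the right tail, after a reflection, Psi (- W xp) = c_p - Psi (W xp). *)
Lemma transition_energy rho eps (W g : R -> R) x xm xp y len : 0 < eps ->
  2 * Psi (-1 + rho) <= Psi (-1 + well_radius p) ->
  x <= xm -> xm <= xp -> xp <= y -> len <= xm - x -> len <= y - xp ->
  layer_width p * eps <= len ->
  abs_cont_deriv x y W g -> itvL1 x y (energy_density p eps W g) ->
  W xm <= -1 + rho -> 1 - rho <= W xp ->
  c_const p - 2 * tail_const * expR (- (decay_rate * len / eps))
    <= itvint x y (energy_density p eps W g).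
Proof.
move=> e0 hrho xxm xmp xpy l1 l2 hl Wg ei Wm Wp.
have xmy := le_trans xmp xpy; have xxp := le_trans xxm xmp.
have lam0 := decay_rate_gt0.
have mono l : len <= l -> tail_const * expR (- (decay_rate * l / eps)) <=
   tail_const * expR (- (decay_rate * len / eps)).
  move=> h; rewrite ler_wpM2l ?tail_const_ge0// ler_expR lerN2 ler_wpM2r ?invr_ge0 ?(ltW e0)//.
  by rewrite ler_wpM2l// ltW.
have T1 := tail_energy e0 hrho (or_introl (conj erefl erefl)) xxm (le_trans hl l1)
  (abs_cont_deriv_sub (lexx _) xmy Wg) (itvL1_sub (lexx _) xmy ei) Wm.
have T2 := Psi_le_energy p1 e0 xmp (abs_cont_deriv_sub xxm xpy Wg) (itvL1_sub xxm xpy ei).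
have WN : - W xp <= -1 + rho by lra.
have ei2 : itvL1 xp y (energy_density p eps (fun z => - W z) (fun z => - g z)).
  by rewrite energy_densityN; exact: itvL1_sub ei.
have T3 := @tail_energy rho eps (fun z => - W z) (fun z => - g z) xp y y xp e0 hrho (or_intror (conj erefl erefl)) xpy
  (le_trans hl l2) (abs_cont_derivN (abs_cont_deriv_sub xxp (lexx _) Wg)) ei2 WN.
rewrite energy_densityN in T3.
rewrite (itvint_split xxm xmy ei) (itvint_split xmp xpy (itvL1_sub xxm (lexx _) ei)).
have PN := PsiN p1 (W xp).
have T2' := le_trans (ler_norm _) T2.
have m1 := mono _ l1; have m2 := mono _ l2.
set E1 := itvint x xm _ in T1 *; set E2 := itvint xm xp _ in T2' *.
set E3 := itvint xp y _ in T3 *.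
move: T1 T2' T3 m1 m2; set Z := expR (- (decay_rate * len / eps)).
set X1 := tail_const * expR _; set X2 := tail_const * expR _.
clear T2; rewrite -mulrA; set Y := tail_const * Z.
move: PN; set a1 := Psi (W xm); set a2 := Psi (W xp); set a3 := Psi (- W xp).
lra.
Qed.

Lemma closeness_point (W v : R -> R) u w sg rho del : u < w -> 0 < rho ->
  itvL1 u w (fun z => W z - v z) -> (forall z, u < z < w -> v z = sg) ->
  itvint u w (fun z => `|W z - v z|) <= del -> del < rho * ((w - u) / 2) ->
  exists2 z, u < z < w & `|W z - sg| <= rho.
Proof.
move=> uw rho0 fi vE hd hdel; apply: contrapT => N.
have far z : u < z < w -> rho <= `|W z - v z|.
  move=> zuw; rewrite leNgt; apply/negP => h; apply: N; exists z => //.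
  by rewrite -(vE _ zuw) ltW.
(* the middle half, because v is not controlled at u and w *)
pose u' := u + (w - u) / 4; pose w' := w - (w - u) / 4.
have uu : u <= u' by rewrite /u'; lra.
have ww : w' <= w by rewrite /w'; lra.
have uw' : u' <= w' by rewrite /u' /w'; lra.
have ni := itvL1_norm fi.
have h1 : itvint u' w' (fun z => `|W z - v z|) <= itvint u w (fun z => `|W z - v z|).
  by apply: itvint_le_sub.
have h2 : itvint u' w' (fun=> rho) <= itvint u' w' (fun z => `|W z - v z|).
  apply: le_itvint; [exact: itvL1_cst|exact: itvL1_sub ni|move=> z /andP[z1 z2]].
  by apply: far; rewrite /u' /w' in z1 z2; apply/andP; split; lra.
rewrite itvint_cst// in h2.
have e : w' - u' = (w - u) / 2 by rewrite /u' /w'; field.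
by rewrite e in h2; lra.
Qed.

End lower_bound.

(** * Functions with finitely many jumps *)

Section piecewise_constant_limit.
Context {R : realType} (a b : R) (N : nat) (h : nat -> R) (v : R -> R) (r : R).
Hypothesis ab : a < b.
Hypothesis h_range : forall i, (1 <= i <= N)%N -> a < h i < b.
Hypothesis h_incr : forall i, (1 <= i < N)%N -> h i < h i.+1.
Hypothesis v_pc : piecewise_constant a b N h v.
Hypothesis r0 : 0 < r.
Hypothesis r_sep : forall i, (1 <= i < N)%N -> h i + r < h i.+1 - r.
Hypothesis r_bdry : (0 < N)%N -> a <= h 1%N - r /\ h N + r <= b.

Lemma h_mono i j : (1 <= i)%N -> (i <= j)%N -> (j <= N)%N -> h i <= h j.
Proof.
move=> i1; elim: j => [|j IH]; first by rewrite leqn0 => /eqP i0; rewrite i0 in i1.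
rewrite leq_eqVlt => /orP[/eqP <- //|ij] jN.
apply: (le_trans (IH ij (ltnW jN))); apply: ltW; apply: h_incr.
by rewrite jN andbT (leq_trans i1).
Qed.

Lemma jump_free_interval i x y : (1 <= i <= N.+1)%N ->
  ((1 < i)%N -> h i.-1 < x) -> ((i <= N)%N -> y < h i) ->
  forall j, (1 <= j <= N)%N -> ~~ (x <= h j <= y).
Proof.
move=> /andP[i1 iN] hx hy j /andP[j1 jN]; apply/negP => /andP[xj jy].
have [ji|ij] := ltnP j i.
  have i2 : (1 < i)%N by exact: leq_ltn_trans ji.
  have ji' : (j <= i.-1)%N by case: i ji {i1 iN hx hy i2} => // i.
  have iN' : (i.-1 <= N)%N by case: i iN {i1 ji hx hy i2 ji'}.
  by have := le_lt_trans (h_mono j1 ji' iN') (hx i2); rewrite ltNge xj.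
have iN' : (i <= N)%N by exact: leq_trans jN.
by have := lt_le_trans (hy iN') (h_mono i1 ij jN); rewrite ltNge jy.
Qed.

(** The indices 0 and N + 1 stand for the ends of [a, b], so that the N + 1 intervals
    of constancy of v can be treated uniformly. *)
Definition break_point i : R := if i == 0%N then a else if (i <= N)%N then h i else b.

Lemma break_point_le i : (i <= N)%N -> break_point i <= break_point i.+1.
Proof.
rewrite /break_point /= => iN; case: ifP => [/eqP -> |i0].
  case: ifP => [N1|_]; last exact: ltW.
  by have /andP[/ltW] : a < h 1 < b by apply: h_range; rewrite N1.
rewrite iN; have i1 : (0 < i)%N by rewrite lt0n i0.
case: ifP => iN1; first by rewrite ltW// h_incr// i1.
by have /andP[_ /ltW] : a < h i < b by apply: h_range; rewrite i1.
Qed.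

Lemma v_cst_between_breaks i x y : (i <= N)%N -> break_point i < x -> x <= y -> y < break_point i.+1 ->
  v x = v y.
Proof.
move=> iN bx xy yb; have [_ vc _] := v_pc.
have ax : a <= x.
  apply: le_trans (ltW bx); rewrite /break_point; case: ifP => // i0; rewrite iN.
  by have /andP[/ltW] : a < h i < b by apply: h_range; rewrite iN lt0n i0.
have yb' : y <= b.
  apply: (le_trans (ltW yb)); rewrite /break_point /=; case: ifP => // iN1.
  by have /andP[_ /ltW] : a < h i.+1 < b by apply: h_range; rewrite iN1.
apply: vc => //; apply: (@jump_free_interval i.+1) => //.
- by move=> i1 /=; move: bx; rewrite /break_point iN; case: i i1 {iN yb} => // i.
- by move=> i1; move: yb; rewrite /break_point /= i1.
Qed.

Lemma v_measurable : measurable_fun `[a, b] v.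
Proof.
have M i : (i <= N.+1)%N -> measurable_fun `[a, break_point i] v /\ a <= break_point i.
  elim: i => [_|i IH iN].
    rewrite /break_point /= set_itv1; split => //.
    exact: measurable_fun_set1.
  have [M1 M2] := IH (ltnW iN); have b12 := break_point_le iN.
  split; last exact: le_trans b12.
  have -> : `[a, break_point i.+1]%classic = `[a, break_point i] `|` `[break_point i, break_point i.+1].
    apply/seteqP; split => x /=; rewrite !in_itv /=.
      by move=> /andP[ax xb]; have [xi|/ltW ix] := leP x (break_point i); [left|right]; apply/andP.
    by move=> [] /andP[h1 h2]; apply/andP; split => //; [exact: le_trans b12|exact: le_trans h1].
  apply/measurable_funU => //; split => //.
  suff mo : measurable_fun `]break_point i, break_point i.+1[ v by exact: measurable_fun_itv_cc mo.
  pose c := (break_point i + break_point i.+1) / 2.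
  apply: (@eq_measurable_fun _ _ _ _ _ (cst (v c))) => // x.
  rewrite inE /= in_itv /= => /andP[x1 x2].
  have [c1 c2] := midf_lt (lt_trans x1 x2); rewrite -/c in c1 c2.
  have [xc|/ltW cx] := leP x c.
    exact/esym/(v_cst_between_breaks iN).
  exact: (v_cst_between_breaks iN).
have [+ _] := M N.+1 (leqnn _).
by rewrite /break_point /= ltnn.
Qed.

Lemma v_itvL1 : itvL1 a b v.
Proof.
apply: (@itvL1_bounded _ _ _ _ 1); first exact: v_measurable.
by move=> x xab; have [+ _ _] := v_pc => /(_ _ xab)[->|->]; rewrite ?normrN1 ?normr1.
Qed.

Lemma jump_neighbourhood i : (1 <= i <= N)%N ->
  [/\ a <= h i - r, h i + r <= b, break_point i.-1 <= h i - r & h i + r <= break_point i.+1].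
Proof.
move=> /[dup] iN /andP[i1 iN'].
have N0 : (0 < N)%N by exact: leq_trans iN'.
have [b1 b2] := r_bdry N0; have hr := h_range iN.
have L : a <= h i - r /\ break_point i.-1 <= h i - r.
  case: i iN i1 iN' hr => [//|[|i]] iN i1 iN' hr /=; first by rewrite /break_point.
  have s1 : (1 <= i.+1 < N)%N by [].
  have := r_sep s1; have /andP[ah _] := h_range (ltac:(by rewrite /= ltnW) : (1 <= i.+1 <= N)%N).
  rewrite /break_point /= ltnW// => hh; have r0' := r0; split; lra.
have U : h i + r <= b /\ h i + r <= break_point i.+1.
  rewrite /break_point /=; move: iN'; rewrite leq_eqVlt => /orP[/eqP iE|iN'].
    by rewrite iE ltnn.
  have s1 : (1 <= i < N)%N by rewrite i1.
  have s2 : (1 <= i.+1 <= N)%N by [].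
  have := r_sep s1; have /andP[_ hb] := h_range s2.
  by rewrite iN' => hh; have r0' := r0; split; lra.
by case: L U => ? ? [].
Qed.

Lemma v_near_jump i : (1 <= i <= N)%N -> exists sg : R,
  [/\ sg = 1 \/ sg = -1, forall z, h i - r < z < h i -> v z = - sg &
      forall z, h i < z < h i + r -> v z = sg].
Proof.
move=> /[dup] iN /andP[i1 iN']; have [b1 b2 b3 b4] := jump_neighbourhood iN.
have hi : break_point i = h i by rewrite /break_point iN' gtn_eqF.
pose zl := h i - r / 2; pose zr := h i + r / 2.
have [v1 _ /(_ _ iN) [l [rr [vl vr lr]]]] := v_pc.
have left z : h i - r < z < h i -> v z = v zl.
  move=> /andP[z1 z2]; have E : i.-1.+1 = i by rewrite prednK.
  have iN1 : (i.-1 <= N)%N by rewrite (leq_trans _ iN')// leq_pred.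
  have l1 : h i - r < zl by rewrite /zl; move: (r0) => ?; lra.
  have l2 : zl < h i by rewrite /zl; move: (r0) => ?; lra.
  have [zz|/ltW zz] := leP z zl; last symmetry.
    apply: (v_cst_between_breaks iN1) => //; first exact: le_lt_trans z1.
    by rewrite E hi.
  apply: (v_cst_between_breaks iN1) => //; first exact: le_lt_trans l1.
  by rewrite E hi.
have right z : h i < z < h i + r -> v z = v zr.
  move=> /andP[z1 z2].
  have l1 : h i < zr by rewrite /zr; move: (r0) => ?; lra.
  have l2 : zr < h i + r by rewrite /zr; move: (r0) => ?; lra.
  have [zz|/ltW zz] := leP z zr; last symmetry.
    apply: (v_cst_between_breaks iN') => //; first by rewrite hi.
    exact: lt_le_trans b4.
  apply: (v_cst_between_breaks iN') => //; first by rewrite hi.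
  exact: lt_le_trans b4.
have lE : l = v zl.
  apply: (cvg_unique _ vl); first exact: Rhausdorff.
  apply: cvg_near_cst; near=> z; apply: left; apply/andP; split.
    by near: z; apply: nbhs_left_gt; rewrite gtrBl.
  by near: z; exact: nbhs_left_lt.
have rE : rr = v zr.
  apply: (cvg_unique _ vr); first exact: Rhausdorff.
  apply: cvg_near_cst; near=> z; apply: right; apply/andP; split.
    by near: z; exact: nbhs_right_gt.
  by near: z; apply: nbhs_right_lt; rewrite ltrDl.
have zlr : a <= zl <= b.
  by rewrite /zl; move: (r0) => ?; apply/andP; split; lra.
have zrr : a <= zr <= b.
  by rewrite /zr; move: (r0) => ?; apply/andP; split; lra.
have vzl := v1 _ zlr; have vzr := v1 _ zrr.
rewrite lE rE in lr.
exists (v zr); split; [by case: vzr; [right|left]| |exact: right].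
move=> z /left ->; case: vzl vzr lr => -> [] -> lr; rewrite ?opprK//; by case: lr.
Unshelve. all: by end_near. Qed.

End piecewise_constant_limit.

(** * The lower bound on the energy *)

Section energy_lower_bound.
Context {R : realType} (a b p : R) (N : nat) (h : nat -> R) (v : R -> R) (r : R).
Hypothesis ab : a < b.
Hypothesis p1 : 1 < p.
Hypothesis h_range : forall i, (1 <= i <= N)%N -> a < h i < b.
Hypothesis h_incr : forall i, (1 <= i < N)%N -> h i < h i.+1.
Hypothesis v_pc : piecewise_constant a b N h v.
Hypothesis r0 : 0 < r.
Hypothesis r_sep : forall i, (1 <= i < N)%N -> h i + r < h i.+1 - r.
Hypothesis r_bdry : (0 < N)%N -> a <= h 1%N - r /\ h N + r <= b.
Variable A : R.
Hypothesis hA : 0 < A < r * Num.sqrt 2 * lambda_const p.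

(** With sqrt 2 <= 1.45, A p / 2 is at most 0.725 p r lambda_p, while the right-hand
    side is 0.9^3 p r lambda_p = 0.729 p r lambda_p. *)
Lemma decay_rate_admissible : A * p / 2 <= decay_rate p * (9 / 10 * r).
Proof.
have p0 : 0 < p by exact: lt_trans p1.
have l0 := lambda_gt0 p1; case/andP: hA => _ A1.
have s2 : Num.sqrt 2 <= 145 / 100 :> R.
  have q0 : (0 : R) <= 145 / 100 by rewrite divr_ge0.
  rewrite -(ger0_norm q0) -sqrtr_sqr ler_wsqrtr//; lra.
have rl : 0 < r * lambda_const p by rewrite mulr_gt0.
have A2 : A <= 145 / 100 * (r * lambda_const p).
  apply: (le_trans (ltW A1)); rewrite mulrAC mulrC.
  exact: ler_wpM2r (ltW rl) _ _ s2.
have A3 := ler_wpM2r (ltW p0) A2.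
have q : 0 < p * (r * lambda_const p) by exact: mulr_gt0.
rewrite /decay_rate; move: A3 q; set l := lambda_const p.
rewrite (_ : 145 / 100 * (r * l) * p = 145 / 100 * (p * (r * l))); last by ring.
rewrite (_ : 9 / 10 * (p * (9 / 10 * l)) * (9 / 10 * r) = 729 / 1000 * (p * (r * l))); last by field.
lra.
Qed.

(** L^1-closeness to v produces, within the distance r / 10 of the jump and on both
    sides of it, points where W is rho-close to v; tails of length 9 r / 10
    remain. *)
Lemma jump_energy rho eps (W g : R -> R) i : 0 < eps -> 0 < rho ->
  2 * Psi p (-1 + rho) <= Psi p (-1 + well_radius p) ->
  layer_width p * eps <= 9 / 10 * r ->
  abs_cont_deriv a b W g -> itvL1 a b (energy_density p eps W g) ->
  itvint a b (fun z => `|W z - v z|) <= rho * (r / 40) -> (1 <= i <= N)%N ->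
  c_const p - 2 * tail_const p * expR (- (decay_rate p * (9 / 10 * r) / eps))
    <= itvint (h i - r) (h i + r) (energy_density p eps W g).
Proof.
move=> e0 rho0 hrho hl Wg ei hd iN.
have r0' := r0; have ab' := ab.
have [b1 b2 _ _] := jump_neighbourhood h_range r0 r_sep r_bdry iN.
have [sg [sg1 vl vr]] := v_near_jump h_range h_incr v_pc r0 r_sep r_bdry iN.
have vi := v_itvL1 ab h_range h_incr v_pc.
have [Wa _ _] := Wg.
have di : itvL1 a b (fun z => W z - v z) by apply: itvL1B => //; exact: abs_cont_itvL1.
have sub u w : a <= u -> u <= w -> w <= b -> itvint u w (fun z => `|W z - v z|) <= rho * (r / 40).
  move=> au uw wb; apply: le_trans hd; apply: itvint_le_sub => //.
  exact: itvL1_norm.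
have dsm : rho * (r / 40) < rho * ((h i - (h i - r / 10)) / 2).
  by rewrite ltr_pM2l//; lra.
have dsm' : rho * (r / 40) < rho * ((h i + r / 10 - h i) / 2).
  by rewrite ltr_pM2l//; lra.
have u1 : h i - r / 10 < h i by lra.
have u2 : h i < h i + r / 10 by lra.
have au1 : a <= h i - r / 10 by lra.
have ah : a <= h i by lra.
have hb : h i <= b by lra.
have ub2 : h i + r / 10 <= b by lra.
have vl' z : h i - r / 10 < z < h i -> v z = - sg.
  by move=> /andP[z1 z2]; apply: vl; rewrite z2 andbT; lra.
have vr' z : h i < z < h i + r / 10 -> v z = sg.
  by move=> /andP[z1 z2]; apply: vr; rewrite z1 /=; lra.
have [xm /andP[m1 m2] Wm] := closeness_point u1 rho0 (itvL1_sub au1 hb di) vl'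
  (sub _ _ au1 (ltW u1) hb) dsm.
have [xp /andP[q1 q2] Wp] := closeness_point u2 rho0 (itvL1_sub ah ub2 di) vr'
  (sub _ _ ah (ltW u2) ub2) dsm'.
have Wg' := abs_cont_deriv_sub b1 b2 Wg; have ei' := itvL1_sub b1 b2 ei.
have x1 : h i - r <= xm by lra.
have x2 : xm <= xp by lra.
have x3 : xp <= h i + r by lra.
have l1 : 9 / 10 * r <= xm - (h i - r) by lra.
have l2 : 9 / 10 * r <= h i + r - xp by lra.
clear - e0 hrho x1 x2 x3 l1 l2 hl Wg' ei' Wm Wp sg1 p1.
move: Wm Wp; rewrite !ler_norml => /andP[wm1 wm2] /andP[wp1 wp2].
case: sg1 => sgE; rewrite sgE in wm1 wm2 wp1 wp2.
  by apply: (transition_energy p1 e0 hrho x1 x2 x3) => //; lra.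
rewrite -energy_densityN.
apply: (transition_energy p1 e0 hrho x1 x2 x3) => //; rewrite ?energy_densityN//; try lra.
exact: abs_cont_derivN.
Qed.

(** The intervals of radius r around the jumps do not overlap. *)
Theorem energy_lower_bound : exists delta C1 eps0 : R, [/\ 0 < delta, 0 <= C1, 0 < eps0 &
  forall eps (W g : R -> R), 0 < eps -> eps < eps0 -> abs_cont_deriv a b W g ->
    itvL1 a b (energy_density p eps W g) ->
    itvint a b (fun z => `|W z - v z|) <= delta ->
    N%:R * c_const p - C1 * expR (- (A * p / (2 * eps))) <= itvint a b (energy_density p eps W g)].
Proof.
have p0 : 0 < p by exact: lt_trans p1.
have [rho [rho0 _ hrho]] := near_well_threshold p1.
have lw := layer_width_gt0 p1.
exists (rho * (r / 40)), (N%:R * (2 * tail_const p)), (9 / 10 * r / layer_width p).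
have tc := tail_const_ge0 p1; have r0' := r0.
split; [by rewrite mulr_gt0 ?divr_gt0|by rewrite mulr_ge0// mulr_ge0
  |by rewrite divr_gt0// mulr_gt0// divr_gt0|].
move=> eps W g e0 ee Wg ei hd.
have hl : layer_width p * eps <= 9 / 10 * r by rewrite mulrC -ler_pdivlMr// ltW.
have J i : (1 <= i <= N)%N -> c_const p - 2 * tail_const p * expR (- (A * p / (2 * eps)))
    <= itvint (h i - r) (h i + r) (energy_density p eps W g).
  move=> iN; apply: le_trans (jump_energy e0 rho0 hrho hl Wg ei hd iN).
  apply: lerB => //; apply: ler_wpM2l; first by rewrite mulr_ge0.
  rewrite ler_expR lerN2.
  have -> : A * p / (2 * eps) = A * p / 2 / eps by field; rewrite gt_eqF.
  by rewrite ler_wpM2r ?invr_ge0 ?(ltW e0)//; exact: decay_rate_admissible.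
pose e_ k : R := if k == 0%N then a else h k + r.
have E k : (k <= N)%N -> [/\ a <= e_ k, e_ k <= b &
    k%:R * (c_const p - 2 * tail_const p * expR (- (A * p / (2 * eps))))
    <= itvint a (e_ k) (energy_density p eps W g)].
  elim: k => [_|k IH kN].
    rewrite /e_ /= mul0r; split => //; first exact: ltW.
    by apply: itvint_ge0 => z _; exact: energy_density_ge0.
  have [ae eb Ek] := IH (ltnW kN).
  have kN' : (1 <= k.+1 <= N)%N by [].
  have [b1 b2 _ _] := jump_neighbourhood h_range r0 r_sep r_bdry kN'.
  have eh : e_ k <= h k.+1 - r.
    rewrite /e_; case: ifP => // k0; apply: ltW; apply: r_sep.
    by rewrite lt0n k0 kN.
  rewrite /e_ /=; split => //; first by lra.
  have hh : h k.+1 - r <= h k.+1 + r by lra.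
  have aeh := le_trans ae eh.
  rewrite (itvint_split aeh hh); last exact: itvL1_sub ei.
  rewrite (itvint_split ae eh); last by apply: itvL1_sub ei => //; lra.
  have m0 : 0 <= itvint (e_ k) (h k.+1 - r) (energy_density p eps W g).
    by apply: itvint_ge0 => z _; exact: energy_density_ge0.
  by rewrite -natr1 mulrDl mul1r; have := J _ kN'; lra.
have [ae eb EN] := E N (leqnn _).
have -> : N%:R * c_const p - N%:R * (2 * tail_const p) * expR (- (A * p / (2 * eps)))
  = N%:R * (c_const p - 2 * tail_const p * expR (- (A * p / (2 * eps)))) by ring.
apply: (le_trans EN); apply: itvint_le_sub => // z _; exact: energy_density_ge0.
Qed.

End energy_lower_bound.

(** * The space of square integrable functions *)

Section square_integrable.
Context {R : realType} (a b : R).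
Hypothesis ab : a < b.
Local Notation mu := (@lebesgue_measure R).
Local Notation V := (R -> R^o).

Definition sq_itg (f : V) : Prop :=
  measurable_fun `[a, b] (f : R -> R) /\ itvL1 a b (fun x => f x ^+ 2).

Definition itg_ip (f g : V) : R := itvint a b (fun x => f x * g x).

Lemma sq_itg_mulL1 (f g : V) : sq_itg f -> sq_itg g -> itvL1 a b (fun x => f x * g x).
Proof.
move=> [mf fi] [mg gi]; apply: (@le_itvL1 _ _ _ _ (fun x => f x ^+ 2 + g x ^+ 2)).
- exact: measurable_funM.
- move=> x _; have h1 := sqr_ge0 (f x - g x); have h2 := sqr_ge0 (f x + g x).
  have h3 := sqr_ge0 (f x); have h4 := sqr_ge0 (g x).
  by rewrite ler_norml; apply/andP; split; nra.
- exact: itvL1D.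
Qed.

Lemma sq_itgD (f g : V) : sq_itg f -> sq_itg g -> sq_itg (f + g).
Proof.
move=> /[dup] Df [mf fi] /[dup] Dg [mg gi]; split; first exact: measurable_funD.
apply: (@eq_itvL1 _ _ _ (fun x => (f x ^+ 2 + 2 * (f x * g x)) + g x ^+ 2)).
  by move=> x _; rewrite !fctE; ring.
apply: itvL1D => //; apply: itvL1D => //; apply: itvL1Z; exact: sq_itg_mulL1.
Qed.

Lemma sq_itgZ (c : R) (f : V) : sq_itg f -> sq_itg (c *: f).
Proof.
move=> [mf fi]; split; first by apply: measurable_funM => //; exact: measurable_cst.
apply: (@eq_itvL1 _ _ _ (fun x => c ^+ 2 * f x ^+ 2)); last exact: itvL1Z.
by move=> x _; rewrite !fctE /GRing.scale /= exprMn.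
Qed.

Lemma itg_ipC (f g : V) : itg_ip f g = itg_ip g f.
Proof. by apply: eq_itvint => x _; rewrite mulrC. Qed.

Lemma itg_ip_ge0 (f : V) : 0 <= itg_ip f f.
Proof. by apply: itvint_ge0 => x _; rewrite -expr2 sqr_ge0. Qed.

Lemma itg_ipDl (f g h : V) : sq_itg f -> sq_itg g -> sq_itg h ->
  itg_ip (f + g) h = itg_ip f h + itg_ip g h.
Proof.
move=> Df Dg Dh; rewrite /itg_ip -itvintD; [|exact: sq_itg_mulL1|exact: sq_itg_mulL1].
by apply: eq_itvint => x _; rewrite !fctE mulrDl.
Qed.

Lemma itg_ipZl (c : R) (f g : V) : sq_itg f -> sq_itg g ->
  itg_ip (c *: f) g = c * itg_ip f g.
Proof.
move=> Df Dg; rewrite /itg_ip -itvintZ; last exact: sq_itg_mulL1.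
by apply: eq_itvint => x _; rewrite !fctE /GRing.scale /= mulrA.
Qed.

Definition L2norm (f : V) : R := ipnorm itg_ip f.

Lemma sq_itg_cst (c : R) : sq_itg (fun=> c).
Proof. by split; [exact: measurable_cst|exact: itvL1_cst]. Qed.

Lemma sq_itg_bounded (f : V) (M : R) : measurable_fun `[a, b] (f : R -> R) ->
  (forall x, a <= x <= b -> `|f x| <= M) -> sq_itg f.
Proof.
move=> mf fM; split => //; apply: (@itvL1_bounded _ _ _ _ (M ^+ 2)).
  exact: measurable_funX.
move=> x /fM h; rewrite normrX ler_pXn2r ?nnegrE//; exact: le_trans h.
Qed.

Lemma sq_itg_itvL1 (f : V) : sq_itg f -> itvL1 a b f.
Proof.
move=> Df; apply: eq_itvL1 (sq_itg_mulL1 Df (sq_itg_cst 1)) => x _; exact: mulr1.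
Qed.

Lemma L1_le_L2norm (f : V) : sq_itg f ->
  itvint a b (fun x => `|f x|) <= Num.sqrt (b - a) * L2norm f.
Proof.
move=> [mf fi].
pose g : V := fun x => `|f x|.
have Dg : sq_itg g.
  split; first by apply: measurableT_comp.
  by apply: eq_itvL1 fi => x _; rewrite /g real_normK ?num_real.
have := ip_cauchy sq_itgD sq_itgZ itg_ipC itg_ip_ge0 itg_ipDl itg_ipZl (sq_itg_cst 1) Dg.
have -> : itg_ip (fun=> 1) g = itvint a b (fun x => `|f x|).
  by apply: eq_itvint => x _; rewrite mul1r.
rewrite ger0_norm; last by apply: itvint_ge0.
move=> /le_trans; apply; rewrite /L2norm /ipnorm.
have -> : itg_ip (fun=> 1) (fun=> 1) = b - a.
  rewrite /itg_ip (@eq_itvint _ _ _ _ (fun=> 1)); last by move=> x _; rewrite mul1r.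
  by rewrite itvint_cst ?mul1r// ltW.
have -> // : itg_ip g g = itg_ip f f.
by apply: eq_itvint => x _; rewrite /g -!expr2 real_normK ?num_real.
Qed.

Lemma Lp_norm2E (f : V) : Lp_norm a b 2 f =
  ((\int[mu]_(x in `[a, b]) (f x ^+ 2)%:E) `^ 2^-1)%E.
Proof.
rewrite /Lp_norm unlock /=; congr (_ `^ _)%E.
rewrite [RHS]integral_mkcond; apply: eq_integral => x _.
rewrite /= !patchE; case: ifP => _ /=; last by rewrite normr0 powR0.
by rewrite powR_mulrn// real_normK ?num_real.
Qed.

Lemma Lp_norm2_sq_itg (f : V) : sq_itg f -> Lp_norm a b 2 f = (L2norm f)%:E.
Proof.
move=> [mf fi]; rewrite Lp_norm2E itvint_EFin// poweR_EFin /L2norm /ipnorm.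
rewrite powR12_sqrt; last by apply: itvint_ge0 => x _; exact: sqr_ge0.
by congr (Num.sqrt _)%:E; apply: eq_itvint => x _; rewrite expr2.
Qed.

Lemma in_Lp2P (f : V) : in_Lp a b 2 f <-> sq_itg f.
Proof.
split=> [[mf nf]|Df]; last first.
  by split; [case: Df|rewrite Lp_norm2_sq_itg// ltry].
split => //; apply/integrableP; split; first by apply/measurable_EFinP; exact: measurable_funX.
have -> : (\int[mu]_(x in `[a, b]) `|(EFin \o (fun x => f x ^+ 2)%R) x| =
  \int[mu]_(x in `[a, b]) (f x ^+ 2)%:E)%E.
  by apply: eq_integral => x _ /=; rewrite ger0_norm ?sqr_ge0.
rewrite ltey; apply/eqP => E; move: nf; rewrite Lp_norm2E E.
by rewrite poweRyr ?ltxx// invr_eq0.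
Qed.

Lemma Lp_norm1E (f : V) : Lp_norm a b 1 f = (\int[mu]_(x in `[a, b]) `|f x|%:E)%E.
Proof.
rewrite /Lp_norm Lnorm1 [RHS]integral_mkcond; apply: eq_integral => x _.
by rewrite /= !patchE; case: ifP => _ //=; rewrite normr0.
Qed.

Lemma Lp_norm1_itvL1 (f : V) : itvL1 a b f ->
  Lp_norm a b 1 f = (itvint a b (fun x => `|f x|))%:E.
Proof. by move=> fi; rewrite Lp_norm1E itvint_EFin//; exact: itvL1_norm. Qed.

Lemma eq_ae_ip (f f' g g' : V) : sq_itg f -> sq_itg f' -> sq_itg g -> sq_itg g' ->
  {ae mu, forall x, x \in `[a, b] -> f x = f' x} ->
  {ae mu, forall x, x \in `[a, b] -> g x = g' x} -> itg_ip f g = itg_ip f' g'.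
Proof.
move=> [mf _] [mf' _] [mg _] [mg' _] ff gg; apply: ae_itvint; try exact: measurable_funM.
by apply: ae_mono (ae_and ff gg) => x [h1 h2] xab; rewrite h1// h2.
Qed.

End square_integrable.

(** * The energy functional and its subgradients *)

Section pde.
Context {R : realType} (a b p : R).
Hypothesis ab : a < b.
Hypothesis p1 : 1 < p.
Local Notation mu := (@lebesgue_measure R).

Let p0 : 0 < p. Proof. exact: lt_trans p1. Qed.

Lemma comp_within_continuous (g f : R -> R) : continuous g ->
  {within `[a, b], continuous f} -> {within `[a, b], continuous (fun x => g (f x))}.
Proof.
by move=> cg cf; apply: (@within_continuous_comp _ _ _ _ f g) => // x _; exact: cg.
Qed.

Lemma ae_closed_itv (P : R -> Prop) : {ae mu, forall x, a < x < b -> P x} ->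
  {ae mu, forall x, x \in `[a, b] -> P x}.
Proof.
move=> h; have e0 : mu.-negligible ([set a] `|` [set b]).
  by apply: negligibleU; apply/negligibleP => //; exact: lebesgue_measure_set1.
apply: negligibleS (negligibleU h e0) => x /= nP; apply: contrapT => /not_orP[h1 h2].
apply: nP; rewrite in_itv /= => /andP[ax xb]; apply: contrapT => nPx.
move/not_orP: h2 => [xa xb']; apply: h1 => hh; apply: nPx; apply: hh.
by rewrite !lt_neqAle ax xb !andbT; apply/andP; split; apply/eqP => // e; exact: xa (esym e).
Qed.

Lemma weak_derivative_abs_cont (u g : R -> R) : weak_derivative a b u g ->
  exists2 W, abs_cont_deriv a b W g & {ae mu, forall x, x \in `[a, b] -> u x = W x}.
Proof.
move=> wd; have [c uE] := weak_derivative_primitive ab wd; have [_ gi _] := wd.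
exists (fun x => c + itvprim a b g x); last exact: ae_closed_itv.
split => //; first by apply: abs_contD; [exact: abs_cont_cst|exact: abs_cont_itvprim].
apply: ae_mono (itvprim_is_derive gi) => x h /h d.
have d1 := is_deriveD (is_derive_cst c x (1 : R)) d.
by apply: is_derive_eq d1 _; rewrite add0r.
Qed.

Lemma continuous_ae_eq (f g : R -> R) : {within `[a, b], continuous f} ->
  {within `[a, b], continuous g} ->
  {ae mu, forall x, x \in `[a, b] -> f x = g x} ->
  forall x, a <= x <= b -> f x = g x.
Proof.
move=> cf cg fg x xab.
have Cd (h : R -> R) : {within `[a, b], continuous h} -> forall e : R, 0 < e ->
    exists2 d : R, 0 < d & forall y, a <= y <= b -> `|y - x| < d -> `|h y - h x| < e.
  move=> ch e e0; move/subspace_continuousP: ch => /(_ x).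
  rewrite /= in_itv /= xab => /(_ isT) /cvgrPdist_lt/(_ _ e0)[d /= d0 hd].
  exists d => // y yab yx; rewrite distrC; apply: hd; rewrite /= ?in_itv//.
  by rewrite distrC.
apply/eqP; rewrite -subr_eq0 -normr_eq0 eq_le normr_ge0 andbT.
apply/ler_addgt0Pr => e e0; rewrite add0r.
have e2 : 0 < e / 2 by rewrite divr_gt0.
have [d1 d10 h1] := Cd _ cf _ e2; have [d2 d20 h2] := Cd _ cg _ e2.
pose d := Num.min d1 d2; have d0 : 0 < d by rewrite lt_min d10.
pose l := Num.max a (x - d); pose r := Num.min b (x + d).
have lr : l < r.
  by case/andP: xab => ax xb; rewrite /l /r gt_max !lt_min ab /=; apply/andP; split;
    [|apply/andP; split]; lra.
have [z [lz zr /contrapT fgz]] := null_complement_dense fg lr.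
move: lz zr; rewrite /l /r gt_max lt_min => /andP[az xz] /andP[zb zx].
have zab : a <= z <= b by rewrite !ltW.
have zd : `|z - x| < d by rewrite ltr_norml; apply/andP; split; lra.
move: (zd); rewrite /d lt_min => /andP[/(h1 _ zab) k1 /(h2 _ zab) k2].
have e3 : f z = g z by apply: fgz; rewrite in_itv.
rewrite e3 in k1; move: k1 k2 => /ltr_normlP[k1 k1'] /ltr_normlP[k2 k2'].
by rewrite ler_norml; apply/andP; split; lra.
Qed.

(** The weak derivative that [energy] chooses is that of an absolutely continuous
    representative, and the energy does not distinguish representatives. *)
Lemma energy_representation eps (u : R -> R) (E : R) : 0 < eps ->
  measurable_fun `[a, b] u ->
  (energy a b p eps u <= E%:E)%E -> exists W g,
    [/\ abs_cont_deriv a b W g, {ae mu, forall x, x \in `[a, b] -> u x = W x},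
        itvL1 a b (energy_density p eps W g) & itvint a b (energy_density p eps W g) <= E].
Proof.
move=> e0 mu'; rewrite /energy; case: pselect => [wd|]; last by rewrite leye_eq.
set g := projT1 (cid wd); have wdg : weak_derivative a b u g := projT2 (cid wd).
have [W Wg uW] := weak_derivative_abs_cont wdg.
rewrite -[X in (X <= _)%E -> _]/(\int[mu]_(x in `[a, b]) (energy_density p eps u g x)%:E)%E => hE.
exists W, g.
have [ui gi _] := wdg; have [Wa _ _] := Wg.
have mW := abs_cont_measurable Wa.
have mF (f : R -> R) : measurable_fun `[a, b] f ->
    measurable_fun `[a, b] (energy_density p eps f g).
  move=> mf; apply: measurable_funD.
    apply: measurable_funM; last exact: measurable_cst.
    apply: measurable_funM; first exact: measurable_cst.
    apply: (@measurableT_comp _ _ _ _ _ _ (fun s : R => s `^ p)); first exact: measurable_powR.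
    by apply: measurableT_comp => //; exact: itvL1_measurable gi.
  apply: measurable_funM; last exact: measurable_cst.
  apply: (@measurableT_comp _ _ _ _ _ _ (potential p)) => //.
  by apply: continuous_measurable_fun; exact: continuous_potential.
have eu : itvL1 a b (energy_density p eps u g).
  apply/integrableP; split; first by apply/measurable_EFinP; exact: mF.
  apply: (@le_lt_trans _ _ E%:E); last exact: ltry.
  apply: le_trans hE; rewrite le_eqVlt; apply/orP; left; apply/eqP.
  by apply: eq_integral => x _; rewrite /= ger0_norm// energy_density_ge0.
have ae : {ae mu, forall x, x \in `[a, b] -> energy_density p eps u g x = energy_density p eps W g x}.
  by apply: ae_mono uW => x h /h hh; rewrite /energy_density hh.
split => //; first exact: ae_itvL1 (mF _ mW) ae eu.
rewrite -(ae_itvint (mF _ mu') (mF _ mW) ae).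
by rewrite -lee_fin -itvint_EFin.
Qed.

(** At a time at which the equation holds, F'(W) - eps^p q is a subgradient at W of eps
    times the energy, up to a quadratic term.  The gradient part is the convexity of |s|^p / p
    after an integration by parts, whose boundary terms vanish by the Neumann
    conditions; the potential part is [potential_semiconvex]. *)
Lemma subgradient_inequality eps (W w q W0 g0 : R -> R) : 0 < eps ->
  abs_cont_deriv a b W w -> {within `[a, b], continuous w} -> w a = 0 -> w b = 0 ->
  weak_derivative a b (plap p \o w) q ->
  abs_cont_deriv a b W0 g0 -> itvL1 a b (energy_density p eps W0 g0) ->
  itvL1 a b (energy_density p eps W w) /\
  eps * itvint a b (energy_density p eps W w)
  - itvint a b (fun x => (eps `^ p * q x - dpotential p (W x)) * (W0 x - W x))
  - 2^-1 * itvint a b (fun x => (W0 x - W x) ^+ 2)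
  <= eps * itvint a b (energy_density p eps W0 g0).
Proof.
move=> e0 [Wa wi dW] cw wa wb wdq [W0a g0i dW0] ei0.
have [P [Pa qi dP] Pae] := weak_derivative_abs_cont wdq.
have cpw : {within `[a, b], continuous (plap p \o w)}.
  exact: comp_within_continuous (continuous_plap p1) cw.
have PE := continuous_ae_eq cpw (abs_cont_continuous Pa) Pae.
pose Z x := W0 x - W x; pose dZ x := g0 x - w x.
have Za : abs_cont a b Z by exact: abs_contB.
have dZi : itvL1 a b dZ by exact: itvL1B.
have dZP : {ae mu, forall x, a < x < b -> is_derive x 1 Z (dZ x)}.
  by apply: ae_mono (ae_and dW0 dW) => x [h1 h2] xab; apply: is_deriveB; [exact: h1|exact: h2].
have := abs_cont_by_parts (ltW ab) Pa Za qi dZi dP dZP.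
have abl : a <= b by exact: ltW.
rewrite -!PE ?lexx ?abl//= wa wb plap0 !mul0r subrr => ibp.
have cont_comp (f : R -> R) : continuous f -> abs_cont a b W -> itvL1 a b (fun x => f (W x)).
  by move=> cf Wc; apply: continuous_itvL1;
    exact: comp_within_continuous cf (abs_cont_continuous Wc).
have ewi : itvL1 a b (energy_density p eps W w).
  apply: itvL1D.
    apply: (@eq_itvL1 _ _ _ (fun x => eps `^ (p - 1) / p * `|w x| `^ p)).
      by move=> x _; rewrite mulrAC.
    apply: itvL1Z; apply: continuous_itvL1.
    exact: comp_within_continuous (continuous_norm_powR_ge p0) cw.
  apply: (@eq_itvL1 _ _ _ (fun x => eps^-1 * potential p (W x))).
    by move=> x _; rewrite mulrC.
  by apply: itvL1Z; apply: cont_comp => //; exact: continuous_potential.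
split => //.
have PdZi : itvL1 a b (fun x => P x * dZ x).
  by apply: eq_itvL1 (itvL1M_abs_cont dZi Pa) => x _; rewrite mulrC.
have qZi : itvL1 a b (fun x => q x * Z x) by exact: itvL1M_abs_cont.
have FZi : itvL1 a b (fun x => dpotential p (W x) * Z x).
  by apply: itvL1M_abs_cont => //; apply: cont_comp => //; exact: continuous_dpotential.
have Z2i : itvL1 a b (fun x => Z x ^+ 2).
  by apply: (@eq_itvL1 _ _ _ (fun x => Z x * Z x)) => [x _|]; [rewrite expr2|apply: itvL1M_abs_cont => //; exact: abs_cont_itvL1].
have ->: itvint a b (fun x => (eps `^ p * q x - dpotential p (W x)) * Z x) =
   eps `^ p * itvint a b (fun x => q x * Z x) - itvint a b (fun x => dpotential p (W x) * Z x).
  rewrite -itvintZ// -itvintB//; last exact: itvL1Z.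
  by apply: eq_itvint => x _; ring.
have : itvint a b (fun x => eps * energy_density p eps W w x + eps `^ p * (P x * dZ x)
     + dpotential p (W x) * Z x - 2^-1 * Z x ^+ 2) <=
   itvint a b (fun x => eps * energy_density p eps W0 g0 x).
  apply: le_itvint.
  - apply: itvL1B; last exact: itvL1Z.
    by apply: itvL1D => //; apply: itvL1D; apply: itvL1Z.
  - exact: itvL1Z.
  - move=> x xab; rewrite -(PE _ xab) /=.
    have h1 := plap_tangent (w x) (g0 x) p1; have h2 := potential_semiconvex (W x) (W0 x) p1.
    have ep : 0 <= eps `^ p by exact: powR_ge0.
    have h3 := ler_wpM2l ep h1.
    have ee (f g : R -> R) : eps * energy_density p eps f g x = eps `^ p * (`|g x| `^ p / p) + potential p (f x).
      rewrite /energy_density -(mulr_powRB1 (ltW e0) p0); move: (potential _ _) => F.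
      by field; rewrite !gt_eqF.
    rewrite !ee /Z /dZ; move: h3 h2; rewrite mulrDr.
    set X1 := eps `^ p * (`|w x| `^ p / p); set X2 := eps `^ p * (_ * _).
    set X3 := eps `^ p * (`|g0 x| `^ p / p); set X4 := dpotential _ _ * _.
    set X5 := 2^-1 * _; lra.
have i1 : itvL1 a b (fun x => eps * energy_density p eps W w x) by exact: itvL1Z.
have i2 : itvL1 a b (fun x => eps `^ p * (P x * dZ x)) by exact: itvL1Z.
have i3 : itvL1 a b (fun x => 2^-1 * Z x ^+ 2) by exact: itvL1Z.
rewrite itvintB//; last by apply: itvL1D => //; exact: itvL1D.
rewrite itvintD//; last exact: itvL1D.
rewrite itvintD// !itvintZ//.
have -> : itvint a b (fun x => P x * dZ x) = - itvint a b (fun x => q x * Z x) by lra.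
rewrite mulrN; move: (eps `^ p * itvint a b _) (eps * itvint a b _).
move: (itvint a b (fun x => dpotential p _ * _)) (itvint a b (fun x => Z x ^+ 2)).
move: (eps * itvint a b (energy_density p eps W0 g0)) => x1 x2 x3 x4 x5; clear; lra.
Qed.

End pde.

(** * Solutions as gradient flows *)

Section solutions.
Context {R : realType} (a b p eps : R) (u0 : R -> R) (u : R -> R -> R).
Hypothesis ab : a < b.
Hypothesis p1 : 1 < p.
Hypothesis eps0 : 0 < eps.
Hypothesis u_sol : solution a b p eps u0 u.
Local Notation mu := (@lebesgue_measure R).
Local Notation V := (R -> R^o).
Local Notation ip := (@itg_ip R a b).
Local Notation L2 := (@L2norm R a b).

Definition good_time : set R := [set t | 0 < t /\ pde_at a b p eps u t].

Lemma ereal_cvg0_near (T : Type) (F : set_system T) {FF : Filter F} (f : T -> \bar R) (e : R) :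
  f x @[x --> F] --> 0%E -> 0 < e -> \forall x \near F, (f x <= e%:E)%E.
Proof.
move=> /fine_cvgP[ffin /cvgrPdist_le h] e0; have := h _ e0.
apply: filterS2 ffin => x fx; rewrite sub0r normrN => hx.
by rewrite -(fineK fx) lee_fin; exact: le_trans (ler_norm _) hx.
Qed.

Lemma sol_sq_itg t : 0 <= t -> sq_itg a b (u t).
Proof. by case: u_sol => h _ _ _ _ /h /in_Lp2P. Qed.

Lemma sq_itgB (f g : V) : sq_itg a b f -> sq_itg a b g -> sq_itg a b (f - g).
Proof.
move=> Df Dg; exact: (ip_domB (@sq_itgD _ _ _) (@sq_itgZ _ _ _) Df Dg).
Qed.

Lemma sol_continuous t (e : R) : 0 <= t -> 0 < e -> exists2 d : R, 0 < d &
  forall s, 0 <= s -> `|s - t| < d -> L2 (u s - u t : V) <= e.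
Proof.
move=> t0 e0; case: u_sol => _ _ /(_ t t0) c _ _.
have [d /= d0 hd] := ereal_cvg0_near c e0.
exists d => // s s0 st; have := hd s _ s0.
rewrite -lee_fin -Lp_norm2_sq_itg; first by apply; rewrite /= distrC.
by apply: sq_itgB; exact: sol_sq_itg.
Qed.

Lemma sol_continuous0 (e : R) : 0 < e -> exists2 d : R, 0 < d &
  forall s, 0 <= s -> s < d -> L2 (u s - u 0 : V) <= e.
Proof.
move=> e0; have [d d0 hd] := sol_continuous (lexx 0) e0.
by exists d => // s s0 sd; apply: hd => //; rewrite subr0 ger0_norm.
Qed.

Lemma sol_abs_cont s T : 0 < s -> s < T -> exists2 k, itvL1 s T k &
  forall x y, s <= x -> x <= y -> y <= T -> L2 (u y - u x : V) <= itvint x y k.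
Proof.
move=> s0 sT; case: u_sol => _ _ _ /(_ s T s0 sT)[k ki hk] _.
exists k => // x y sx xy yT; have := hk x y sx xy yT.
rewrite (itvint_EFin (itvL1_sub sx yT ki)).
rewrite (Lp_norm2_sq_itg (f := (u y - u x : V))) ?lee_fin//.
have x0 : 0 <= x by rewrite (le_trans (ltW s0)).
by apply: sq_itgB; apply: sol_sq_itg => //; exact: le_trans xy.
Qed.

Lemma good_time_ae : mu.-negligible [set t | 0 < t /\ ~ good_time t].
Proof.
case: u_sol => _ _ _ _ h; apply: negligibleS h => t /= [t0 nG] h.
by apply: nG; split => //; exact: h.
Qed.

(** For D = (W, w, xi): W represents u t, w is its derivative, and xi is the
    derivative of the solution in L^2. *)
Definition time_data (t : R) (D : (R -> R) * (R -> R) * (R -> R)) : Prop :=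
  let: (W, w, xi) := D in
  [/\ abs_cont_deriv a b W w, itvL1 a b (energy_density p eps W w),
      {ae mu, forall x, x \in `[a, b] -> u t x = W x},
      sq_itg a b xi /\ curve_derivative ip (u : R -> V) t xi &
      forall W0 g0, abs_cont_deriv a b W0 g0 -> itvL1 a b (energy_density p eps W0 g0) ->
        eps * itvint a b (energy_density p eps W w) - ip xi (W0 - W : V)
        - 2^-1 * ip (W0 - W : V) (W0 - W : V) <=
        eps * itvint a b (energy_density p eps W0 g0)].

Lemma abs_cont_deriv_sq_itg (W g : R -> R) : abs_cont_deriv a b W g -> sq_itg a b W.
Proof.
move=> [Wa _ _]; have [M [_ WM]] := abs_cont_bounded Wa.
exact: (sq_itg_bounded (abs_cont_measurable Wa) WM).
Qed.

(** The derivative in L^2 is the right-hand side of the equation; that it is itself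
    in L^2, although q is only integrable, follows from the convergence of the
    difference quotients. *)
Lemma good_time_data t : good_time t -> exists D, time_data t D.
Proof.
move=> [t0 [w [q [cw wdu [wa wb] wdq hq]]]].
have Dut : sq_itg a b (u t) by apply: sol_sq_itg; exact: ltW.
have [mut _] := Dut.
have [W Wg uW] := weak_derivative_abs_cont ab wdu.
pose xi : V := fun x => eps `^ p * q x - derive1 (potential p) (u t x).
have xiE x : xi x = eps `^ p * q x - dpotential p (u t x) by rewrite /xi derive1_potential.
have [_ qi _] := wdq; have mq := itvL1_measurable qi.
have mF (f : R -> R) : measurable_fun `[a, b] f -> measurable_fun `[a, b] (fun x => dpotential p (f x)).
  move=> mf; apply: (@measurableT_comp _ _ _ _ _ _ (dpotential p)) => //.
  by apply: continuous_measurable_fun; exact: continuous_dpotential.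
have mG (f : R -> R) : measurable_fun `[a, b] f ->
    measurable_fun `[a, b] (fun x => eps `^ p * q x - dpotential p (f x)).
  move=> mf; apply: measurable_funB; last exact: mF.
  by apply: measurable_funM => //; exact: measurable_cst.
have mxi : measurable_fun `[a, b] (xi : R -> R).
  by rewrite (_ : (xi : R -> R) = fun x => eps `^ p * q x - dpotential p (u t x)); [exact: mG|apply/funext].
have Dquot h : `|h| < t -> sq_itg a b (h^-1 *: (u (t + h) - u t : V)).
  move=> ht; apply: (@sq_itgZ R a b); apply: sq_itgB => //; apply: sol_sq_itg.
  by move: ht; rewrite ltr_norml => /andP[h1 _]; lra.
have quotE h : (fun x => (u (t + h) x - u t x) / h - xi x) =
    (h^-1 *: (u (t + h) - u t : V) - xi).
  by apply/funext => x; rewrite !fctE /GRing.scale /= mulrC.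
have small (e : R) : 0 < e -> exists2 d : R, 0 < d & forall h : R, h != 0 -> `|h| < d ->
    (Lp_norm a b 2 (h^-1 *: (u (t + h) - u t : V) - xi)%R <= e%:E)%E.
  move=> e0; have [d /= d0 hd] := ereal_cvg0_near hq e0.
  exists d => // h h0 hh; rewrite -quotE; apply: hd => //=.
  by rewrite sub0r normrN.
have Dxi : sq_itg a b xi.
  have [d d0 hd] := small _ ltr01; pose h := Num.min d t / 2.
  have m0 : 0 < Num.min d t by rewrite lt_min d0 t0.
  have h0 : 0 < h by rewrite divr_gt0.
  have hm : `|h| < Num.min d t by rewrite gtr0_norm// /h; lra.
  move: hm; rewrite lt_min => /andP[hm1 hm2].
  have Dq := Dquot _ hm2.
  have Dd : sq_itg a b (h^-1 *: (u (t + h) - u t : V) - xi).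
    apply/in_Lp2P; split.
      by apply: measurable_funB => //; case: Dq.
    by apply: le_lt_trans (hd _ _ hm1) (ltry _); rewrite gt_eqF.
  have -> : xi = h^-1 *: (u (t + h) - u t : V) - (h^-1 *: (u (t + h) - u t : V) - xi).
    by rewrite opprB addrC subrK.
  exact: sq_itgB.
exists (W, w, xi).
have DW := abs_cont_deriv_sq_itg Wg; have [mW _] := DW.
have E0 W0 g0 : abs_cont_deriv a b W0 g0 -> itvL1 a b (energy_density p eps W0 g0) ->
  itvL1 a b (energy_density p eps W w) /\
  eps * itvint a b (energy_density p eps W w) - ip xi (W0 - W : V)
        - 2^-1 * ip (W0 - W : V) (W0 - W : V) <= eps * itvint a b (energy_density p eps W0 g0).
  move=> W0g ei0; have [h1 h2] := subgradient_inequality ab p1 eps0 Wg cw wa wb wdq W0g ei0.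
  split => //; have [mW0 _] := abs_cont_deriv_sq_itg W0g.
  have mD : measurable_fun `[a, b] (fun x => W0 x - W x) by exact: measurable_funB.
  have e1 : ip xi (W0 - W : V) =
      itvint a b (fun x => (eps `^ p * q x - dpotential p (W x)) * (W0 x - W x)).
    apply: ae_itvint; first exact: measurable_funM.
      by apply: measurable_funM => //; exact: mG.
    by apply: ae_mono uW => x h /h hx; rewrite xiE hx.
  have e2 : ip (W0 - W : V) (W0 - W : V) = itvint a b (fun x => (W0 x - W x) ^+ 2).
    by apply: eq_itvint => x _; rewrite expr2.
  by rewrite e1 e2.
(* a comparison function of finite energy, to obtain that the energy of W is finite *)
have cst_pair : abs_cont_deriv a b (fun=> 1) (fun=> 0).
  split; [exact: abs_cont_cst|exact: itvL1_cst|].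
  by apply: aeW => x _; exact: is_derive_cst.
have cst_ei : itvL1 a b (energy_density p eps (fun=> 1) (fun=> 0)) by exact: itvL1_cst.
split => //.
- by have [] := E0 _ _ cst_pair cst_ei.
- split => // e e0; have [d d0 hd] := small _ e0.
  exists (Num.min d t); first by rewrite lt_min d0 t0.
  move=> h h0; rewrite lt_min => /andP[h1 h2].
  have := hd _ h0 h1; rewrite Lp_norm2_sq_itg ?lee_fin//.
  by apply: sq_itgB => //; exact: Dquot.
- by move=> W0 g0 W0g ei0; have [] := E0 _ _ W0g ei0.
Qed.

(** This is [flow_dissipation0] for the flow in the space of square integrable
    functions, where phi is eps times the energy of the representatives. *)
Theorem solution_dissipation (W0 g0 : R -> R) : abs_cont_deriv a b W0 g0 ->
  itvL1 a b (energy_density p eps W0 g0) ->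
  {ae mu, forall x, x \in `[a, b] -> u 0 x = W0 x} ->
  forall t, good_time t -> exists W g, [/\ abs_cont_deriv a b W g,
    itvL1 a b (energy_density p eps W g),
    {ae mu, forall x, x \in `[a, b] -> u t x = W x} &
    forall lam : R, 0 < lam -> L2 (u t - u 0 : V) <= t / (2 * lam) +
      lam / 2 * (eps * itvint a b (energy_density p eps W0 g0)
                 - eps * itvint a b (energy_density p eps W g))].
Proof.
move=> W0g ei0 uW0.
have /choice[F FP] : forall t, exists D, good_time t -> time_data t D.
  move=> t; have [G|nG] := pselect (good_time t); last by exists (cst 0, cst 0, cst 0).
  by have [D hD] := good_time_data G; exists D.
pose Wf t := (F t).1.1; pose wf t := (F t).1.2; pose xf t : V := (F t).2.
have FE t : good_time t -> time_data t (Wf t, wf t, xf t).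
  by move=> /FP; rewrite /Wf /wf /xf; case: (F t) => -[].
pose phi t := eps * itvint a b (energy_density p eps (Wf t) (wf t)).
have gt0 t : good_time t -> 0 < t by case.
have DW t : good_time t -> sq_itg a b (Wf t).
  by move=> /FE[Wg _ _ _ _]; exact: abs_cont_deriv_sq_itg Wg.
have ipE t s (W' : V) : good_time t -> sq_itg a b (u s) -> sq_itg a b W' ->
    {ae mu, forall x, x \in `[a, b] -> u s x = W' x} ->
    ip (xf t) (W' - Wf t : V) = ip (xf t) (u s - u t : V) /\
    ip (W' - Wf t : V) (W' - Wf t : V) = ip (u s - u t : V) (u s - u t : V).
  move=> /[dup] Gt /FE[Wg _ uW [Dxi _] _] Ds DW' us.
  have Dt : sq_itg a b (u t) by apply: sol_sq_itg; exact: ltW (gt0 _ Gt).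
  have D1 : sq_itg a b (W' - Wf t : V) by apply: sq_itgB => //; exact: DW.
  have D2 : sq_itg a b (u s - u t : V) by exact: sq_itgB.
  have ae : {ae mu, forall x, x \in `[a, b] -> (W' - Wf t : V) x = (u s - u t : V) x}.
    by apply: ae_mono (ae_and us uW) => x [h1 h2] xab; rewrite !fctE h1// h2.
  have ae1 : {ae mu, forall x, x \in `[a, b] -> xf t x = xf t x} by exact: aeW.
  by split; exact: eq_ae_ip.
move=> t Gt; have [Wg ei uW _ _] := FE _ Gt.
exists (Wf t), (wf t); split => // lam lam0.
apply: (@flow_dissipation0 R V (sq_itg a b) ip (@sq_itgD R a b) (@sq_itgZ R a b) (@itg_ipC R a b)
  (@itg_ip_ge0 R a b) (@itg_ipDl R a b) (@itg_ipZl R a b) (u : R -> V) xf good_time phi sol_sq_itg sol_abs_cont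
  gt0 good_time_ae _ _ _ (eps * itvint a b (energy_density p eps W0 g0)) sol_continuous0 _ t lam Gt lam0).
- by move=> s /FE[_ _ _ []].
- by move=> s /FE[_ _ _ []].
- move=> s s' Gs Gs'; have [_ _ _ _ H] := FE _ Gs; have [Wg' ei' us' _ _] := FE _ Gs'.
  have [<- <-] := ipE _ s' (Wf s') Gs (sol_sq_itg (ltW (gt0 _ Gs'))) (DW _ Gs') us'.
  exact: H Wg' ei'.
- move=> s Gs; have [_ _ _ _ H] := FE _ Gs.
  have [<- <-] := ipE _ 0 W0 Gs (sol_sq_itg (lexx 0)) (abs_cont_deriv_sq_itg W0g) uW0.
  exact: H.
Qed.

End solutions.

(** * Slow motion *)

Section slow_motion.
Context {R : realType} (a b p eps : R) (u0 : R -> R) (u : R -> R -> R) (v : R -> R).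
Hypothesis ab : a < b.
Hypothesis p1 : 1 < p.
Hypothesis eps0 : 0 < eps.
Hypothesis u_sol : solution a b p eps u0 u.
Hypothesis vi : itvL1 a b v.
Local Notation mu := (@lebesgue_measure R).
Local Notation V := (R -> R^o).

Definition L1dist (t : R) : R := itvint a b (fun x => `|u t x - v x|).

Lemma sol_itvL1 t : 0 <= t -> itvL1 a b (u t).
Proof. by move=> t0; apply: sq_itg_itvL1; exact: (sol_sq_itg u_sol). Qed.

Lemma L1dist_lipschitz s t : 0 <= s -> 0 <= t ->
  L1dist s <= L1dist t + Num.sqrt (b - a) * L2norm a b (u s - u t : V).
Proof.
move=> s0 t0.
have Dst : sq_itg a b (u s - u t : V).
  by apply: sq_itgB; exact: (sol_sq_itg u_sol).
have d1 : itvL1 a b (fun x => `|u t x - v x|).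
  by apply: itvL1_norm; apply: itvL1B => //; exact: sol_itvL1.
have d2 : itvL1 a b (fun x => `|u s x - v x|).
  by apply: itvL1_norm; apply: itvL1B => //; exact: sol_itvL1.
have d3 : itvL1 a b (fun x => `|u s x - u t x|).
  by apply: itvL1_norm; apply: itvL1B => //; exact: sol_itvL1.
apply: (@le_trans _ _ (L1dist t + itvint a b (fun x => `|u s x - u t x|))).
  rewrite -itvintD//; apply: le_itvint => //; first exact: itvL1D.
  move=> x _; have -> : u s x - v x = (u t x - v x) + (u s x - u t x) by ring.
  exact: ler_normD.
by rewrite lerD2l; exact: (L1_le_L2norm ab Dst).
Qed.

Lemma L1dist_continuous t (e : R) : 0 <= t -> 0 < e -> exists2 d : R, 0 < d &
  forall s, 0 <= s -> `|s - t| < d -> `|L1dist s - L1dist t| <= e.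
Proof.
move=> t0 e0; have S0 : 0 < Num.sqrt (b - a) by rewrite sqrtr_gt0 subr_gt0.
have e1 : 0 < e / Num.sqrt (b - a) by rewrite divr_gt0.
have [d d0 hd] := sol_continuous u_sol t0 e1.
exists d => // s s0 st; have h := hd s s0 st.
have h1 := L1dist_lipschitz s0 t0; have h2 := L1dist_lipschitz t0 s0.
have Ds := sol_sq_itg u_sol s0; have Dt := sol_sq_itg u_sol t0.
have sym : L2norm a b (u t - u s : V) = L2norm a b (u s - u t : V).
  exact: (ipnormB (@sq_itgD R a b) (@sq_itgZ R a b) (@itg_ipC R a b) (@itg_ipZl R a b) Dt Ds).
rewrite sym in h2.
have h3 : Num.sqrt (b - a) * L2norm a b (u s - u t : V) <= e.
  by rewrite mulrC -ler_pdivlMr.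
by rewrite ler_norml; apply/andP; split; lra.
Qed.

(** As long as the solution stays L^1-close to v, its energy is almost minimal, so
    it has almost no energy left to dissipate and cannot leave.  If the distance
    exceeded beta, it would take the value beta / 2 at an earlier time c; at a good
    time s close to c, dissipation shows that the distance is at most
    beta / 4. *)
Lemma slow_motion (m X C C1 E0 beta : R) : 0 < m -> 0 <= C -> 0 <= C1 -> 0 < beta ->
  L1dist 0 <= beta / 8 ->
  Num.sqrt (b - a) * (Num.sqrt eps * (m + C + C1)) <= beta / 8 ->
  (exists W0 g0, [/\ abs_cont_deriv a b W0 g0, itvL1 a b (energy_density p eps W0 g0),
     {ae mu, forall x, x \in `[a, b] -> u 0 x = W0 x} &
     itvint a b (energy_density p eps W0 g0) <= E0 + C * expR (- X)]) ->
  (forall W g, abs_cont_deriv a b W g -> itvL1 a b (energy_density p eps W g) ->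
     itvint a b (fun z => `|W z - v z|) <= beta ->
     E0 - C1 * expR (- X) <= itvint a b (energy_density p eps W g)) ->
  forall t, 0 <= t -> t <= m * expR X -> L1dist t <= beta.
Proof.
move=> m0 C0 C10 beta0 hinit hsmall [W0 [g0 [W0g ei0 uW0 hE0]]] hlow t t0 tm.
rewrite leNgt; apply/negP => far.
have mid : exists2 c, 0 <= c < t & L1dist c = beta / 2.
  have cD : {within `[0, t], continuous L1dist}.
    apply/subspace_continuousP => x /=; rewrite in_itv /= => /andP[x0 xt].
    apply/cvgrPdist_le => e e0; have [d d0 hd] := L1dist_continuous x0 e0.
    exists d => //= y xy; rewrite in_itv /= => /andP[y0 _].
    by rewrite distrC; apply: hd => //; rewrite distrC.
  have [|c] := @IVT R L1dist 0 t (beta / 2) t0 cD.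
    by rewrite ge_min le_max; apply/andP; split; apply/orP; [left|right]; lra.
  rewrite in_itv /= => /andP[c0 ct] hc; exists c => //; rewrite c0 lt_neqAle ct andbT.
  by apply/eqP => cE; move: far; rewrite -cE hc; lra.
have [c /andP[c0 ct] hc] := mid.
have b8 : 0 < beta / 8 by rewrite divr_gt0.
have [d d0 hd] := L1dist_continuous c0 b8.
have m1 : c < Num.min t (c + d) by rewrite lt_min ct ltrDl.
have [s [cs st Gs]] := good_time_dense (good_time_ae u_sol) c0 m1.
move: st; rewrite lt_min => /andP[st sd].
have s0 : 0 <= s by rewrite (le_trans c0)// ltW.
have sc : `|s - c| < d by rewrite gtr0_norm ?subr_gt0// ltrBlDl.
have := hd s s0 sc; rewrite hc ler_norml => /andP[n1 n2].
have [W [g [Wg ei uW diss]]] := solution_dissipation ab p1 eps0 u_sol W0g ei0 uW0 Gs.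
have [Wa _ _] := Wg; have Wi := abs_cont_itvL1 Wa.
have close : itvint a b (fun z => `|W z - v z|) <= beta.
  have <- : L1dist s = itvint a b (fun z => `|W z - v z|).
    have mv := itvL1_measurable vi; have mW := itvL1_measurable Wi.
    have mus := itvL1_measurable (sol_itvL1 s0).
    apply: ae_itvint.
    - by apply: measurableT_comp => //; exact: measurable_funB.
    - by apply: measurableT_comp => //; exact: measurable_funB.
    - by apply: ae_mono uW => x h /h ->.
  by move: (beta0) n2 => bb; lra.
have low := hlow _ _ Wg ei close.
pose Y := expR X; have Y0 : 0 < Y by exact: expR_gt0.
have YN : expR (- X) = Y^-1 by rewrite expRN.
have se0 : 0 < Num.sqrt eps by rewrite sqrtr_gt0.
(* lam = e^X / sqrt eps makes both terms of the dissipation estimate O(sqrt eps) *)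
have lam0 : 0 < Y / Num.sqrt eps by rewrite divr_gt0.
have := diss _ lam0.
have sm : s <= m * Y by rewrite (le_trans _ tm)// ltW.
have k1 : s / (2 * (Y / Num.sqrt eps)) <= Num.sqrt eps * m.
  rewrite ler_pdivrMr; last exact: mulr_gt0.
  have -> : Num.sqrt eps * m * (2 * (Y / Num.sqrt eps)) = 2 * (m * Y) by field; rewrite gt_eqF.
  have mY0 : 0 <= m * Y by rewrite mulr_ge0// ltW.
  by rewrite (le_trans sm)// ler_peMl// ler1n.
have k2 : Y / Num.sqrt eps / 2 * (eps * itvint a b (energy_density p eps W0 g0)
     - eps * itvint a b (energy_density p eps W g)) <= Num.sqrt eps * (C + C1).
  have dE : itvint a b (energy_density p eps W0 g0) - itvint a b (energy_density p eps W g) <= (C + C1) / Y.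
    apply: (le_trans (lerB hE0 low)).
    by rewrite le_eqVlt; apply/orP; left; apply/eqP; rewrite YN; ring.
  have cc : 0 <= Y / Num.sqrt eps / 2 * eps by apply: mulr_ge0; [apply: mulr_ge0; [exact: ltW lam0|rewrite invr_ge0]|exact: ltW].
  rewrite -mulrBr mulrA; apply: (le_trans (ler_wpM2l cc dE)).
  have -> : Y / Num.sqrt eps / 2 * eps * ((C + C1) / Y) = Num.sqrt eps * (C + C1) / 2.
    by rewrite -{2}(sqr_sqrtr (ltW eps0)); field; rewrite !gt_eqF.
  have q0 : 0 <= Num.sqrt eps * (C + C1) by rewrite mulr_ge0 ?addr_ge0// ltW.
  by rewrite ler_pdivrMr// ler_peMr// ler1n.
move=> k3.
have k4 : L2norm a b (u s - u 0 : V) <= Num.sqrt eps * (m + C + C1).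
  have -> : Num.sqrt eps * (m + C + C1) = Num.sqrt eps * m + Num.sqrt eps * (C + C1) by ring.
  by apply: (le_trans k3); exact: lerD.
have S0 : 0 <= Num.sqrt (b - a) by exact: sqrtr_ge0.
have k5 := ler_wpM2l S0 k4.
have k6 := L1dist_lipschitz s0 (lexx 0).
move: n1 hinit hsmall k5 k6 beta0; clear.
set Z1 := Num.sqrt (b - a) * L2norm _ _ _; set Z2 := Num.sqrt (b - a) * (_ * _).
move: Z1 Z2 (L1dist 0) (L1dist s) => Z1 Z2 D0 Ds; lra.
Qed.

End slow_motion.

Theorem theorem5 (R : realType) (a b p : R) (hab : a < b) (hp : 1 < p)
  (N : nat) (h : nat -> R) (v : R -> R)
  (h_range : forall i, (1 <= i <= N)%N -> a < h i < b)
  (h_incr : forall i, (1 <= i < N)%N -> h i < h i.+1)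
  (v_pc : piecewise_constant a b N h v)
  (r : R) (hr : 0 < r)
  (r_sep : forall i, (1 <= i < N)%N -> h i + r < h i.+1 - r)
  (r_bdry : (0 < N)%N -> a <= h 1%N - r /\ h N + r <= b)
  (A : R) (hA : 0 < A < r * Num.sqrt 2 * lambda_const p)
  (u0 : R -> R -> R) (u : R -> R -> R -> R)
  (u0_H1 : forall eps, 0 < eps -> in_H1 a b (u0 eps))
  (u_sol : forall eps, 0 < eps -> solution a b p eps (u0 eps) (u eps))
  (u0_lim : Lp_norm a b 1 (fun x => u0 eps x - v x) @[eps --> 0^'+] --> 0%E)
  (C : R) (hC : 0 < C)
  (u0_energy : \forall eps \near 0^'+,
     (energy a b p eps (u0 eps)
      <= (N%:R * c_const p + C * expR (- (A * p / (2 * eps))))%:E)%E) :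
  forall m : R, 0 < m ->
  ereal_sup [set Lp_norm a b 1 (fun x => u eps t x - v x) |
             t in [set t | 0 <= t <= m * expR (A * p / (2 * eps))]]
    @[eps --> 0^'+] --> 0%E.
Proof.
move=> m m0.
have p0 : 0 < p by exact: lt_trans hp.
have vi : itvL1 a b v := v_itvL1 hab h_range h_incr v_pc.
have [delta [C1 [e1 [delta0 C10 e10 low]]]] :=
  energy_lower_bound hab hp h_range h_incr v_pc hr r_sep r_bdry hA.
have S0 : 0 < Num.sqrt (b - a) by rewrite sqrtr_gt0 subr_gt0.
suff main (beta : R) : 0 < beta -> beta <= delta -> \forall eps \near 0^'+,
    forall t, 0 <= t <= m * expR (A * p / (2 * eps)) ->
    (Lp_norm a b 1 (fun x => u eps t x - v x)%R <= beta%:E)%E.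
  have sup (beta : R) : 0 < beta -> \forall eps \near 0^'+,
      (0 <= ereal_sup [set Lp_norm a b 1 (fun x => u eps t x - v x)%R |
             t in [set t | (0 <= t <= m * expR (A * p / (2 * eps)))%R]] <= beta%:E)%E.
    move=> beta0; pose bb := Num.min beta delta.
    have bb0 : 0 < bb by rewrite lt_min beta0.
    have bd : bb <= delta by rewrite /bb ge_min lexx orbT.
    have bl : bb <= beta by rewrite /bb ge_min lexx.
    near=> eps.
    have H : forall t, 0 <= t <= m * expR (A * p / (2 * eps)) ->
      (Lp_norm a b 1 (fun x => u eps t x - v x)%R <= bb%:E)%E.
      near: eps; exact: main.
    apply/andP; split.
      apply: (@le_trans _ _ (Lp_norm a b 1 (fun x => u eps 0%R x - v x)%R)).
        by rewrite /Lp_norm Lnorm_ge0.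
      apply: ereal_sup_ubound; exists 0 => //=.
      by rewrite lexx mulr_ge0 ?expR_ge0// ltW.
    apply: ge_ereal_sup => _ [t /= ht <-].
    by apply: (le_trans (H _ ht)); rewrite lee_fin.
  apply/fine_cvgP; split.
    have := sup 1 ltr01; apply: filterS => eps /andP[s1 s2].
    by rewrite ge0_fin_numE//; exact: le_lt_trans s2 (ltry _).
  apply/cvgrPdist_le => beta beta0; have := sup _ beta0.
  apply: filterS => eps /andP[s1 s2] /=.
  have fs : ereal_sup [set Lp_norm a b 1 (fun x => u eps t x - v x)%R |
      t in [set t | 0 <= t <= m * expR (A * p / (2 * eps))]] \is a fin_num.
    by rewrite ge0_fin_numE//; exact: le_lt_trans s2 (ltry _).
  rewrite sub0r normrN ger0_norm ?fine_ge0//.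
  by rewrite -lee_fin fineK.
move=> beta0 bd.
have b4 : 0 < beta / 8 by rewrite divr_gt0.
pose K := Num.sqrt (b - a) * (m + C + C1).
have K0 : 0 < K by rewrite mulr_gt0// ltr_wpDr// addr_gt0.
pose e2 := (beta / 8 / K) ^+ 2.
have e20 : 0 < e2 by rewrite exprn_gt0// divr_gt0.
near=> eps => t /andP[t0 tm].
have eps0 : 0 < eps by near: eps; exact: nbhs_right_gt.
have eps1 : eps < e1 by near: eps; exact: nbhs_right_lt.
have eps2 : eps < e2 by near: eps; exact: nbhs_right_lt.
have hinit : (Lp_norm a b 1 (fun x => u0 eps x - v x)%R <= (beta / 8)%:E)%E.
  by near: eps; exact: ereal_cvg0_near u0_lim b4.
have henergy : (energy a b p eps (u0 eps)
      <= (N%:R * c_const p + C * expR (- (A * p / (2 * eps))))%:E)%E by near: eps.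
have sol := u_sol eps eps0.
have [_ u00 _ _ _] := sol.
have [[mu0 _] _] := u0_H1 eps eps0.
have u0i : itvL1 a b (u0 eps).
  by apply: sq_itg_itvL1; apply/in_Lp2P; case: (u0_H1 eps eps0).
have D0 : L1dist a b (u eps) v 0 <= beta / 8.
  move: hinit; rewrite Lp_norm1_itvL1; last exact: itvL1B.
  rewrite lee_fin; congr (_ <= _); apply: ae_itvint.
  - apply: measurableT_comp => //; apply: measurable_funB => //; exact: itvL1_measurable.
  - apply: measurableT_comp => //; apply: measurable_funB; last exact: itvL1_measurable.
    exact: itvL1_measurable (sol_itvL1 sol (lexx 0)).
  - by apply: ae_mono u00 => x hx /hx ->.
have hs : Num.sqrt (b - a) * (Num.sqrt eps * (m + C + C1)) <= beta / 8.
  have se : Num.sqrt eps <= beta / 8 / K.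
    have q0 : 0 <= beta / 8 / K by rewrite divr_ge0// ltW.
    by rewrite -(ger0_norm q0) -sqrtr_sqr ler_wsqrtr// ltW.
  have -> : Num.sqrt (b - a) * (Num.sqrt eps * (m + C + C1)) = Num.sqrt eps * K.
    by rewrite /K; ring.
  by rewrite -ler_pdivlMr.
have rep : exists W0 g0, [/\ abs_cont_deriv a b W0 g0, itvL1 a b (energy_density p eps W0 g0),
     {ae (@lebesgue_measure R), forall x, x \in `[a, b] -> u eps 0 x = W0 x} &
     itvint a b (energy_density p eps W0 g0) <=
       N%:R * c_const p + C * expR (- (A * p / (2 * eps)))].
  have [W0 [g0 [h1 h2 h3 h4]]] := energy_representation hab hp eps0 mu0 henergy.
  exists W0, g0; split => //.
  by apply: ae_mono (ae_and u00 h2) => x [k1 k2] xab; rewrite k1// k2.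
have := slow_motion hab hp eps0 sol vi m0 (ltW hC) C10 beta0 D0 hs rep _ t0 tm.
rewrite Lp_norm1_itvL1; last exact: (itvL1B (sol_itvL1 sol t0) vi).
rewrite lee_fin; apply => W g Wg ei hW; apply: low => //.
exact: le_trans bd.
Unshelve. all: by end_near. Qed.
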